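(* Let $T$ be a contraction on a complex Hilbert space $\mathcal{H}$. Then $T$ is a maximal element with respect to Harnack domination if and only if $T$ is a singular unitary operator.
   Context: A contraction on $\mathcal{H}$ is a bounded linear operator of norm at most $1$. For contractions $T,T'$ on $\mathcal{H}$, $T$ is Harnack dominated by $T'$ (written $T \prec T'$) if there is a constant $c\ge 1$ such that $\operatorname{Re} p(T)\le c\,\operatorname{Re} p(T')$ for every analytic polynomial $p$ with $\operatorname{Re} p(z)\ge 0$ for all $|z|\le 1$; here $\operatorname{Re} A=\frac12(A+A^* )$ for an operator $A$. A contraction $T$ on $\mathcal{H}$ is maximal with respect to Harnack domination if, for contractions $T'$ on $\mathcal{H}$, $T\prec T'$ implies $T'=T$. A unitary operator is singular if its spectral measure on the unit circle is singular with respect to Lebesgue measure. *)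

(* Defs.v *)
From HB Require Import structures.
From mathcomp Require Import all_boot all_order all_algebra sesquilinear.
From mathcomp Require Import complex.
From mathcomp Require Import all_classical all_reals all_analysis.

Set Implicit Arguments.
Unset Strict Implicit.
Unset Printing Implicit Defensive.

Import Order.TTheory GRing.Theory Num.Theory.
Import numFieldNormedType.Exports.

Local Open Scope classical_set_scope.
Local Open Scope ring_scope.
Local Open Scope complex_scope.

(* The inner product is linear in its first argument. *)
HB.mixin Record hasInnerProduct (R : realType) H
    of CompleteNormedModule R[i] H := {
  inner : {dot H for (@Num.conj R[i])} ;
  inner_normE : forall x : H, inner x x = `|x| ^+ 2 }.

#[short(type="hilbertType")]
HB.structure Definition Hilbert (R : realType) :=
  { H of CompleteNormedModule R[i] H & hasInnerProduct R H }.

Notation "''[' x , y ]" := (inner x y) : ring_scope.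

Section Operators.
Context {R : realType} {H : hilbertType R}.
Implicit Types (A B : H -> H) (T : {linear H -> H}) (p : {poly R[i]}).

Definition contraction_op T := forall x, `|T x| <= `|x|.

Definition is_adjoint A B := forall x y, '[A x, y] = '[x, B y].

(* By the Riesz representation theorem a bounded linear operator has exactly
   one adjoint; the default value 0 only concerns unbounded operators. *)
Definition adjoint A : H -> H := xget (cst 0) [set B | is_adjoint A B].

Definition op_le A B := forall x, '[A x, x] <= '[B x, x].

Definition op_Re A : H -> H := fun x => 2%:R^-1 *: (A x + adjoint A x).

Definition op_horner p T : H -> H :=
  fun x => \sum_(k < size p) p`_k *: iter k T x.

Definition harnack_dominated T T' := exists2 c : R, 1 <= c &
  forall p, (forall z : R[i], `|z| <= 1 -> 0 <= complex.Re p.[z]) ->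
    op_le (op_Re (op_horner p T))
          (fun x => c%:C *: op_Re (op_horner p T') x).

Definition harnack_maximal T := contraction_op T /\
  forall T' : {linear H -> H}, contraction_op T' -> harnack_dominated T T' ->
    T' = T :> (H -> H).

Definition unitary_op T := adjoint T \o T = id /\ T \o adjoint T = id.

End Operators.

Section Circle.
Context (R : realType).

Definition borelC := g_sigma_algebraType (@open R[i]^o).

Definition unit_circle : set borelC := [set z : R[i] | `|z| = 1].

Definition expi (t : R) : borelC := cos t +i* sin t.

(* Arc length, as a measure on the complex plane carried by the circle. *)
Definition circle_lebesgue (B : set borelC) : \bar R :=
  lebesgue_measure (`[0, 2 * pi[%classic `&` expi @^-1` B).

Definition mutually_singular (mu nu : set borelC -> \bar R) :=
  exists N : set borelC, [/\ measurable N, mu (~` N) = 0%E & nu N = 0%E].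

End Circle.

Section SpectralMeasure.
Context {R : realType} {H : hilbertType R}.
Implicit Types (E : set (borelC R) -> {linear H -> H}) (T : {linear H -> H}).

Definition orthogonal_projection (P : {linear H -> H}) :=
  P \o P = P :> (H -> H) /\ is_adjoint P P.

Definition projection_valued_measure E :=
  [/\ forall B, measurable B -> orthogonal_projection (E B),
      E (@unit_circle R) = id :> (H -> H) &
      forall F : (set (borelC R))^nat,
        (forall n, measurable (F n)) -> trivIset setT F ->
        forall x, series (fun n => E (F n) x) @ \oo --> E (\bigcup_n F n) x].

Definition scalar_measure E (x : H) (B : set (borelC R)) : \bar R :=
  (complex.Re '[E B x, x])%:E.

(* T is the integral of z against E in the weak sense; by polarization the
   diagonal coefficients <E(.)x, x> suffice. *)
Definition spectral_measure T E := projection_valued_measure E /\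
  forall x, '[T x, x] =
    fine (\int[scalar_measure E x]_(z in @unit_circle R) (complex.Re z)%:E) +i*
    fine (\int[scalar_measure E x]_(z in @unit_circle R) (complex.Im z)%:E).

(* Singularity of the vector-valued measure E is singularity of all the
   measures <E(.)x, x>, with a null set depending on x: a single null set
   carrying E exists for separable H but not in general. *)
Definition singular_unitary T := unitary_op T /\
  exists2 E, spectral_measure T E &
    forall x, mutually_singular (scalar_measure E x) (@circle_lebesgue R).

End SpectralMeasure.

(* Main.v *)
Require Import Defs.
From HB Require Import structures.
From mathcomp Require Import all_boot all_order all_algebra.
From mathcomp Require Import sesquilinear complex.
From mathcomp Require Import all_classical all_reals all_analysis.
From mathcomp Require Import measurable_realfun.
From mathcomp Require Import ring lra.

(** Why the theorem holds.

    Harnack domination is a comparison of energies. Feed inputs g_0, g_1, ... to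
    the system s_(j+1) = T s_j + g_j started at s_0 = 0. Its energy after n steps
    is |s_n|^2 plus what has been lost, the sum of |s_j|^2 - |T s_j|^2. For the
    inputs w^j x with |w| = 1 the energy is the value at x of the quadratic form
    Re p(T), where p is an unnormalized Fejer kernel (fejer_energy), and the same
    computation for scalars shows that Re p is nonnegative on the disc
    (fejer_positive). Hence domination of T by T' compares the energies of all
    geometric inputs (harnack_energy). Conversely every polynomial with
    nonnegative real part is, up to a relatively small error, an average of
    Fejer kernels over roots of unity (energy_harnack). From there on only
    energies are used.

    A maximal contraction is unitary. Say that q has bounded density if the
    inputs al_j q have energy at most C times the sum of |al_j|^2. Adding to T a
    rank one operator that maps x to <x, e> q, for such a q, gives an operator
    T' that dominates T, provided the defect |x|^2 - |T' x|^2 controls both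
    |<x, e>|^2 and the defect of T (energy_perturb). If T is an isometry and u
    has bounded density, this applies to T' = T (1 - P), where P is the
    projection onto u; so a maximal isometry has no vector of bounded density
    but 0 (isometry_bounded_density). Let A be the adjoint of T. The vectors
    v - T A v always have bounded density (bounded_density_codefect), and when T
    is no isometry a small e in the range of 1 - A T makes the perturbation
    along q = v - T A v work. So T A = 1 (maximal_coisometry). Energies of T and
    A on conjugate inputs agree, so A is maximal too, and T is unitary.

    A singular unitary is maximal. Let T be unitary and dominated by T', and let
    g = (T - T') h. Both w h - T h and w h - T' h are inputs to which the
    respective system answers with bounded states, so the sums of w^j T^(n-1-j) g
    over j < n have norm of order sqrt n, uniformly in w (difference_growth).
    On the spectral subspace of an arc of length e around w, T is w up to e, and
    about 1/e of these terms add up coherently. This forces |E(arc) g|^2 to be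
    of order e (growth_local): the spectral measure of g is absolutely
    continuous. As it is also singular, it vanishes, and T' h = T h.

    A maximal contraction is singular. The spectral theorem for the unitary T is
    derived from its orbits. The norms of the sums of w^(-k) T^k x over k < N, at
    the roots of unity w, define discrete measures of mass |x|^2; their
    distribution functions converge along an ultrafilter, and the limits define
    a measure mu_x on the circle. If an operator A is, like a polynomial in T and
    its inverse, a function f of T, then mu_(A x) has density |f|^2 with respect
    to mu_x (line_symbol). These measures determine the spectral projections:
    E(B) x is the vector p such that mu_p is carried by B and mu_(x - p) by its
    complement. Such a p exists when B is a disk, as a limit of polynomials in T
    and its inverse applied to x (splitting_threshold), and the sets B for which
    every x can be split in this way form a sigma-algebra. If finally mu_x is at
    most c times arc length on a set N, then E(N) x has bounded density, by
    Parseval's identity and Riemann sums (dominated_bounded_density), so it is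
    0 and mu_x(N) = 0. Taking for N the negative sets of mu_x - c (arc length),
    c = 0, 1, 2, ..., leaves mu_x carried by a null set
    (maximal_mutually_singular). *)

Set Implicit Arguments.
Unset Strict Implicit.
Unset Printing Implicit Defensive.

Import Order.TTheory GRing.Theory Num.Theory.
Import numFieldNormedType.Exports.

Local Open Scope classical_set_scope.
Local Open Scope ring_scope.
Local Open Scope complex_scope.

Local Notation Re := complex.Re.
Local Notation Im := complex.Im.

(** * Hilbert space preliminaries *)

Section RealInnerProduct.
Context {R : realType} {H : hilbertType R}.
Implicit Types (x y z : H) (c : R[i]).

(** The norm of a complex Hilbert space takes values in R[i]; computations with
   real inequalities are done with the real part of the inner product and its
   square norm instead. *)
Definition rip x y : R := Re '[x, y].
Definition sq x : R := rip x x.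
Definition csq c : R := Re c ^+ 2 + Im c ^+ 2.

Lemma innerDl x y z : '[x + y, z] = '[x, z] + '[y, z].
Proof. exact: linearDl. Qed.
Lemma innerDr x y z : '[z, x + y] = '[z, x] + '[z, y].
Proof. exact: linearDr. Qed.
Lemma innerZl c x y : '[c *: x, y] = c * '[x, y].
Proof. exact: linearZl. Qed.
Lemma innerC x y : '[x, y] = conjc '[y, x].
Proof. by rewrite (hermC inner x y) expr0 mul1r. Qed.
Lemma innerZr c x y : '[x, c *: y] = conjc c * '[x, y].
Proof. by rewrite innerC innerZl rmorphM /= -innerC. Qed.
Lemma innerxx x : '[x, x] = (sq x)%:C.
Proof.
apply/eqP; rewrite eq_complex /= eqxx /=.
have := innerC x x; case: '[x, x] => a b /= [] h.
by apply/eqP; lra.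
Qed.

Lemma ripC x y : rip x y = rip y x.
Proof. by rewrite /rip innerC; case: '[y, x]. Qed.
Lemma ripDl x y z : rip (x + y) z = rip x z + rip y z.
Proof. by rewrite /rip innerDl raddfD. Qed.
Lemma ripDr x y z : rip x (y + z) = rip x y + rip x z.
Proof. by rewrite !(ripC x) ripDl. Qed.
Lemma ripNl x y : rip (- x) y = - rip x y.
Proof. by rewrite /rip -scaleN1r innerZl mulN1r raddfN. Qed.
Lemma ripNr x y : rip x (- y) = - rip x y.
Proof. by rewrite !(ripC x) ripNl. Qed.
Lemma rip0l x : rip 0 x = 0.
Proof. by rewrite /rip linear0l. Qed.
Lemma rip0r x : rip x 0 = 0.
Proof. by rewrite ripC rip0l. Qed.
Lemma ripZl (a : R) x y : rip (a%:C *: x) y = a * rip x y.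
Proof. by rewrite /rip innerZl; case: '[x, y] => u v /=; rewrite mul0r subr0. Qed.
Lemma ripZr (a : R) x y : rip x (a%:C *: y) = a * rip x y.
Proof. by rewrite ripC ripZl ripC. Qed.
Lemma sq_ge0 x : 0 <= sq x.
Proof.
have : 0 <= '[x, x] by rewrite inner_normE exprn_ge0.
by rewrite innerxx ler0c.
Qed.

Lemma norm_sq x : `|x| = (Num.sqrt (sq x))%:C.
Proof.
apply/eqP; rewrite -(@eqrXn2 _ 2) //; first last.
- by rewrite ler0c sqrtr_ge0.
- rewrite -inner_normE innerxx expr2 -rmorphM /= -expr2 sqr_sqrtr ?sq_ge0 //.
Qed.

Lemma sq_eq0 x : sq x = 0 -> x = 0.
Proof. by move=> h; apply/eqP; rewrite -normr_eq0 norm_sq h sqrtr0. Qed.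
Lemma sq0 : sq 0 = 0. Proof. exact: rip0l. Qed.
Lemma sq_gt0 x : x != 0 -> 0 < sq x.
Proof.
move=> x0; rewrite lt_neqAle sq_ge0 andbT eq_sym.
by apply: contraNneq x0 => /sq_eq0 ->.
Qed.

Lemma sqD x y : sq (x + y) = sq x + sq y + 2 * rip x y.
Proof. by rewrite /sq !ripDl !ripDr (ripC y x); lra. Qed.
Lemma sqN x : sq (- x) = sq x.
Proof. by rewrite /sq ripNl ripNr opprK. Qed.
Lemma sqB x y : sq (x - y) = sq x + sq y - 2 * rip x y.
Proof. by rewrite sqD sqN ripNr mulrN. Qed.
Lemma sqZ c x : sq (c *: x) = csq c * sq x.
Proof.
rewrite /sq {1}/rip innerZl innerZr innerxx /csq /=.
by case: c => a b /=; ring.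
Qed.
Lemma csqC (a : R) : csq a%:C = a ^+ 2.
Proof. by rewrite /csq /= expr0n /= addr0. Qed.
Lemma csqM c d : csq (c * d) = csq c * csq d.
Proof. by case: c d => a b [e f]; rewrite /csq /=; ring. Qed.
Lemma csq_ge0 c : 0 <= csq c.
Proof. by rewrite /csq addr_ge0 // sqr_ge0. Qed.
Lemma csq_norm c : `|c| = (Num.sqrt (csq c))%:C.
Proof. by rewrite normc_def. Qed.
Lemma sq_le2 x y : sq (x + y) <= 2 * sq x + 2 * sq y.
Proof. by have := sq_ge0 (x - y); rewrite sqB sqD; lra. Qed.
Lemma sq_le2B x y : sq (x - y) <= 2 * sq x + 2 * sq y.
Proof. by have := sq_le2 x (- y); rewrite sqN. Qed.

(** Complete the square at t = - b / d; the case d = 0 forces b = 0. *)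
Lemma discr_le (a b d : R) : 0 <= a -> 0 <= d ->
  (forall t : R, 0 <= a + 2 * t * b + t ^+ 2 * d) -> b ^+ 2 <= a * d.
Proof.
move=> a0 d0 h; have [d00|dn0] := eqVneq d 0.
  have [b0|bn0] := eqVneq b 0; first by rewrite b0 expr0n /= mulr_ge0.
  have := h (- (a + 1) / (2 * b)); rewrite d00.
  have -> : a + 2 * (- (a + 1) / (2 * b)) * b + (- (a + 1) / (2 * b)) ^+ 2 * 0
    = -1 by field.
  by move=> ?; lra.
have dp : 0 < d by rewrite lt_neqAle eq_sym dn0.
have := h (- b / d).
have -> : a + 2 * (- b / d) * b + (- b / d) ^+ 2 * d = a - b ^+ 2 / d by field.
by rewrite subr_ge0 ler_pdivrMr.
Qed.

Lemma rip_CS x y : rip x y ^+ 2 <= sq x * sq y.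
Proof.
apply: discr_le; rewrite ?sq_ge0 // => t.
have := sq_ge0 (x + t%:C *: y); rewrite sqD sqZ csqC ripZr.
by congr (_ <= _); ring.
Qed.

Lemma norm_contraction (f : H -> H) :
  (forall x, `|f x| <= `|x|) <-> (forall x, sq (f x) <= sq x).
Proof.
split=> h x; have := h x.
  by rewrite !norm_sq lecR ler_psqrt ?nnegrE ?sq_ge0.
by rewrite !norm_sq lecR ler_psqrt ?nnegrE ?sq_ge0.
Qed.

Lemma Im_inner x y : Im '[x, y] = rip x ('i *: y).
Proof. by rewrite /rip innerZr; case: '[x, y] => a b /=; ring. Qed.

Lemma inner_rip x y : '[x, y] = rip x y +i* rip x ('i *: y).
Proof. by rewrite -Im_inner /rip; case: '[x, y]. Qed.

End RealInnerProduct.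

Section Projection.
Context {R : realType} {H : hilbertType R}.
Implicit Types (x y z : H) (c : R[i]).

Lemma inv_succ_lt (e : R) : 0 < e ->
  exists k, forall j, (k <= j)%N -> j.+1%:R^-1 < e.
Proof.
move=> e0; exists (Num.truncn e^-1) => j kj.
rewrite -[ltRHS]invrK ltf_pV2 ?posrE ?invr_gt0 //.
by apply: (lt_le_trans (truncnS_gt _)); rewrite ler_nat.
Qed.

Definition sq_cvg (u : nat -> H) (l : H) :=
  forall e : R, 0 < e -> exists N, forall n, (N <= n)%N -> sq (u n - l) < e.

Lemma norm_lt_sq x (e : R) : 0 < e -> (`|x| < e%:C) = (sq x < e ^+ 2).
Proof.
move=> e0; rewrite norm_sq ltcR.
have {1}-> : e = Num.sqrt (e ^+ 2) by rewrite sqrtr_sqr gtr0_norm.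
by rewrite ltr_sqrt // exprn_gt0.
Qed.

Lemma sq_complete (u : nat -> H) :
  (forall e : R, 0 < e -> exists N, forall n m, (N <= n)%N -> (N <= m)%N ->
     sq (u n - u m) < e) -> exists l, sq_cvg u l.
Proof.
move=> hu.
have pos (eps : R[i]) : 0 < eps -> exists2 e : R, 0 < e & eps = e%:C.
  case: eps => a b; rewrite ltcE /= => /andP[/eqP-> a0]; exists a => //.
have cu : cauchy (u @ \oo).
  apply/cauchy_ballP => eps /pos[e e0 ->].
  have [N hN] := hu (e ^+ 2) (exprn_gt0 2 e0).
  exists ((u @` [set n | (N <= n)%N]), (u @` [set n | (N <= n)%N])) => /=.
    by split; exists N => // n /= Nn; exists n.
  case=> a b /= [[n /= Nn <-] [m /= Nm <-]].
  by rewrite -ball_normE /ball_ /= norm_lt_sq // hN.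
exists (lim (u @ \oo)) => e e0.
have cl : u @ \oo --> lim (u @ \oo) by exact: (cauchy_cvg (u @ \oo) cu).
move/cvgrPdist_lt: cl => h.
have [|N _ hN] := h (Num.sqrt e)%:C; first by rewrite ltcR sqrtr_gt0.
exists N => n Nn; have := hN n Nn; rewrite /= norm_lt_sq ?sqrtr_gt0 //.
by rewrite sqr_sqrtr ?(ltW e0) // -sqN opprB.
Qed.

Record closed_subspace (M : set H) : Prop := ClosedSubspace {
  csub0 : M 0;
  csubD : forall x y, M x -> M y -> M (x + y);
  csubZ : forall c x, M x -> M (c *: x);
  csub_closed : forall x, (forall e : R, 0 < e -> exists2 y, M y & sq (x - y) < e) -> M x }.

Lemma inner_eq0 x y : (forall c, rip x (c *: y) = 0) -> '[x, y] = 0.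
Proof.
by move=> h; rewrite inner_rip h -[y]scale1r h.
Qed.

(** Nearest points are orthogonal feet. By the parallelogram law a sequence in M
   that minimizes the distance to x is a Cauchy sequence. *)
Lemma projection_exists (M : set H) : closed_subspace M ->
  forall x, exists2 y, M y & forall z, M z -> '[x - y, z] = 0.
Proof.
move=> [M0 MD MZ Mc] x.
have MB a b : M a -> M b -> M (a - b).
  by move=> Ma Mb; apply: MD => //; rewrite -scaleN1r; apply: MZ.
pose D := [set sq (x - y) | y in M].
have lbD : lbound D 0 by move=> _ [y _ <-]; apply: sq_ge0.
have hiD : has_inf D by split; [exists (sq (x - 0)); exists 0 | exists 0].
pose d := inf D.
have dle y : M y -> d <= sq (x - y) by move=> My; apply: ge_inf; [exists 0|exists y].
have d0 : 0 <= d by apply: lb_le_inf => //; exact: hiD.1.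
have near_ n : exists y, M y /\ sq (x - y) < d + n.+1%:R^-1.
  have [|_ [y My <-] h] := @inf_adherent R D n.+1%:R^-1 _ hiD; first by rewrite invr_gt0.
  by exists y.
have /choice[u hu] := near_.
have par n m : sq (u n - u m) <= 2 * n.+1%:R^-1 + 2 * m.+1%:R^-1.
  have aux (a b r d' p q : R) : a < d' + p -> b < d' + q ->
      d' <= 2%:R^-1 ^+ 2 * (a + b + 2 * r) -> b + a - 2 * r <= 2 * p + 2 * q.
    by move=> h1 h2; rewrite expr2 => h3; lra.
  have [Mn hn] := hu n; have [Mm hm] := hu m.
  have := dle (2%:R^-1%:C *: (u n + u m)) (MZ _ _ (MD _ _ Mn Mm)).
  have -> : x - 2%:R^-1%:C *: (u n + u m) = 2%:R^-1%:C *: ((x - u n) + (x - u m)).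
    have {1}-> : x = 2%:R^-1%:C *: (x + x).
      rewrite -[in RHS](scale1r x) -scalerDl scalerA.
      have -> : 2%:R^-1%:C * (1 + 1) = 1 :> R[i].
        by apply/eqP; rewrite eq_complex /=; apply/andP; split; apply/eqP; field.
      by rewrite scale1r.
    by rewrite -scalerBr; congr (_ *: _); rewrite opprD addrACA.
  rewrite sqZ csqC => h1.
  have -> : u n - u m = (x - u m) - (x - u n) by rewrite opprB [RHS]addrC subrKA.
  move: h1; rewrite (sqD (x - u n)) (sqB (x - u m)) (ripC (x - u m)); exact: aux.
have [|l hl] := @sq_complete u.
  move=> e e0; have [k hk] := inv_succ_lt (divr_gt0 e0 (ltr0Sn R 3)).
  exists k => n m kn km; apply: (le_lt_trans (par n m)).
  move: (hk _ kn) (hk _ km); move: (n.+1%:R^-1) (m.+1%:R^-1) => p q; lra.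
have Ml : M l.
  apply: Mc => e e0; have [N hN] := hl e e0; exists (u N); first exact: (hu N).1.
  by rewrite -sqN opprB; exact: hN.
have minl : sq (x - l) <= d.
  (* The distance is attained, as u n is both nearly closest to x and near l. *)
  apply/ler_addgt0Pr => e e0.
  pose s := Num.min 1 (e / (2 * (d + 3))).
  have s0 : 0 < s by rewrite lt_min ltr01 /= divr_gt0 // mulr_gt0 //; lra.
  have s1 : s <= 1 by rewrite ge_min lexx.
  have se : s * (d + 3) <= e / 2.
    have : s <= e / (2 * (d + 3)) by rewrite ge_min lexx orbT.
    rewrite ler_pdivlMr; last by rewrite mulr_gt0 //; lra.
    by lra.
  have [N hN] := hl (s ^+ 2) (exprn_gt0 2 s0).
  have [k hk] := inv_succ_lt s0.
  pose n := maxn N k.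
  have h1 := hN n (leq_maxl _ _).
  have h2 : sq (x - u n) < d + s.
    by apply: (lt_trans (hu n).2); rewrite ltrD2l; apply: hk; rewrite leq_maxr.
  have -> : x - l = (x - u n) + (u n - l) by rewrite addrA subrK.
  (* 2 <a,b> <= s |a|^2 + |b|^2 / s *)
  have h3 : 2 * rip (x - u n) (u n - l) <= s * sq (x - u n) + s.
    have h4 := sq_ge0 (s%:C *: (x - u n) - (u n - l)).
    rewrite (sqB (s%:C *: _)) sqZ csqC ripZl in h4.
    rewrite -(ler_pM2l s0); rewrite mulrDr; nra.
  rewrite (sqD (x - u n)); nra.
exists l => // z Mz; apply: inner_eq0 => c.
have Mcz := MZ c _ Mz; move: (c *: z) Mcz => {z Mz c} z Mz.
apply/eqP; rewrite -sqrf_eq0 -subr_eq0 subr0 eq_le sqr_ge0 andbT.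
have := @discr_le _ 0 (rip (x - l) z) (sq z); rewrite mul0r; apply=> //; first exact: sq_ge0.
move=> t; have := dle (l - t%:C *: z) (MB _ _ Ml (MZ _ _ Mz)).
rewrite opprB addrCA addrC (sqD (x - l)) sqZ csqC ripZr => h.
by have := le_trans minl h; lra.
Qed.

(** If f is not zero, a vector w orthogonal to its kernel represents it up to
   scaling, since x - (f x / f w) *: w lies in the kernel. *)
Lemma riesz (f : H -> R[i]) (K : R) :
  (forall x y, f (x + y) = f x + f y) -> (forall c x, f (c *: x) = c * f x) ->
  (forall x, csq (f x) <= K * sq x) ->
  exists y, forall x, f x = '[x, y].
Proof.
move=> fD fZ fK.
have f0 : f 0 = 0 by rewrite -(scale0r (0 : H)) fZ mul0r.
have fB x y : f (x - y) = f x - f y by rewrite fD -scaleN1r fZ mulN1r.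
have csq0 (z : R[i]) : csq z = 0 -> z = 0.
  by move=> h; apply/eqP; rewrite -normr_eq0 csq_norm h sqrtr0.
have cs : closed_subspace [set x | f x = 0].
  split=> //= [x y fx fy|c x fx|x hx].
  - by rewrite fD fx fy addr0.
  - by rewrite fZ fx mulr0.
  - apply: csq0; apply/eqP; rewrite eq_le csq_ge0 andbT.
    apply/ler_addgt0Pr => e e0; rewrite add0r.
    have K1 : 0 < `|K| + 1 by rewrite ltr_wpDl.
    have [y /= fy hy] := hx (e / (`|K| + 1)) (divr_gt0 e0 K1).
    have -> : f x = f (x - y) by rewrite fB fy subr0.
    apply: (le_trans (fK _)); move: hy; rewrite ltr_pdivlMr // => hy.
    have := ler_norm K; have := sq_ge0 (x - y); nra.
have [ker|/existsNP[x0 fx0]] := pselect (forall x, f x = 0).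
  by exists 0 => x; rewrite ker linear0r.
have [p fp hp] := projection_exists cs x0.
pose w := x0 - p.
have fw : f w = f x0 by rewrite fB fp subr0.
have w0 : w != 0 by apply/eqP => h; apply: fx0; rewrite -fw h f0.
have sw : (sq w)%:C != 0 :> R[i].
  by rewrite -[0]/(0%:C) (inj_eq (@complexI _)) gt_eqF // sq_gt0.
exists (conjc (f w / (sq w)%:C) *: w) => x.
rewrite innerZr conjcK.
have ker : f (x - (f x / f w) *: w) = 0.
  by rewrite fB fZ mulfVK ?subrr // fw; apply/eqP.
have : '[w, x - (f x / f w) *: w] = 0 by exact: hp.
rewrite innerC => /(congr1 (@conjc R)); rewrite conjcK conjc0.
rewrite innerDl -scaleN1r !innerZl mulN1r innerxx => /eqP; rewrite subr_eq0 => /eqP ->.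
have fw0 : f w != 0 by rewrite fw; apply/eqP.
move: sw fw0; move: (f w) (f x) (_%:C) => a b s s0 a0.
by field; rewrite a0 s0.
Qed.

Lemma csq_inner x y : csq '[x, y] <= sq x * sq y.
Proof.
have [->|h] := eqVneq '[x, y] 0; first by rewrite /csq /= expr0n addr0 mulr_ge0 ?sq_ge0.
have := rip_CS x ('[x, y] *: y); rewrite /rip innerZr sqZ.
have -> : Re (conjc '[x, y] * '[x, y]) = csq '[x, y].
  by case: '[x, y] => a b; rewrite /csq /=; ring.
have : 0 < csq '[x, y].
  rewrite lt_neqAle csq_ge0 andbT eq_sym; apply: contraNneq h => h.
  by rewrite -normr_eq0 csq_norm h sqrtr0.
by move=> c0; rewrite expr2 mulrCA ler_pM2l.
Qed.

Lemma adjoint_exists (A : H -> H) (K : R) :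
  (forall x y, A (x + y) = A x + A y) -> (forall c x, A (c *: x) = c *: A x) ->
  (forall x, sq (A x) <= K * sq x) -> is_adjoint A (adjoint A).
Proof.
move=> AD AZ AK.
have ex y : exists z, forall x, '[A x, y] = '[x, z].
  apply: (@riesz (fun x => '[A x, y]) (K * sq y)) => [u v|c u|u].
  - by rewrite AD innerDl.
  - by rewrite AZ innerZl.
  - apply: (le_trans (csq_inner _ _)).
    by rewrite mulrAC ler_wpM2r // sq_ge0.
have [B hB] := choice ex.
have : exists B, is_adjoint A B by exists B => x y; apply: hB.
by move=> /(xgetPex (cst 0)).
Qed.

Lemma inner_inj x y : (forall z, '[z, x] = '[z, y]) -> x = y.
Proof.
move=> h; apply/eqP; rewrite -subr_eq0; apply/eqP/sq_eq0.
rewrite /sq /rip innerDr -scaleN1r innerZr h -innerZr scaleN1r -innerDr subrr.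
by rewrite linear0r.
Qed.

Lemma is_adjointC (A B : H -> H) : is_adjoint A B -> is_adjoint B A.
Proof. by move=> h x y; rewrite innerC -h -innerC. Qed.

Lemma is_adjointD (A B : H -> H) : is_adjoint A B ->
  forall x y, B (x + y) = B x + B y.
Proof. by move=> h x y; apply: inner_inj => z; rewrite innerDr -!h innerDr. Qed.

Lemma is_adjointZ (A B : H -> H) : is_adjoint A B ->
  forall c x, B (c *: x) = c *: B x.
Proof. by move=> h c x; apply: inner_inj => z; rewrite innerZr -!h innerZr. Qed.

Lemma rip_adj (A B : H -> H) : is_adjoint A B -> forall x y, rip (A x) y = rip x (B y).
Proof. by move=> h x y; rewrite /rip h. Qed.

Lemma sq_adj (A B : H -> H) : is_adjoint A B ->
  (forall x, sq (A x) <= sq x) -> forall x, sq (B x) <= sq x.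
Proof.
move=> h hA x; have [->|/eqP n0] := pselect (B x = 0).
  by rewrite sq0 sq_ge0.
have := rip_CS (A (B x)) x; rewrite (rip_adj h) -/(sq (B x)) => h1.
have := sq_gt0 n0; have := hA (B x); have := sq_ge0 x => *.
rewrite -(@ler_pM2l _ (sq (B x))) // -expr2; apply: (le_trans h1).
by rewrite ler_wpM2r.
Qed.

End Projection.

(** * Driven systems and their energy *)

Section Energy.
Context {R : realType} {H : hilbertType R}.
Implicit Types (x y z : H) (c : R[i]) (T : {linear H -> H}) (g : nat -> H).

(** The state at time n of the system s_(j+1) = T s_j + g_j with s_0 = 0. *)
Fixpoint drive T g n : H := if n is m.+1 then T (drive T g m) + g m else 0.

Definition defect T x : R := sq x - sq (T x).

(** What the state still contains plus what the contraction has dissipated. *)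
Definition energy T g n : R :=
  sq (drive T g n) + \sum_(j < n) defect T (drive T g j).

Definition sq_contraction T := forall x, sq (T x) <= sq x.

(** For unitary T this says that the spectral measure of q has a bounded density
   with respect to arc length: the energy is then the integral of |f|^2 against
   that measure, where f is a trigonometric polynomial with coefficients al_j. *)
Definition bounded_density T q := exists2 C : R, 0 <= C &
  forall (al : nat -> R[i]) n,
    energy T (fun j => al j *: q) n <= C * \sum_(j < n) csq (al j).

Lemma contraction_sq T : contraction_op T <-> sq_contraction T.
Proof. exact: norm_contraction. Qed.

(** The dissipated part telescopes against the growth of the state, so the energy
   only changes by what the input feeds in. *)
Lemma energyS T g n :
  energy T g n.+1 = energy T g n + (sq (g n) + 2 * rip (T (drive T g n)) (g n)).
Proof. by rewrite /energy big_ord_recr /= sqD /defect; lra. Qed.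

Lemma energyE T g n :
  energy T g n = \sum_(j < n) (sq (g j) + 2 * rip (T (drive T g j)) (g j)).
Proof.
elim: n => [|n IH]; first by rewrite /energy !big_ord0 /= sq0 addr0.
by rewrite energyS IH big_ord_recr.
Qed.

Lemma defect_ge0 T : sq_contraction T -> forall x, 0 <= defect T x.
Proof. by move=> h x; rewrite subr_ge0. Qed.

Lemma defectD T x y : defect T (x + y) + defect T (x - y) =
  2 * defect T x + 2 * defect T y.
Proof. by rewrite /defect raddfD raddfB /= !sqD !sqN !ripNr; ring. Qed.

Lemma defect_le2B T x y : sq_contraction T ->
  defect T (x - y) <= 2 * defect T x + 2 * defect T y.
Proof. by move=> h; rewrite -defectD lerDr defect_ge0. Qed.

Lemma energy_ge_defect T g n : \sum_(j < n) defect T (drive T g j) <= energy T g n.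
Proof. by rewrite lerDr sq_ge0. Qed.

Lemma driveB T g g' n :
  drive T (fun j => g j - g' j) n = drive T g n - drive T g' n.
Proof.
elim: n => [|n IH] /=; first by rewrite subrr.
by rewrite IH raddfB opprD addrACA.
Qed.

Lemma drive_comm T g n : drive T (fun j => T (g j)) n = T (drive T g n).
Proof. by elim: n => [|n IH] /=; rewrite ?raddf0 // IH raddfD. Qed.

(** The states of T are those of T' minus the response V of T to the inputs
   <s_j, e> q, where s_j are the states of T'. Bounded density controls the
   energy of V by the sum of the |<s_j, e>|^2, and these are controlled by the
   dissipation of T'. *)
Lemma energy_perturb T T' e q (a b C : R) :
  sq_contraction T -> sq_contraction T' ->
  (forall x, T' x = T x + '[x, e] *: q) -> 0 <= a -> 0 <= b -> 0 <= C ->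
  (forall x, defect T x <= a * defect T' x) ->
  (forall x, csq '[x, e] <= b * defect T' x) ->
  (forall (al : nat -> R[i]) n,
    energy T (fun j => al j *: q) n <= C * \sum_(j < n) csq (al j)) ->
  forall g n, energy T g n <= (2 + 2 * a + 2 * C * b) * energy T' g n.
Proof.
move=> cT cT' hT' a0 b0 C0 hD he hC g n.
pose al j := '[drive T' g j, e].
  (* V is the response of T to what the perturbation feeds in. *)
pose V j := drive T (fun j => al j *: q) j.
have shuffle (u v w z : H) : u - w + z = u + v + z - (w + v).
  by rewrite [u + v + z]addrAC opprD [RHS]addrACA subrr addr0 [RHS]addrAC.
have WE j : drive T g j = drive T' g j - V j.
  elim: j => [|j IH]; first by rewrite subr0.
  rewrite /= IH hT' raddfB /= -/(al j) /V /= -/(V j).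
  exact: shuffle.
have h1 : sq (drive T g n) <= 2 * sq (drive T' g n) + 2 * sq (V n).
  by rewrite WE; apply: sq_le2B.
have h2 : \sum_(j < n) defect T (drive T g j) <=
    2 * a * \sum_(j < n) defect T' (drive T' g j) + 2 * \sum_(j < n) defect T (V j).
  rewrite !mulr_sumr -big_split /=; apply: ler_sum => j _.
  rewrite WE; apply: (le_trans (defect_le2B _ _ cT)).
  by rewrite lerD2r -mulrA ler_pM2l.
have h3 : energy T (fun j => al j *: q) n <= C * b * \sum_(j < n) defect T' (drive T' g j).
  apply: (le_trans (hC _ _)); rewrite -mulrA ler_wpM2l // mulr_sumr.
  by apply: ler_sum => j _; apply: he.
have S0 : 0 <= \sum_(j < n) defect T' (drive T' g j).
  by apply: sumr_ge0 => j _; apply: defect_ge0.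
have {}h3 : sq (V n) + \sum_(j < n) defect T (V j) <=
  C * b * \sum_(j < n) defect T' (drive T' g j) := h3.
have s0 := sq_ge0 (drive T' g n); rewrite /energy.
have aS := mulr_ge0 a0 s0; have cS := mulr_ge0 (mulr_ge0 C0 b0) s0.
lra.
Qed.

Lemma rip_defect T A : is_adjoint T A ->
  forall x y, rip (x - A (T x)) y = rip x y - rip (T x) (T y).
Proof.
move=> hA x y; rewrite ripDl ripNl; congr (_ - _).
by rewrite ripC -(rip_adj hA) ripC.
Qed.

(** Cauchy-Schwarz for the positive form of 1 - A T. *)
Lemma defect_CS T A : is_adjoint T A -> sq_contraction T ->
  forall x y, rip (x - A (T x)) y ^+ 2 <= defect T x * defect T y.
Proof.
move=> hA cT x y; rewrite (rip_defect hA).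
apply: discr_le; rewrite ?defect_ge0 // => t.
have := defect_ge0 cT (x + t%:C *: y).
rewrite /defect raddfD /= linearZ /= !sqD !sqZ csqC !ripZr.
by congr (_ <= _); ring.
Qed.

Lemma defect_CSc T A : is_adjoint T A -> sq_contraction T ->
  forall x y, csq '[x, y - A (T y)] <= defect T x * defect T y.
Proof.
move=> hA cT x y; set b := '[x, _].
have [->|h] := eqVneq b 0.
  by rewrite /csq /= expr0n addr0 mulr_ge0 ?defect_ge0.
have dZ : defect T (b *: y) = csq b * defect T y.
  by rewrite /defect linearZ /= !sqZ mulrBr.
have := defect_CS hA cT (b *: y) x; rewrite dZ.
rewrite linearZ (is_adjointZ hA) -scalerBr /rip innerZl.
have -> : Re (b * '[y - A (T y), x]) = csq b.
  by rewrite innerC -/b /csq; case: (b) => u v /=; ring.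
have c0 : 0 < csq b.
  rewrite lt_neqAle csq_ge0 andbT eq_sym; apply: contraNneq h => h.
  by rewrite -normr_eq0 csq_norm h sqrtr0.
by rewrite expr2 -mulrA ler_pM2l // mulrC.
Qed.

(** The energy that such a vector feeds into the system is at most half of what
   the system dissipates, up to the size of the input: if q = v - T A v, then
   <T w, q> is the form of 1 - A T at w and A v. *)
Lemma bounded_density_codefect T A v : is_adjoint T A -> sq_contraction T ->
  bounded_density T (v - T (A v)).
Proof.
move=> hA cT; set q := v - _.
have cA := sq_adj hA cT.
exists (2 * sq q + 4 * sq v); first by rewrite addr_ge0 ?mulr_ge0 ?sq_ge0.
move=> al n; set g := fun j => _.
have step j : sq (g j) + 2 * rip (T (drive T g j)) (g j) <=
    (sq q + 2 * sq v) * csq (al j) + defect T (drive T g j) / 2.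
  set w := drive T g j.
  have -> : rip (T w) (g j) = rip (w - A (T w)) (al j *: A v).
    rewrite /g /q scalerBr ripDr ripNr (rip_defect hA) !linearZ /=; congr (_ - _).
    by rewrite (rip_adj hA) (is_adjointZ hA).
  have := defect_CS hA cT w (al j *: A v).
  set r := rip _ _; set d := defect T w.
  have d0 : 0 <= d by apply: defect_ge0.
  have h : defect T (al j *: A v) <= csq (al j) * sq v.
    rewrite /defect linearZ !sqZ; have := sq_ge0 (T (A v)); have := cA v.
    by have := csq_ge0 (al j); nra.
  rewrite /g sqZ; set k := csq (al j) * sq v in h *.
  move=> h1; have h2 : r ^+ 2 <= d * k by apply: (le_trans h1); rewrite ler_wpM2l.
  have k0 : 0 <= k by rewrite mulr_ge0 ?csq_ge0 ?sq_ge0.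
  have -> : (sq q + 2 * sq v) * csq (al j) = csq (al j) * sq q + 2 * k.
    by rewrite /k; ring.
  suff : 2 * r <= 2 * k + d / 2 by lra.
  have [r0|r0] := leP r 0; first by apply: (@le_trans _ _ 0); lra.
  rewrite -(@ler_pXn2r _ 2) ?nnegrE; [|by []|by lra|by lra].
  have : 0 <= (2 * k - d / 2) ^+ 2 by apply: sqr_ge0.
  by rewrite !expr2 in h2 *; lra.
have := energy_ge_defect T g n; rewrite {1}energyE => h1.
have : energy T g n <= (sq q + 2 * sq v) * (\sum_(j < n) csq (al j)) +
    (\sum_(j < n) defect T (drive T g j)) / 2.
  rewrite energyE mulr_sumr mulr_suml -big_split /=.
  by apply: ler_sum => j _; apply: step.
rewrite -energyE in h1; set S := \sum_(j < n) csq _; move=> h2.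
have -> : (2 * sq q + 4 * sq v) * S = 2 * ((sq q + 2 * sq v) * S) by ring.
by lra.
Qed.

End Energy.

(** * Roots of unity *)

Section Circle.
Context {R : realType}.
Implicit Types (s t : R) (c : R[i]).

Definition cis t : R[i] := cos t +i* sin t.

Lemma cis0 : cis 0 = 1. Proof. by rewrite /cis cos0 sin0. Qed.

Lemma cisD s t : cis (s + t) = cis s * cis t.
Proof. by apply/eqP; rewrite eq_complex /= cosD sinD; apply/andP; split; apply/eqP; ring. Qed.

Lemma cisX t n : cis t ^+ n = cis (n%:R * t).
Proof.
elim: n => [|n IH]; first by rewrite mul0r cis0.
by rewrite exprS IH -cisD mulrS mulrDl mul1r.
Qed.

Lemma csq_cis t : csq (cis t) = 1.
Proof. by rewrite /csq /= cos2Dsin2. Qed.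

Lemma csq_mulJ c : c * conjc c = (csq c)%:C.
Proof. by case: c => a b; apply/eqP; rewrite eq_complex /csq /=; apply/andP; split; apply/eqP; ring. Qed.

Lemma csq_conj c : csq (conjc c) = csq c.
Proof. by case: c => a b; rewrite /csq /= sqrrN. Qed.

Lemma conjcM c d : conjc (c * d) = conjc c * conjc d.
Proof. exact: rmorphM. Qed.

Lemma conjc_sum (I : Type) (r : seq I) (P : pred I) (F : I -> R[i]) :
  conjc (\sum_(i <- r | P i) F i) = \sum_(i <- r | P i) conjc (F i).
Proof. exact: rmorph_sum. Qed.

Lemma conjcX c n : conjc (c ^+ n) = conjc c ^+ n.
Proof. exact: rmorphXn. Qed.

Lemma csqX c n : csq (c ^+ n) = csq c ^+ n.
Proof.
elim: n => [|n IH]; first by rewrite /csq /= expr0n /= addr0 expr1n.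
by rewrite !exprS csqM IH.
Qed.

Lemma norm_csq1 c : csq c = 1 -> `|c| = 1.
Proof. by move=> h; rewrite csq_norm h sqrtr1. Qed.

Lemma cos_lt1 t : 0 < t -> t < 2 * pi -> cos t < 1.
Proof.
move=> t0 t2; have -> : t = t / 2 + t / 2 by field.
have h : 0 < sin (t / 2) by apply: sin_gt0_pi; apply/andP; split; lra.
rewrite cosD; have := cos2Dsin2 (t / 2); rewrite !expr2.
by have := mulr_gt0 h h; lra.
Qed.

Definition unity_root n (i : nat) : R[i] := cis (2 * pi / n%:R * i%:R).

Lemma csq_unity_root n i : csq (unity_root n i) = 1.
Proof. exact: csq_cis. Qed.

Lemma sum_unity_root n l : (0 < l < n)%N ->
  \sum_(i < n) unity_root n i ^+ l = 0.
Proof.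
case/andP=> l0 ln; have n0 : 0 < n%:R :> R by rewrite ltr0n (leq_trans _ ln).
pose t : R := l%:R * (2 * pi / n%:R).
have E i : unity_root n i ^+ l = cis t ^+ i.
  by rewrite /unity_root !cisX; congr cis; rewrite /t; ring.
have zn : cis t ^+ n = 1.
  rewrite cisX (_ : n%:R * t = l%:R * (2 * pi)); last first.
    by rewrite /t; field; rewrite gt_eqF.
  by rewrite -cisX {1}/cis mulr_natl cos2pi sin2pi expr1n.
have t1 : cis t != 1.
  rewrite eq_complex /= negb_and; apply/orP; left; rewrite lt_eqF // cos_lt1 //.
    by rewrite mulr_gt0 ?ltr0n // divr_gt0 // mulr_gt0 // pi_gt0.
  rewrite /t mulrCA -[ltRHS]mulr1 ltr_pM2l ?mulr_gt0 ?pi_gt0 //.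
  by rewrite ltr_pdivrMr // mul1r ltr_nat.
under eq_bigr do rewrite E.
have := subrX1 (cis t) n; rewrite zn subrr => /esym/eqP.
by rewrite mulf_eq0 subr_eq0 (negbTE t1) => /eqP.
Qed.

Lemma unity_root_orth n k l : (k < n)%N -> (l < n)%N ->
  \sum_(i < n) unity_root n i ^+ l * conjc (unity_root n i) ^+ k =
  (if l == k then n%:R else 0).
Proof.
move=> kn ln.
have half (a b : nat) : (a <= b)%N -> (b < n)%N ->
    \sum_(i < n) unity_root n i ^+ b * conjc (unity_root n i) ^+ a =
    (if b == a then n%:R else 0).
  move=> ab bn.
  have E i : unity_root n i ^+ b * conjc (unity_root n i) ^+ a =
      unity_root n i ^+ (b - a).
    rewrite -{1}(subnK ab) exprD -mulrA -exprMn csq_mulJ csq_unity_root.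
    by rewrite expr1n mulr1.
  under eq_bigr do rewrite E.
  case: eqP => [->|/eqP nab].
    by rewrite subnn; under eq_bigr do rewrite expr0; rewrite sumr_const card_ord.
  apply: sum_unity_root; rewrite subn_gt0 ltn_neqAle eq_sym nab ab /=.
  exact: leq_ltn_trans (leq_subr _ _) bn.
have [kl|/ltnW lk] := leqP k l; first exact: half.
rewrite -[LHS]conjcK conjc_sum.
under eq_bigr do rewrite conjcM !conjcX conjcK mulrC.
by rewrite half // eq_sym; case: ifP; rewrite ?conjc0 ?conjc_nat.
Qed.

Lemma sum_unity_rootD n k l : (0 < l + k < n)%N ->
  \sum_(i < n) unity_root n i ^+ l * unity_root n i ^+ k = 0.
Proof. by move=> h; under eq_bigr do rewrite -exprD; exact: sum_unity_root. Qed.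

End Circle.

(** * Harnack domination as domination of energies *)

Section HarnackEnergy.
Context {R : realType} {H : hilbertType R}.
Implicit Types (x y z : H) (c v w : R[i]) (T : {linear H -> H}) (p : {poly R[i]}).

Definition bounded_op (A : H -> H) := exists K : R, forall x, sq (A x) <= K * sq x.

Lemma iter_contraction T k x : sq_contraction T -> sq (iter k T x) <= sq x.
Proof. by move=> cT; elim: k => //= k IH; apply: (le_trans (cT _)). Qed.

Lemma iter_add T k x y : iter k T (x + y) = iter k T x + iter k T y.
Proof. by elim: k => //= k ->; rewrite raddfD. Qed.

Lemma iter_scale T k c x : iter k T (c *: x) = c *: iter k T x.
Proof. by elim: k => //= k ->; rewrite linearZ. Qed.

Lemma bounded_sum n (f : nat -> R[i]) T : sq_contraction T ->
  bounded_op (fun x => \sum_(k < n) f k *: iter k T x).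
Proof.
move=> cT; elim: n => [|n [K hK]].
  by exists 0 => x; rewrite big_ord0 sq0 mul0r.
exists (2 * K + 2 * csq (f n)) => x; rewrite big_ord_recr /=.
apply: (le_trans (sq_le2 _ _)); rewrite (mulrDl (2 * K)) -!mulrA.
apply: lerD; rewrite ler_pM2l // sqZ ler_wpM2l ?csq_ge0 //.
exact: iter_contraction.
Qed.

Lemma op_horner_adjoint p T : sq_contraction T ->
  is_adjoint (op_horner p T) (adjoint (op_horner p T)).
Proof.
move=> cT; have [K hK] := bounded_sum (size p) (fun k => p`_k) cT.
apply: (@adjoint_exists _ _ _ K) => // [x y|c x].
  by rewrite /op_horner -big_split /=; apply: eq_bigr => k _; rewrite iter_add scalerDr.
rewrite /op_horner scaler_sumr; apply: eq_bigr => k _.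
by rewrite iter_scale !scalerA mulrC.
Qed.

Lemma inner_op_Re (A : H -> H) x : is_adjoint A (adjoint A) ->
  '[op_Re A x, x] = (rip (A x) x)%:C.
Proof.
move=> hA; rewrite /op_Re innerZl innerDl (is_adjointC hA) (innerC x) /rip.
have -> : 2%:R^-1 = 2%:R^-1%:C :> R[i] by rewrite fmorphV /= rmorph_nat.
case: '[A x, x] => a b; apply/eqP; rewrite eq_complex /=.
by apply/andP; split; apply/eqP; field.
Qed.

Definition disc_positive p := forall z : R[i], `|z| <= 1 -> 0 <= Re p.[z].

(** Restates domination without adjoints: the form of op_Re A at x is the real
   part of <A x, x>. *)
Lemma harnackE T T' : sq_contraction T -> sq_contraction T' ->
  harnack_dominated T T' <-> exists2 c : R, 1 <= c & forall p, disc_positive p ->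
    forall x, rip (op_horner p T x) x <= c * rip (op_horner p T' x) x.
Proof.
move=> cT cT'; split=> -[c c1 h]; exists c => // p hp x; have := h p hp x;
  by rewrite innerZl !inner_op_Re -?rmorphM /= ?lecR //; apply: op_horner_adjoint.
Qed.

Lemma op_hornerE p T x n : (size p <= n)%N ->
  op_horner p T x = \sum_(k < n) p`_k *: iter k T x.
Proof.
move=> h; rewrite /op_horner (big_ord_widen _ (fun k => p`_k *: iter k T x) h).
rewrite big_mkcond; apply: eq_bigr => k _; case: ltnP => // hk.
by rewrite nth_default // scale0r.
Qed.

Lemma op_hornerD p q T x : op_horner (p + q) T x = op_horner p T x + op_horner q T x.
Proof.
have h := size_polyD p q; rewrite (op_hornerE _ _ h).
rewrite (op_hornerE T x (leq_maxl (size p) (size q))) (op_hornerE T x (leq_maxr (size p) (size q))).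
by rewrite -big_split /=; apply: eq_bigr => k _; rewrite coefD scalerDl.
Qed.

Lemma op_hornerZ c p T x : op_horner (c *: p) T x = c *: op_horner p T x.
Proof.
rewrite (op_hornerE T x (size_scale_leq c p)) scaler_sumr.
by apply: eq_bigr => k _; rewrite coefZ scalerA.
Qed.

Lemma op_horner1 T x : op_horner 1 T x = x.
Proof.
rewrite (@op_hornerE _ _ _ 1) ?size_poly1 // big_ord_recl big_ord0 addr0.
by rewrite coef1 scale1r.
Qed.

Lemma op_horner_sum (I : Type) (r : seq I) (F : I -> {poly R[i]}) T x :
  op_horner (\sum_(j <- r) F j) T x = \sum_(j <- r) op_horner (F j) T x.
Proof.
elim: r => [|j r IH]; first by rewrite !big_nil /op_horner size_poly0 big_ord0.
by rewrite !big_cons op_hornerD IH.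
Qed.

Lemma rip_sum (I : Type) (r : seq I) (F : I -> H) x :
  rip (\sum_(j <- r) F j) x = \sum_(j <- r) rip (F j) x.
Proof. by elim: r => [|j r IH]; rewrite ?big_nil ?rip0l // !big_cons ripDl IH. Qed.

Definition geo_poly v n : {poly R[i]} := \poly_(k < n) v ^+ k.
Definition geo_sum v T x n : H := \sum_(k < n) v ^+ k *: iter k T x.

(** The analytic Fejer kernel, without its normalizing factor. *)
Definition fejer_poly v n : {poly R[i]} :=
  \sum_(j < n) (2%:R *: geo_poly v j.+1 - 1).

Lemma op_horner_geo v T x n : op_horner (geo_poly v n) T x = geo_sum v T x n.
Proof.
rewrite (op_hornerE _ _ (size_poly _ _)); apply: eq_bigr => k _.
by rewrite coef_poly ltn_ord.
Qed.

Lemma geo_sumS v T x n : geo_sum v T x n.+1 = x + v *: T (geo_sum v T x n).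
Proof.
rewrite /geo_sum big_ord_recl /= expr0 scale1r; congr (_ + _).
rewrite raddf_sum /= scaler_sumr; apply: eq_bigr => k _.
by rewrite linearZ scalerA -exprS.
Qed.

Lemma ripZZ c x y : csq c = 1 -> rip (c *: x) (c *: y) = rip x y.
Proof.
by move=> h; rewrite /rip innerZl innerZr mulrA csq_mulJ h mul1r.
Qed.

(** A geometric input sums up the geometric series of T: the powers of w can be
   taken out of the state. *)
Lemma drive_geo w T x n : csq w = 1 ->
  drive T (fun j => w ^+ j *: x) n.+1 = w ^+ n *: geo_sum (conjc w) T x n.+1.
Proof.
move=> hw; elim: n => [|n IH].
  by rewrite /= raddf0 add0r /geo_sum big_ord_recl big_ord0 addr0 /= !expr0 !scale1r.
rewrite [LHS]/= -/(drive T _ n.+1) IH linearZ addrC (geo_sumS _ T x n.+1) scalerDr scalerA.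
by rewrite exprSr -mulrA csq_mulJ hw mulr1.
Qed.

Lemma energy_geo w T x n : csq w = 1 ->
  energy T (fun j => w ^+ j *: x) n =
  \sum_(j < n) (2 * rip (geo_sum (conjc w) T x j.+1) x - sq x).
Proof.
move=> hw; rewrite energyE; apply: eq_bigr => j _.
have wj : csq (w ^+ j) = 1 by rewrite csqX hw expr1n.
have := drive_geo T x j hw; rewrite /= => /(canRL (addrK _)) ->.
rewrite ripDl ripNl ripZZ // -/(sq (w ^+ j *: x)) sqZ wj; ring.
Qed.

(** Both sides grow by 2 Re <s, x> - |x|^2 at each step, where s is the geometric
   sum of the powers of conjc w T on x. *)
Lemma fejer_energy w T x n : csq w = 1 ->
  rip (op_horner (fejer_poly (conjc w) n) T x) x =
  energy T (fun j => w ^+ j *: x) n.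
Proof.
move=> hw; rewrite energy_geo // /fejer_poly op_horner_sum rip_sum; apply: eq_bigr => j _.
rewrite op_hornerD -scaleN1r !op_hornerZ op_horner1 op_horner_geo scaleN1r ripDl ripNl.
congr (_ - _); have -> : 2%:R = (2%:R)%:C :> R[i] by rewrite rmorph_nat.
by rewrite ripZl.
Qed.

(** The energy identity for the scalar contraction z: Re of the kernel is a sum of
   squares weighted by 1 and 1 - |z|^2. *)
Lemma fejer_positive v n : csq v = 1 -> disc_positive (fejer_poly v n).
Proof.
move=> hv z; rewrite csq_norm (_ : 1 = 1%:C) // lecR -sqrtr1 ler_psqrt ?nnegrE ?csq_ge0 //.
move=> hz; pose q j := (geo_poly v j).[z].
have qS j : q j.+1 = 1 + v * z * q j.
  rewrite /q !horner_poly big_ord_recl !expr0 mul1r; congr (_ + _).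
  by rewrite mulr_sumr; apply: eq_bigr => k _; rewrite !exprS mulrACA.
suff -> : Re (fejer_poly v n).[z] = csq (q n) + \sum_(j < n) (1 - csq z) * csq (q j).
  rewrite addr_ge0 ?csq_ge0 // sumr_ge0 // => j _.
  by rewrite mulr_ge0 ?csq_ge0 // subr_ge0.
elim: n => [|n IH].
  by rewrite /fejer_poly /q !big_ord0 !horner_poly !horner0 big_ord0 /csq /= expr0n /= !addr0.
have -> : fejer_poly v n.+1 = fejer_poly v n + (2%:R *: geo_poly v n.+1 - 1).
  by rewrite /fejer_poly big_ord_recr.
rewrite big_ord_recr hornerD raddfD /= IH !hornerE -/(q n.+1) qS.
have E : csq z * csq (q n) = csq (v * z * q n) by rewrite !csqM hv mul1r.
rewrite mulrBl mul1r E; move: (\sum_(_ < _) _) (csq (q n)) => S0 S1.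
by case: (v * z * q n) => a b; rewrite /csq /=; ring.
Qed.

Lemma harnack_energy T T' : sq_contraction T -> sq_contraction T' ->
  harnack_dominated T T' -> exists2 c : R, 1 <= c &
  forall w, csq w = 1 -> forall x n,
    energy T (fun j => w ^+ j *: x) n <= c * energy T' (fun j => w ^+ j *: x) n.
Proof.
move=> cT cT' /(harnackE cT cT')[c c1 h]; exists c => // w hw x n.
rewrite -!fejer_energy //; apply: h; apply: fejer_positive.
by rewrite csq_conj.
Qed.

End HarnackEnergy.

Section FejerAverage.
Context {R : realType} {H : hilbertType R}.
Implicit Types (x y z : H) (c v w : R[i]) (T : {linear H -> H}) (p : {poly R[i]}).

Lemma inner_sum (I : Type) (r : seq I) (F : I -> H) x :
  '[\sum_(j <- r) F j, x] = \sum_(j <- r) '[F j, x].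
Proof. by elim: r => [|j r IH]; rewrite ?big_nil ?linear0l // !big_cons innerDl IH. Qed.

Lemma Re_sum (I : Type) (r : seq I) (F : I -> R[i]) :
  Re (\sum_(j <- r) F j) = \sum_(j <- r) Re (F j).
Proof. exact: raddf_sum. Qed.

Lemma Re_mulC c (a : R) : Re c * a = Re (c * a%:C).
Proof. by case: c => u v /=; rewrite mulr0 subr0. Qed.

(** The real part of a geometric sum of T is, up to <x, x>, a trigonometric sum in
   w whose coefficients are <T^k x, x> and their conjugates. With more roots of
   unity than the degrees involved, averaging it against Re p picks out the
   products of matching coefficients, so it truncates p at degree j. *)
Lemma unity_root_average p T x j n : (size p + j < n)%N ->
  \sum_(i < n) Re p.[unity_root n i] *
    (2 * rip (geo_sum (conjc (unity_root n i)) T x j.+1) x - sq x) =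
  n%:R * \sum_(k < size p | (k <= j)%N) Re (p`_k * '[iter k T x, x]).
Proof.
move=> hn; pose b k := '[iter k T x, x].
pose w i : R[i] := unity_root n i.
have tE i : (2 * rip (geo_sum (conjc (w i)) T x j.+1) x - sq x)%:C =
    \sum_(k < j.+1) conjc (w i) ^+ k * b k + \sum_(k < j) w i ^+ k.+1 * conjc (b k.+1).
  have uE : '[geo_sum (conjc (w i)) T x j.+1, x] = \sum_(k < j.+1) conjc (w i) ^+ k * b k.
    by rewrite inner_sum; apply: eq_bigr => k _; rewrite innerZl.
  have cE : conjc (\sum_(k < j.+1) conjc (w i) ^+ k * b k) =
      (sq x)%:C + \sum_(k < j) w i ^+ k.+1 * conjc (b k.+1).
    rewrite conjc_sum big_ord_recl expr0 mul1r; congr (_ + _).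
      by rewrite /b /= -innerC innerxx.
    by apply: eq_bigr => k _; rewrite conjcM conjcX conjcK lift0.
  rewrite /rip uE -[X in _ = _ + X](addKr (sq x)%:C) -cE addrCA.
  case: (\sum_(k < j.+1) _) => u v; apply/eqP; rewrite eq_complex /=.
  by apply/andP; split; apply/eqP; ring.
under eq_bigr do rewrite Re_mulC tE.
rewrite -Re_sum.
have -> : \sum_(i < n) p.[w i] * (\sum_(k < j.+1) conjc (w i) ^+ k * b k +
    \sum_(k < j) w i ^+ k.+1 * conjc (b k.+1)) =
  \sum_(l < size p) \sum_(k < j.+1) p`_l * b k *
      (\sum_(i < n) w i ^+ l * conjc (w i) ^+ k) +
  \sum_(l < size p) \sum_(k < j) p`_l * conjc (b k.+1) *
      (\sum_(i < n) w i ^+ l * w i ^+ k.+1).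
  under eq_bigr do rewrite mulrDr horner_coef !mulr_suml.
  rewrite big_split /=; congr (_ + _); rewrite exchange_big /=; apply: eq_bigr => l _.
    under eq_bigr do rewrite mulr_sumr.
    rewrite exchange_big /=; apply: eq_bigr => k _; rewrite mulr_sumr.
    by apply: eq_bigr => i _; rewrite [X in _ * X]mulrC mulrACA.
  under eq_bigr do rewrite mulr_sumr.
  rewrite exchange_big /=; apply: eq_bigr => k _; rewrite mulr_sumr.
  by apply: eq_bigr => i _; rewrite [X in _ * X]mulrC mulrACA.
have sp (l : 'I_(size p)) : (l < n)%N.
  by apply: leq_ltn_trans hn; rewrite (leq_trans (ltnW (ltn_ord l))) // leq_addr.
rewrite [X in _ + X]big1 ?addr0; last first.
  move=> l _; apply: big1 => k _; rewrite sum_unity_rootD ?mulr0 //.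
  rewrite addnS /=; apply: leq_ltn_trans hn; rewrite -addSn.
  exact: leq_add (ltn_ord l) (ltnW (ltn_ord k)).
rewrite Re_sum [in RHS]big_mkcond [in RHS]mulr_sumr; apply: eq_bigr => l _.
have kn (k : 'I_j.+1) : (k < n)%N.
  apply: leq_ltn_trans hn; apply: leq_trans (leq_addl _ _).
  by rewrite -ltnS.
under eq_bigr do rewrite unity_root_orth //.
case: leqP => lj; last first.
  rewrite mulr0 big1 // => k _; case: eqP => [lk|_]; last by rewrite mulr0.
  by move: (ltn_ord k); rewrite -lk ltnS leqNgt lj.
rewrite (bigD1 (Ordinal (lj : l < j.+1)%N)) //= eqxx big1 ?addr0; last first.
  by move=> k /eqP kl; case: eqP => [lk|_]; rewrite ?mulr0 //; case: kl; apply: val_inj.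
have -> : n%:R = n%:R%:C :> R[i] by rewrite rmorph_nat.
by rewrite -Re_mulC mulrC.
Qed.

Lemma archi_le (A B : R) : (forall m, A + m%:R * B <= 0) -> B <= 0.
Proof.
move=> h; rewrite leNgt; apply/negP => B0.
have := h (Num.truncn (`|A| / B)).+1; apply/negP; rewrite -ltNge.
have : `|A| / B < (Num.truncn (`|A| / B)).+1%:R by exact: truncnS_gt.
by rewrite ltr_pdivrMr // => h1; have := ler_norm (- A); rewrite normrN; lra.
Qed.

(** Averaging the energies of w^j x against Re p(w) over many roots of unity gives
   m times the form of p(T) plus a term independent of m, which disappears as m
   grows. *)
Lemma energy_harnack T T' (c : R) : sq_contraction T -> sq_contraction T' ->
  1 <= c ->
  (forall w, csq w = 1 -> forall x n,
    energy T (fun j => w ^+ j *: x) n <= c * energy T' (fun j => w ^+ j *: x) n) ->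
  harnack_dominated T T'.
Proof.
move=> cT cT' c1 h; apply/(harnackE cT cT'); exists c => // p hp x.
pose P S j := \sum_(k < size p | (k <= j)%N) Re (p`_k * '[iter k S x, x]) : R.
have PE S : rip (op_horner p S x) x = P S (size p).
  rewrite /op_horner rip_sum /P [in RHS]big_mkcond; apply: eq_bigr => k _.
  by rewrite ltnW // /rip innerZl.
have PE' S j : P S (size p + j)%N = P S (size p).
  rewrite /P; apply: eq_bigl => k.
  by rewrite (leq_trans (ltnW (ltn_ord k)) (leq_addr _ _)) ltnW.
have sumE S m : let N := (size p + m)%N in let n := (size p + N).+1 in
    \sum_(i < n) Re p.[unity_root n i] *
      energy S (fun j => unity_root n i ^+ j *: x) N =
    n%:R * (\sum_(j < size p) P S j + m%:R * P S (size p)).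
  move=> N n; under eq_bigr do rewrite (energy_geo _ _ _ (csq_unity_root _ _)) mulr_sumr.
  rewrite exchange_big /=.
  transitivity (\sum_(j < N) n%:R * P S j).
    apply: eq_bigr => j _; rewrite unity_root_average // ltnS leq_add2l.
    exact: ltnW.
  rewrite -mulr_sumr big_split_ord /=; congr (_ * (_ + _)).
  under eq_bigr do rewrite PE'.
  by rewrite sumr_const card_ord mulr_natl.
rewrite !PE -subr_le0; apply: (@archi_le
  (\sum_(j < size p) P T j - c * \sum_(j < size p) P T' j)) => m.
have := sumE T m; have := sumE T' m => /=.
set N := (size p + m)%N; set n := (size p + N).+1 => E' E.
have n0 : 0 < n%:R :> R by rewrite ltr0n.
have : n%:R * (\sum_(j < size p) P T j + m%:R * P T (size p)) <=
   c * (n%:R * (\sum_(j < size p) P T' j + m%:R * P T' (size p))).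
  rewrite -E -E' mulr_sumr; apply: ler_sum => i _.
  rewrite mulrCA ler_wpM2l //; last by apply: h; exact: csq_unity_root.
  by apply: hp; rewrite norm_csq1 // csq_unity_root.
rewrite mulrCA ler_pM2l //; lra.
Qed.

End FejerAverage.

(** * Maximal contractions are unitary *)

Section MaximalUnitary.
Context {R : realType} {H : hilbertType R}.
Implicit Types (x y z e q u v : H) (c w : R[i]) (T L : {linear H -> H}).

Lemma exists_linear (f : H -> H) :
  (forall x y, f (x + y) = f x + f y) -> (forall c x, f (c *: x) = c *: f x) ->
  exists L, L = f :> (H -> H).
Proof.
move=> fD fZ; have hf : linear f by move=> c x y; rewrite fD fZ.
pose m := GRing.isLinear.Build R[i] H H *:%R f hf.
by exists (HB.pack f m : {linear H -> H}).
Qed.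

Lemma bounded_densityZ T c u : bounded_density T u -> bounded_density T (c *: u).
Proof.
move=> [C C0 h]; exists (C * csq c) => [|al n]; first by rewrite mulr_ge0 ?csq_ge0.
have -> : (fun j => al j *: (c *: u)) = (fun j => (al j * c) *: u).
  by apply/funext => j; rewrite scalerA.
apply: (le_trans (h _ _)); rewrite -mulrA [csq c * _]mulr_sumr.
by rewrite ler_wpM2l // ler_sum // => j _; rewrite csqM mulrC.
Qed.

(** By energy_perturb the perturbed operator is a contraction that dominates T, so
   it is T. *)
Lemma maximal_perturb T e q (a b : R) : harnack_maximal T ->
  0 <= a -> 0 < b -> bounded_density T q ->
  (forall x, defect T x <= a * (sq x - sq (T x + '[x, e] *: q))) ->
  (forall x, csq '[x, e] <= b * (sq x - sq (T x + '[x, e] *: q))) ->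
  e = 0 \/ q = 0.
Proof.
move=> [cT maxT] a0 b0 [C C0 hC] ha hb.
have [T' T'E] : exists T' : {linear H -> H}, T' = (fun x => T x + '[x, e] *: q) :> (H -> H).
  apply: exists_linear => [x y|c x].
    by rewrite raddfD innerDl scalerDl addrACA.
  by rewrite linearZ innerZl scalerDr scalerA.
have T'x x : T' x = T x + '[x, e] *: q by rewrite T'E.
have sT := (contraction_sq T).1 cT.
have sT' : sq_contraction T'.
  move=> x; rewrite -subr_ge0 -(pmulr_rge0 _ b0) T'x.
  by apply: le_trans (hb x); exact: csq_ge0.
have dE x : sq x - sq (T x + '[x, e] *: q) = defect T' x by rewrite -T'x.
have dom : harnack_dominated T T'.
  have c1 : 1 <= 2 + 2 * a + 2 * C * b.
    by have := mulr_ge0 C0 (ltW b0); lra.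
  apply: (energy_harnack sT sT' c1) => w hw x n.
  apply: (energy_perturb sT sT' T'x a0 (ltW b0) C0) => // y; rewrite -dE.
    exact: ha.
  exact: hb.
have E := maxT T' ((contraction_sq T').2 sT') dom.
have := T'x e; rewrite E -{1}(addr0 (T e)) => /addrI/esym/eqP.
rewrite scaler_eq0 => /orP[/eqP h|/eqP->]; [left|by right].
by apply: sq_eq0; move: h; rewrite innerxx => /(congr1 (@complex.Re R)).
Qed.

(** The perturbation is T (1 - P), with P the projection onto u: the defect of this
   operator is |P x|^2, which is what the perturbing functional has to be
   controlled by. It kills u, while T does not. *)
Lemma isometry_bounded_density T u : harnack_maximal T ->
  (forall x, sq (T x) = sq x) -> bounded_density T u -> u = 0.
Proof.
move=> maxT isoT [C C0 hC]; have [//|u0] := eqVneq u 0.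
have s0 := sq_gt0 u0; set s := sq u in s0.
have bdTu : bounded_density T (T u).
  exists C => // al n; have -> : (fun j => al j *: T u) = (fun j => T (al j *: u)).
    by apply/funext => j; rewrite linearZ.
  apply: le_trans (hC al n); rewrite /energy drive_comm isoT lerD2l.
  by apply: ler_sum => j _; rewrite drive_comm /defect !isoT.
have eqn x : sq x - sq (T x + '[x, u] *: ((- s^-1)%:C *: T u)) = s^-1 * csq '[x, u].
  set t := '[x, u].
  have -> : T x + t *: ((- s^-1)%:C *: T u) = T (x - s^-1%:C *: (t *: u)).
    have -> : (- s^-1)%:C = - s^-1%:C by exact: rmorphN.
    have TZ c y : T (c *: y) = c *: T y by exact: linearZ.
    by rewrite raddfB /= !TZ scaleNr scalerN !scalerA mulrC.
  rewrite isoT sqB sqZ csqC sqZ -/s ripZr /rip innerZr -/t.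
  have -> : Re (conjc t * t) = csq t by case: (t) => p r; rewrite /csq /=; ring.
  by field; rewrite gt_eqF.
(* T (1 - P) x = T x - <x, u> T u / |u|^2. *)
case: (@maximal_perturb T u ((- s^-1)%:C *: T u) 0 s) => //.
- exact: bounded_densityZ.
- by move=> x; rewrite /defect isoT subrr mul0r.
- by move=> x; rewrite eqn mulrA divff ?gt_eqF // mul1r.
move=> /eqP; rewrite scaler_eq0 => /orP[|/eqP h].
  by rewrite -(rmorph0 (real_complex R)) (inj_eq (@complexI R)) oppr_eq0 invr_eq0 gt_eqF.
by apply: sq_eq0; rewrite -isoT h sq0.
Qed.

(** If T is not isometric, choose y with positive defect, small enough, and perturb
   T along q by the functional given by e = y - A T y. Cauchy-Schwarz for the
   defect form bounds both the functional and the cross term by a small multiple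
   of the defect, so half of the defect survives the perturbation. *)
Lemma maximal_coisometry T A : is_adjoint T A -> harnack_maximal T ->
  forall v, T (A v) = v.
Proof.
move=> hA maxT v; have sT := (contraction_sq T).1 maxT.1.
apply/eqP; rewrite eq_sym -subr_eq0; apply/eqP.
set q := v - T (A v); have bdq : bounded_density T q by exact: bounded_density_codefect.
have [iso|/existsNP[y0 hy0]] := pselect (forall x, defect T x = 0).
  apply: (isometry_bounded_density maxT) => // x.
  by have := iso x; rewrite /defect => /eqP; rewrite subr_eq0 => /eqP.
have sA := sq_adj hA sT.
(* Scales y0 so that |y|^2 |v|^2 is small; 1/64 is enough below. *)
pose k := (8 * (1 + sq y0) * (1 + sq v))^-1.
have s1 := sq_ge0 y0; have s2 := sq_ge0 v.
have k0 : 0 < k by rewrite invr_gt0 !mulr_gt0 //; lra.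
pose y := k%:C *: y0.
have ysmall : sq y * sq v <= 64^-1.
  rewrite /y sqZ csqC /k; set m := 8 * _ * _.
  have m0 : 0 < m by rewrite !mulr_gt0 //; lra.
  have -> : m^-1 ^+ 2 * sq y0 * sq v = (sq y0 * sq v) / m ^+ 2.
    by field; rewrite gt_eqF.
  rewrite ler_pdivrMr ?exprn_gt0 //.
  have -> : 64^-1 * m ^+ 2 = ((1 + sq y0) * (1 + sq y0)) * ((1 + sq v) * (1 + sq v)).
    by rewrite /m; field.
  by apply: ler_pM => //; nra.
have hy : defect T y != 0.
  have -> : defect T y = k ^+ 2 * defect T y0.
    by rewrite /defect /y linearZ !sqZ csqC mulrBr.
  by apply: mulf_neq0; [rewrite expf_neq0 // gt_eqF | exact/eqP].
pose e := y - A (T y).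
have dy : defect T y <= sq y by rewrite lerBlDr lerDl sq_ge0.
have te x : csq '[x, e] <= sq y * defect T x.
  apply: (le_trans (defect_CSc hA sT x y)); rewrite mulrC ler_wpM2r //.
  exact: defect_ge0.
have half x : defect T x / 2 <= sq x - sq (T x + '[x, e] *: q).
  set t := '[x, e]; set D := defect T x.
  have D0 : 0 <= D by apply: defect_ge0.
  have ht : csq t <= sq y * D by exact: te.
  have rE : rip (T x) (t *: q) = rip (x - A (T x)) (t *: A v).
    rewrite /q scalerBr ripDr ripNr (rip_defect hA) !linearZ /=; congr (_ - _).
    by rewrite (rip_adj hA) (is_adjointZ hA).
  have h1 := defect_CS hA sT x (t *: A v).
  have h2 : defect T (t *: A v) <= 64^-1 * D.
    apply: (@le_trans _ _ (csq t * sq v)).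
      rewrite /defect linearZ !sqZ -mulrBr ler_wpM2l ?csq_ge0 //.
      by have := sA v; have := sq_ge0 (T (A v)); lra.
    apply: (@le_trans _ _ (sq y * D * sq v)); first by rewrite ler_wpM2r.
    by rewrite mulrAC ler_wpM2r.
  have h3 : 2 * rip (T x) (t *: q) <= D / 4.
    rewrite rE; set r := rip _ _ in h1 *.
    have h4 : r ^+ 2 <= (D / 8) ^+ 2.
      apply: (le_trans h1); apply: (le_trans (ler_wpM2l D0 h2)).
      by rewrite !expr2; lra.
    have h5 : r <= D / 8.
      have [r0|r0] := leP r 0; first by apply: (le_trans r0); rewrite divr_ge0.
      by rewrite -(@ler_pXn2r _ 2) ?nnegrE ?(ltW r0) ?divr_ge0.
    by lra.
  have h6 : csq t * sq q <= D / 16.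
    have h7 : sq q <= 4 * sq v.
      by apply: (le_trans (sq_le2B _ _)); have := sT (A v); have := sA v; lra.
    apply: (@le_trans _ _ (sq y * D * (4 * sq v))).
      by apply: ler_pM => //; rewrite ?csq_ge0 ?sq_ge0.
    by have := ler_wpM2r D0 ysmall; lra.
  rewrite sqD sqZ; have : D = sq x - sq (T x) by [].
  by lra.
have y1 := sq_ge0 y.
case: (@maximal_perturb T e q 2 (2 * sq y + 1)) => //; first lra.
- by move=> x; have := half x; lra.
- move=> x; apply: (le_trans (te x)).
  have h := half x; have D0 := defect_ge0 sT x.
  have := ler_wpM2l y1 h; lra.
move=> e0; case/eqP: hy; have : rip e y = 0 by rewrite e0 rip0l.
by rewrite /e (rip_defect hA) -/(sq y) -/(sq (T y)).
Qed.

Lemma inner_iter_adj T A : is_adjoint T A ->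
  forall k x y, '[iter k T x, y] = '[x, iter k A y].
Proof. by move=> hA; elim=> //= k IH x y; rewrite hA IH -iterSr. Qed.

(** The energy of a geometric input only depends on the numbers Re <T^k x, x> w^(-k),
   and passing to the adjoint conjugates <T^k x, x>. *)
Lemma energy_adjoint T L : is_adjoint T L -> forall w, csq w = 1 -> forall x n,
  energy L (fun j => w ^+ j *: x) n = energy T (fun j => (conjc w) ^+ j *: x) n.
Proof.
move=> hL w hw x n; rewrite !energy_geo ?csq_conj //; apply: eq_bigr => j _.
congr (2 * _ - _); rewrite /geo_sum !rip_sum; apply: eq_bigr => k _.
rewrite /rip !innerZl (inner_iter_adj hL) (innerC x (iter k L x)) -!conjcX.
by case: (w ^+ k) '[_, _] => a b [a' b'] /=; ring.
Qed.

Lemma maximal_adjoint T L : is_adjoint T L -> harnack_maximal T -> harnack_maximal L.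
Proof.
move=> hL [cT maxT]; have sT := (contraction_sq T).1 cT.
have sL : sq_contraction L := sq_adj hL sT.
split=> [|T' cT' dom]; first exact/contraction_sq.
have sT' := (contraction_sq T').1 cT'.
have hT' : is_adjoint T' (adjoint T').
  by apply: (@adjoint_exists _ _ _ 1) => [x y|c x|x]; rewrite ?raddfD ?linearZ ?mul1r.
have [S SE] := exists_linear (is_adjointD hT') (is_adjointZ hT').
rewrite -SE in hT'.
have sS : sq_contraction S := sq_adj hT' sT'.
have [c c1 h] := harnack_energy sL sT' dom.
have TS : T = S :> (H -> H).
  apply/esym/maxT; first exact/contraction_sq.
  apply: (energy_harnack sT sS c1) => w hw x n.
  have := h (conjc w); rewrite csq_conj => /(_ hw x n).
  rewrite (energy_adjoint hL) ?csq_conj // conjcK.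
  by rewrite (energy_adjoint (is_adjointC hT')) ?csq_conj // conjcK.
apply/funext => y; apply: inner_inj => z.
by rewrite -hL TS -(is_adjointC hT').
Qed.

Lemma maximal_unitary T : harnack_maximal T -> unitary_op T.
Proof.
move=> maxT; have sT := (contraction_sq T).1 maxT.1.
have hA : is_adjoint T (adjoint T).
  by apply: (@adjoint_exists _ _ _ 1) => [x y|c x|x]; rewrite ?raddfD ?linearZ ?mul1r.
have [L LE] := exists_linear (is_adjointD hA) (is_adjointZ hA).
rewrite -LE in hA; rewrite /unitary_op -LE; split; apply/funext => x /=.
  apply: (maximal_coisometry (is_adjointC hA)); exact: maximal_adjoint hA maxT.
exact: maximal_coisometry.
Qed.

End MaximalUnitary.

(** * Borel structure of the circle *)

Section CircleMeasurability.
Context {R : realType}.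
Implicit Types (s t : R).

Lemma sin_le_norm t : `|sin t| <= `|t|.
Proof.
wlog t0 : t / 0 <= t => [hw|].
  have [|/ltW t0] := leP 0 t; first exact: hw.
  by rewrite -normrN -sinN -(normrN t) hw // oppr_ge0.
have [c _] := @MVT_segment R sin cos 0 t t0 (fun x _ => is_derive_sin x)
  (continuous_subspaceT (@continuous_sin R)).
rewrite sin0 !subr0 => ->; rewrite normrM -[leRHS]mul1r.
by rewrite ler_wpM2r // cos_max.
Qed.

(** The chord 2 sin(h/2) is shorter than the arc h. *)
Lemma cis_lip s t : csq (cis s - cis t) <= (s - t) ^+ 2.
Proof.
have -> : csq (cis s - cis t) = (2 * sin ((s - t) / 2)) ^+ 2.
  have -> : csq (cis s - cis t) = 2 - 2 * cos (s - t).
    rewrite /csq /= cosB.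
    transitivity ((cos s ^+ 2 + sin s ^+ 2) + (cos t ^+ 2 + sin t ^+ 2)
      - 2 * (cos s * cos t + sin s * sin t)); first by ring.
    by rewrite !cos2Dsin2; ring.
  have {1}-> : s - t = (s - t) / 2 + (s - t) / 2 by field.
  rewrite cosD; set u := (s - t) / 2.
  transitivity (2 * (cos u ^+ 2 + sin u ^+ 2) - 2 * (cos u * cos u - sin u * sin u)).
    by rewrite cos2Dsin2 mulr1.
  ring.
rewrite -[leLHS]real_normK ?num_real // -[leRHS]real_normK ?num_real //.
rewrite ler_pXn2r ?nnegrE // normrM; have := sin_le_norm ((s - t) / 2).
by rewrite normf_div (gtr0_norm (ltr0Sn R 1)); lra.
Qed.

Lemma open_borelC (A : set R[i]^o) : open A -> measurable (A : set (borelC R)).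
Proof. by move=> oA; apply: sub_sigma_algebra. Qed.

Lemma open_lip (f : R[i] -> R) : (forall z w, `|f z - f w|%:C <= `|z - w|) ->
  forall a, open ([set z | f z < a] : set R[i]^o).
Proof.
move=> hf a; rewrite openE => z /= fza; apply/nbhs_ballP.
exists (a - f z)%:C; first by rewrite /= ltcR subr_gt0.
move=> w /=; rewrite /ball /= => zw.
have := le_lt_trans (hf z w) zw; rewrite ltcR ltr_norml => /andP[h _].
by lra.
Qed.

Lemma measurable_lip (f : R[i] -> R) : (forall z w, `|f z - f w|%:C <= `|z - w|) ->
  measurable_fun setT (f : borelC R -> R).
Proof.
move=> hf; apply: (measurability _ (RGenInftyO.measurableE R)).
move=> /= _ [_ [a ->] <-]; rewrite setTI.
have -> : f @^-1` `]-oo, a[ = [set z | f z < a].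
  by apply/seteqP; split=> z /=; rewrite in_itv.
by apply: open_borelC; exact: open_lip.
Qed.

Lemma measurable_Re : measurable_fun setT (fun z : borelC R => Re z).
Proof.
apply: (@measurable_lip (@complex.Re R)) => z w.
by have := normc_ge_Re (z - w); rewrite raddfB.
Qed.

Lemma measurable_Im : measurable_fun setT (fun z : borelC R => Im z).
Proof.
apply: (@measurable_lip (@complex.Im R)) => z w.
rewrite normc_def lecR -raddfB /=; case: (z - w) => a b /=.
by rewrite -sqrtr_sqr ler_sqrt ?lerDr ?addr_ge0 ?sqr_ge0.
Qed.

Lemma measurable_expi : measurable_fun setT (@expi R).
Proof.
apply: (@measurability _ _ _ _ setT (@expi R) (@open R[i]^o)) => //.
move=> _ [A oA <-]; rewrite setTI; apply: open_measurable.
rewrite openE => t /= At; move: oA; rewrite openE => /(_ _ At).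
move=> /nbhs_ballP [e /= e0 he]; apply/nbhs_ballP.
case: e e0 he => a b; rewrite ltcE /= => /andP[/eqP -> a0] he.
exists a => // s; rewrite /ball /= => st; apply: he => /=.
rewrite /ball /= csq_norm ltcR; apply: le_lt_trans st.
by rewrite -sqrtr_sqr ler_psqrt ?nnegrE ?csq_ge0 ?sqr_ge0 //; exact: cis_lip.
Qed.

Lemma measurable_csqB (w : R[i]) :
  measurable_fun setT (fun z : borelC R => csq ((z : R[i]) - w)).
Proof.
have -> : (fun z : borelC R => csq ((z : R[i]) - w)) =
    (fun z : borelC R => (Re z - Re w) ^+ 2 + (Im z - Im w) ^+ 2).
  by apply/funext => z; rewrite /csq !raddfB.
apply: measurable_funD; apply: measurable_funX; apply: measurable_funB;
  (exact: measurable_Re || exact: measurable_Im || exact: measurable_cst).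
Qed.

Lemma unit_circleE : @unit_circle R = [set z | csq z = 1].
Proof.
apply/seteqP; split=> z; last exact: norm_csq1.
rewrite /unit_circle /= csq_norm -[1]/(1%:C) => -[] h.
by rewrite -(sqr_sqrtr (csq_ge0 z)) h expr1n.
Qed.

Lemma measurable_circle : measurable (@unit_circle R).
Proof.
have -> : @unit_circle R = (fun z : borelC R => csq ((z : R[i]) - 0)) @^-1` [set 1].
  by rewrite unit_circleE; apply/seteqP; split=> z /=; rewrite subr0.
rewrite -[X in measurable X]setTI; apply: measurable_csqB => //.
Qed.

Lemma expi_circle t : @unit_circle R (expi t).
Proof. by rewrite unit_circleE /=; exact: csq_cis. Qed.

End CircleMeasurability.

(** * Projection valued measures *)

Section SpectralCalculus.
Context {R : realType} {H : hilbertType R}.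
Implicit Types (x y z : H) (T : {linear H -> H}) (A B : set (borelC R)).

Lemma cvg_sq_cvg (u : nat -> H) (l : H) : u @ \oo --> l -> sq_cvg u l.
Proof.
move=> /cvgrPdist_lt h e e0; have [|N _ hN] := h (Num.sqrt e)%:C.
  by rewrite ltcR sqrtr_gt0.
exists N => n Nn; have := hN n Nn; rewrite /= norm_lt_sq ?sqrtr_gt0 //.
by rewrite sqr_sqrtr ?(ltW e0) // -sqN opprB.
Qed.

Lemma sq_cvg_cvg (u : nat -> H) (l : H) : sq_cvg u l -> u @ \oo --> l.
Proof.
move=> h; apply/cvgrPdist_lt => eps.
case: eps => a b; rewrite ltcE /= => /andP[/eqP -> a0].
have [N hN] := h (a ^+ 2) (exprn_gt0 2 a0).
exists N => // n Nn /=.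
by have := hN n Nn; rewrite -/(a%:C) norm_lt_sq // -[in X in _ -> X]sqN opprB.
Qed.

Lemma sq_cvg_rip (u : nat -> H) (l x : H) : sq_cvg u l ->
  (fun n => rip (u n) x) @ \oo --> rip l x.
Proof.
move=> h; apply/cvgrPdist_lt => e e0.
have s1 : 0 < sq x + 1 by rewrite ltr_wpDl ?sq_ge0.
have [N hN] := h (e ^+ 2 / (sq x + 1)) (divr_gt0 (exprn_gt0 2 e0) s1).
exists N => // n Nn /=; have := hN n Nn; rewrite ltr_pdivlMr // => h1.
have -> : rip l x - rip (u n) x = rip (l - u n) x by rewrite ripDl ripNl.
rewrite -(@ltr_pXn2r _ 2) ?nnegrE ?(ltW e0) // real_normK ?num_real //.
apply: le_lt_trans (rip_CS _ _) _; apply: le_lt_trans h1.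
by rewrite -[sq (l - u n)]sqN opprB ler_wpM2l ?sq_ge0 // lerDl.
Qed.

Section Pvm.
Variable E : set (borelC R) -> {linear H -> H}.
Hypothesis hE : projection_valued_measure E.

Lemma pvm_idem B x : measurable B -> E B (E B x) = E B x.
Proof. by case: hE => + _ _ mB => /(_ B mB)[+ _] => /(congr1 (@^~ x)). Qed.

Lemma pvm_adj B : measurable B -> is_adjoint (E B) (E B).
Proof. by case: hE => + _ _ mB => /(_ B mB)[]. Qed.

(** The constant series with term E set0 x converges, so its term is 0. *)
Lemma pvm0 x : E set0 x = 0.
Proof.
case: hE => _ _ /(_ (fun=> set0)) h.
have {h} := h (fun=> measurable0) (@trivIset_set0 _ _ _) x.
rewrite bigcup0 //; set a := E set0 x => /cvg_sq_cvg h.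
have sE n : series (fun=> a) n = n%:R *: a.
  by rewrite /series /= big_const_nat iter_addr_0 subn0 scaler_nat.
apply: sq_eq0; apply/eqP; rewrite eq_le sq_ge0 andbT leNgt; apply/negP => a0.
have [N hN] := h (sq a) a0.
have := hN N.+2 (leqW (leqnSn N)); rewrite sE.
have -> : N.+2%:R *: a - a = (N.+1%:R)%:C *: a.
  by rewrite (_ : N.+2%:R = (N.+1%:R)%:C + 1) ?scalerDl ?scale1r ?addrK // rmorph_nat -mulrSr.
by rewrite sqZ csqC ltNge ler_peMl ?sq_ge0 // exprn_ege1 // ler1n.
Qed.

Lemma pvmU A B x : measurable A -> measurable B -> A `&` B = set0 ->
  E (A `|` B) x = E A x + E B x.
Proof.
move=> mA mB AB; pose F (n : nat) := match n with 0%N => A | 1%N => B | _ => set0 end.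
have mF n : measurable (F n) by case: n => [|[|n]] //; exact: measurable0.
have tF : trivIset setT F.
  apply/trivIsetP => i j _ _; case: i => [|[|i]]; case: j => [|[|j]] //=;
    by rewrite ?setI0 ?set0I // setIC.
have UF : \bigcup_n F n = A `|` B.
  apply/seteqP; split=> [z [[|[|n]] _ //= Fz]|z [Az|Bz]]; [by left|by right| |].
    by exists 0%N.
  by exists 1%N.
case: hE => _ _ /(_ F mF tF x); rewrite UF => /cvg_sq_cvg h.
have sE n : series (fun n => E (F n) x) n.+2 = E A x + E B x.
  rewrite /series /= big_nat_recl // big_nat_recl //= big1 ?addr0 // => i _.
  exact: pvm0.
apply/eqP; rewrite -subr_eq0; apply/eqP/sq_eq0/eqP.
rewrite eq_le sq_ge0 andbT leNgt; apply/negP => d0.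
have [N hN] := h _ d0; have := hN N.+2 (leqW (leqnSn N)).
by rewrite sE -sqN opprB ltxx.
Qed.

Lemma pvm_sq B x : measurable B -> rip (E B x) x = sq (E B x).
Proof. by move=> mB; rewrite -{1}pvm_idem // (rip_adj (pvm_adj mB)). Qed.

(** Additivity makes E A y and E B y orthogonal: the square norm of their sum is
   also the sum of the square norms. *)
Lemma pvm_disj A B x : measurable A -> measurable B -> A `&` B = set0 ->
  E A (E B x) = 0.
Proof.
move=> mA mB AB; have orth y : rip (E A y) (E B y) = 0.
  have := pvm_sq y (measurableU _ _ mA mB); rewrite pvmU // ripDl !pvm_sq // sqD.
  lra.
apply: sq_eq0; have := orth (E B x); rewrite pvm_idem // => h.
by rewrite -pvm_sq.
Qed.

Lemma pvmI A B x : measurable A -> measurable B ->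
  E A (E B x) = E (A `&` B) x.
Proof.
move=> mA mB; have mAB := measurableI _ _ mA mB.
have mD (C D : set (borelC R)) : measurable C -> measurable D -> measurable (C `\` D).
  by move=> *; exact: measurableD.
have split (C D : set (borelC R)) y : measurable C -> measurable D ->
    E C y = E (C `&` D) y + E (C `\` D) y.
  move=> mC mD'; rewrite -pvmU ?setUIDK //; [exact: measurableI|exact: mD|].
  by apply/seteqP; split=> z //= -[[_ Dz] [_ nDz]].
rewrite (split B A x) // raddfD /= [E A (E (B `\` A) x)]pvm_disj ?addr0 //; first last.
- by apply/seteqP; split=> z //= -[Az [_ nAz]].
- exact: mD.
rewrite (setIC B A) (split A B) // pvm_idem // pvm_disj ?addr0 //; first exact: mD.
by apply/seteqP; split=> z //= -[[_ nBz] [_ Bz]].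
Qed.

Lemma pvmT x : E setT x = x.
Proof.
have Ec : E (@unit_circle R) = id :> (H -> H) by case: hE.
have mc := @measurable_circle R.
by have := pvmI x mc (@measurableT _ _); rewrite setIT Ec.
Qed.

Lemma pvm_le B x : measurable B -> sq (E B x) <= sq x.
Proof.
move=> mB; have -> : x = E B x + E (~` B) x.
  by rewrite -pvmU ?setUCr ?pvmT ?setICr //; exact: measurableC.
rewrite raddfD /= pvm_idem // pvm_disj ?setICr ?addr0 //; last exact: measurableC.
rewrite sqD (rip_adj (pvm_adj mB)) pvm_disj ?setICr ?rip0r ?mulr0 ?addr0 //; last exact: measurableC.
by rewrite lerDl sq_ge0.
Qed.

Lemma scalar_measureE x B : measurable B -> scalar_measure E x B = (sq (E B x))%:E.
Proof. by move=> mB; rewrite /scalar_measure -/(rip (E B x) x) pvm_sq. Qed.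

End Pvm.
End SpectralCalculus.

Section SpectralLocal.
Context {R : realType} {H : hilbertType R}.
Implicit Types (x y : H) (z : borelC R) (A B : set (borelC R)).

Import HBNNSimple.

(** Lets an integral against a scalar_measure be read as an integral against a
   genuine measure that agrees with it on measurable sets. *)
Lemma eq_integral_measurable d (X : measurableType d) (m1 m2 : set X -> \bar R)
    (D : set X) (f : X -> \bar R) : (forall C : set X, measurable C -> m1 C = m2 C) ->
  (\int[m1]_(x in D) f x = \int[m2]_(x in D) f x)%E.
Proof.
move=> m12; have sE (h : {nnsfun X >-> R}) : sintegral m1 h = sintegral m2 h.
  by apply: eq_fsbigr => r _; rewrite m12.
rewrite /integral; congr (ereal_sup _ - ereal_sup _)%E; apply/seteqP.
  by split=> _ [h hf <-]; exists h; rewrite ?sE.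
by split=> _ [h hf <-]; exists h; rewrite ?sE.
Qed.

Variable E : set (borelC R) -> {linear H -> H}.
Hypothesis hE : projection_valued_measure E.

(** A scalar_measure is only constrained on measurable sets; this is a genuine
   measure with which it agrees there. *)
Lemma pvm_measure x :
  exists m : {measure set (borelC R) -> \bar R}, forall B, m B = (sq (E B x))%:E.
Proof.
pose m B := (sq (E B x))%:E.
have m0 : m set0 = 0%E by rewrite /m (pvm0 hE) sq0.
have mge0 B : (0 <= m B)%E by rewrite lee_fin sq_ge0.
have madd : semi_sigma_additive m.
  move=> F mF tF mUF; have := hE; case=> _ _ /(_ F mF tF x) /cvg_sq_cvg /(@sq_cvg_rip _ _ _ _ x).
  rewrite (pvm_sq hE) // => h; rewrite /m.
  have -> : (fun n => \sum_(0 <= i < n) (sq (E (F i) x))%:E)%E =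
      EFin \o (fun n => rip (series (fun i => E (F i) x) n) x).
    apply/funext => n /=; rewrite sumEFin; congr EFin.
    by rewrite /series /= rip_sum; apply: eq_bigr => i _; rewrite (pvm_sq hE).
  by apply: cvg_EFin => //; exact: nearW.
pose M := isMeasure.Build _ _ _ m m0 mge0 madd.
by exists (HB.pack m M : {measure set (borelC R) -> \bar R}).
Qed.

Lemma pvm_measureT (m : {measure set (borelC R) -> \bar R}) x :
  (forall B, m B = (sq (E B x))%:E) -> m (@unit_circle R) = (sq x)%:E.
Proof. by move=> ->; case: hE => _ -> _. Qed.

Lemma circle_integrable (m : {measure set (borelC R) -> \bar R}) (f : borelC R -> R) :
  (m (@unit_circle R) < +oo)%E ->
  measurable_fun setT f -> (exists M, forall z, @unit_circle R z -> `|f z| <= M) ->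
  m.-integrable (@unit_circle R) (EFin \o f).
Proof.
move=> fin mf [M hM]; apply: measurable_bounded_integrable => //.
- exact: measurable_circle.
- exact: measurable_funTS.
exists M; split; first exact: num_real.
by move=> N MN z /hM h; apply: le_trans h (ltW MN).
Qed.

Lemma circle_Re_bound z : @unit_circle R z -> `|Re z| <= 1.
Proof.
rewrite unit_circleE /= => h; rewrite -(@ler_pXn2r _ 2) ?nnegrE // expr1n.
by rewrite real_normK ?num_real // -h lerDl sqr_ge0.
Qed.

Lemma circle_Im_bound z : @unit_circle R z -> `|Im z| <= 1.
Proof.
rewrite unit_circleE /= => h; rewrite -(@ler_pXn2r _ 2) ?nnegrE // expr1n.
by rewrite real_normK ?num_real // -h lerDr sqr_ge0.
Qed.

Definition coef x (f : borelC R -> R) : R :=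
  fine (\int[scalar_measure E x]_(z in @unit_circle R) (f z)%:E).

Lemma coefE (m : {measure set (borelC R) -> \bar R}) x f :
  (forall B, m B = (sq (E B x))%:E) -> coef x f = \int[m]_(z in @unit_circle R) f z.
Proof.
move=> mE; rewrite /coef; congr fine; apply: eq_integral_measurable => B mB.
by rewrite (scalar_measureE hE) // mE.
Qed.

(** For vectors in complementary spectral subspaces the scalar measures add up, as
   the cross terms vanish. *)
Lemma coefD B x y (f : borelC R -> R) : measurable B -> E B x = x -> E B y = 0 ->
  measurable_fun setT f -> (exists M, forall z, @unit_circle R z -> `|f z| <= M) ->
  coef (x + y) f = coef x f + coef y f.
Proof.
move=> mB hx hy mf bf.
have [mx mxE] := pvm_measure x; have [my myE] := pvm_measure y.
have [ms msE] := pvm_measure (x + y).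
rewrite (coefE _ mxE) (coefE _ myE) (coefE _ msE) /Rintegral.
have intx : mx.-integrable (@unit_circle R) (EFin \o f).
  by apply: circle_integrable => //; rewrite (pvm_measureT mxE) ltry.
have inty : my.-integrable (@unit_circle R) (EFin \o f).
  by apply: circle_integrable => //; rewrite (pvm_measureT myE) ltry.
rewrite -fineD; [|by apply: integrable_fin_num => //; exact: measurable_circle..].
congr fine; transitivity (\int[measure_add mx my]_(z in @unit_circle R) (f z)%:E)%E.
  apply: eq_integral_measurable => A mA; rewrite measure_addE mxE myE msE -EFinD.
  congr EFin; rewrite raddfD sqD -[RHS]addr0; congr (_ + _).
  suff -> : rip (E A x) (E A y) = 0 by rewrite mulr0.
  rewrite -(rip_adj (pvm_adj hE mA)) (pvm_idem hE) //.
  rewrite -{1}hx (pvmI hE) // setIC -(pvmI hE) // (rip_adj (pvm_adj hE mB)).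
  by rewrite hy rip0r.
by apply: integral_measure_add => //; exact: measurable_circle.
Qed.

Variable T : {linear H -> H}.
Hypothesis hT : forall x, '[T x, x] = coef x (fun z => Re z) +i* coef x (fun z => Im z).

(** The moments of x, y and x + y give only the symmetric part of the form of T;
   replacing x by its multiples by 1 and 'i separates the two terms. *)
Lemma spectral_orth B x y : measurable B -> E B x = x -> E B y = 0 -> '[T x, y] = 0.
Proof.
move=> mB hx hy.
have add c : '[T (c *: x), y] + '[T y, c *: x] = 0.
  have hcx : E B (c *: x) = c *: x by rewrite linearZ /= hx.
  have := hT (c *: x + y).
  rewrite (coefD mB hcx hy measurable_Re); last by exists 1; exact: circle_Re_bound.
  rewrite (coefD mB hcx hy measurable_Im); last by exists 1; exact: circle_Im_bound.
  rewrite [T (_ + _)]raddfD /= innerDl !innerDr !hT => /eqP; rewrite eq_complex /=.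
  case: '[T _, y] => a b; case: '[T y, _] => a' b' /= /andP[/eqP h1 /eqP h2].
  by apply/eqP; rewrite eq_complex /=; apply/andP; split; apply/eqP; lra.
have h1 := add 1; have h2 := add 'i; move: h1 h2.
rewrite scale1r linearZ innerZl innerZr; case: '[T x, y] => a b; case: '[T y, x] => a' b'.
move=> /eqP; rewrite eq_complex /= => /andP[/eqP h1 /eqP h2].
move=> /eqP; rewrite eq_complex /= => /andP[/eqP h3 /eqP h4].
by apply/eqP; rewrite eq_complex /=; apply/andP; split; apply/eqP; lra.
Qed.

(** T maps the range of E B and that of its complement to themselves, as
   spectral_orth says. *)
Lemma spectral_comm B x : measurable B -> E B (T x) = T (E B x).
Proof.
move=> mB; have mC := measurableC mB.
have dec u : u = E B u + E (~` B) u.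
  by rewrite -(pvmU hE) ?setUCr ?(pvmT hE) ?setICr.
have z1 : E B (T (E (~` B) x)) = 0.
  apply: inner_inj => w; rewrite linear0r innerC (pvm_adj hE mB).
  rewrite (@spectral_orth (~` B)) ?conjc0 ?(pvm_idem hE) //.
  by rewrite (pvm_disj hE) // setICl.
have z2 : E (~` B) (T (E B x)) = 0.
  apply: inner_inj => w; rewrite linear0r innerC (pvm_adj hE mC).
  rewrite (@spectral_orth B) ?conjc0 ?(pvm_idem hE) //.
  by rewrite (pvm_disj hE) // setICr.
rewrite [in LHS](dec x) raddfD /= raddfD /= z1 addr0.
by rewrite [in RHS](dec (T (E B x))) z2 addr0.
Qed.

(** The square norm of T x - w *: x is at most 2 |x|^2 - 2 Re <T x, w x>, the
   integral of |z - w|^2 against the measure of x, which is carried by B. *)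
Lemma spectral_local B x w (e : R) : measurable B -> E B x = x -> csq w = 1 ->
  sq_contraction T -> 0 <= e ->
  (forall z, B z -> @unit_circle R z -> csq ((z : R[i]) - w) <= e) ->
  sq (T x - w *: x) <= e * sq x.
Proof.
move=> mB hx hw cT e0 hB.
have [m mE] := pvm_measure x; have mc := @measurable_circle R.
have mT := pvm_measureT mE.
have int (f : borelC R -> R) : measurable_fun setT f -> (exists M, forall z, @unit_circle R z -> `|f z| <= M) ->
    m.-integrable (@unit_circle R) (EFin \o f).
  by move=> *; apply: circle_integrable => //; rewrite mT ltry.
have intRe : m.-integrable (@unit_circle R) (EFin \o (fun z : borelC R => Re z)).
  by apply: int; [exact: measurable_Re|exists 1; exact: circle_Re_bound].
have intIm : m.-integrable (@unit_circle R) (EFin \o (fun z : borelC R => Im z)).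
  by apply: int; [exact: measurable_Im|exists 1; exact: circle_Im_bound].
pose F (z : borelC R) := csq ((z : R[i]) - w).
have F4 z : @unit_circle R z -> F z = 2 - 2 * Re w * Re z - 2 * Im w * Im z.
  rewrite unit_circleE /= => hz; rewrite /F.
  transitivity (csq (z : R[i]) + csq w - 2 * Re w * Re z - 2 * Im w * Im z).
    by rewrite /csq !raddfB /=; ring.
  by rewrite hz hw; ring.
have intF : m.-integrable (@unit_circle R) (EFin \o F).
  apply: int; first exact: measurable_csqB.
  exists (2 + `|2 * Re w| + `|2 * Im w|) => z hz; rewrite F4 //.
  apply: le_trans (ler_normB _ _) _; apply: lerD; last first.
    by rewrite normrM ler_piMr // circle_Im_bound.
  apply: le_trans (ler_normB _ _) _; apply: lerD; first by rewrite gtr0_norm.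
  by rewrite normrM ler_piMr // circle_Re_bound.
have JE : 2 * sq x - 2 * rip (T x) (w *: x) = \int[m]_(z in @unit_circle R) F z.
  rewrite (@eq_Rintegral _ _ _ m _ (fun z => 2 - 2 * Re w * Re z - 2 * Im w * Im z)); last first.
    by move=> z; rewrite inE => /F4.
  have intZ c (g : borelC R -> R) : m.-integrable (@unit_circle R) (EFin \o g) ->
      m.-integrable (@unit_circle R) (EFin \o (fun z => c * g z)).
    by move=> ig; have := integrableZl mc c ig; apply: eq_integrable.
  have int2 : m.-integrable (@unit_circle R) (EFin \o (fun=> 2)).
    by apply: int; [exact: measurable_cst|exists `|2|].
  have int3 : m.-integrable (@unit_circle R) (EFin \o (fun z => 2 - 2 * Re w * Re z)).
    by have := integrableB mc int2 (intZ (2 * Re w) _ intRe); apply: eq_integrable.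
  rewrite RintegralB //; last exact: intZ.
  rewrite RintegralB //; last exact: intZ.
  rewrite Rintegral_cst // !RintegralZl // mT /= -!(coefE _ mE).
  rewrite /rip innerZr hT; case: (w) => a b /=; ring.
have JB : \int[m]_(z in @unit_circle R) F z <= e * sq x.
  have mI := measurableI _ _ mc mB; have mD := measurableD mc mB.
  have UE : @unit_circle R = (@unit_circle R `&` B) `|` (@unit_circle R `\` B).
    by rewrite setUIDK.
  have sub1 : @unit_circle R `&` B `<=` @unit_circle R by move=> z [].
  have sub2 : @unit_circle R `\` B `<=` @unit_circle R by move=> z [].
  have intFB : m.-integrable (@unit_circle R `&` B) (EFin \o F) := integrableS mc mI sub1 intF.
  rewrite [X in Rintegral _ X]UE Rintegral_setU //; first last.
  - by apply/disj_set2P; apply/seteqP; split=> z //= -[[_ ?] [_ ?]].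
  - by rewrite -UE.
  have -> : \int[m]_(z in @unit_circle R `\` B) F z = 0.
    rewrite /Rintegral null_set_integral //.
      apply: measurableT_comp => //; apply: measurable_funTS; exact: measurable_csqB.
    rewrite mE; congr EFin.
    have D0 : (@unit_circle R `\` B) `&` B = set0.
      by apply/seteqP; split=> z //= -[[]].
    by rewrite -hx (pvmI hE) // D0 (pvm0 hE) sq0.
  rewrite addr0; apply: (@le_trans _ _ (\int[m]_(z in @unit_circle R `&` B) e)).
    apply: le_Rintegral => //.
      apply: measurable_bounded_integrable => //.
      + by rewrite mE ltry.
      + exists `|e|; split; first exact: num_real.
        by move=> N eN z _ /=; exact: ltW.
    by move=> z [cz Bz]; exact: hB.
  rewrite Rintegral_cst // mE /=.
  by rewrite ler_wpM2l // (pvm_le hE).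
apply: le_trans JB; rewrite -JE sqB sqZ hw mul1r.
by have := cT x; lra.
Qed.

End SpectralLocal.

(** * Singular unitaries are maximal *)

Section SingularMaximal.
Context {R : realType} {H : hilbertType R}.
Implicit Types (x y h : H) (w : R[i]) (T : {linear H -> H}).

Definition nr x : R := Num.sqrt (sq x).

Lemma nr_ge0 x : 0 <= nr x. Proof. exact: sqrtr_ge0. Qed.
Lemma nr_sq x : nr x ^+ 2 = sq x. Proof. by rewrite sqr_sqrtr ?sq_ge0. Qed.
Lemma nrD x y : nr (x + y) <= nr x + nr y.
Proof. by have := ler_normD x y; rewrite !norm_sq -rmorphD lecR. Qed.
Lemma nrZ w x : csq w = 1 -> nr (w *: x) = nr x.
Proof. by move=> hw; rewrite /nr sqZ hw mul1r. Qed.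
Lemma nrC (a : R) x : 0 <= a -> nr (a%:C *: x) = a * nr x.
Proof. by move=> a0; rewrite /nr sqZ csqC sqrtrM ?sqr_ge0 // sqrtr_sqr ger0_norm. Qed.
Lemma nr_le x y : sq x <= sq y -> nr x <= nr y.
Proof. exact: ler_wsqrtr. Qed.

Lemma isometry_energy T g n : (forall x, sq (T x) = sq x) ->
  energy T g n = sq (drive T g n).
Proof.
move=> iT; rewrite /energy big1 ?addr0 // => j _.
by rewrite /defect iT subrr.
Qed.

(** The sum telescopes. *)
Lemma drive_resolvent T w h n :
  drive T (fun j => w ^+ j *: (w *: h - T h)) n = w ^+ n *: h - iter n T h.
Proof.
elim: n => [|n IH] /=; first by rewrite expr0 scale1r subrr.
rewrite IH raddfB /= linearZ /= scalerBr scalerA -exprSr.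
by rewrite addrC addrA subrK.
Qed.

(** The inputs w^j (w h - T' h) have bounded response under T', so their energy is
   of order n for T', and by domination also for T. The inputs w^j (w h - T h)
   have bounded response under T. The difference of the two is the claim. *)
Lemma difference_growth T T' h : (forall x, sq (T x) = sq x) -> sq_contraction T' ->
  harnack_dominated T T' ->
  exists2 C : R, 0 <= C & forall w n, csq w = 1 ->
    sq (drive T (fun j => w ^+ j *: (T h - T' h)) n) <= C * n.+1%:R.
Proof.
move=> iT cT' dom; have cT : sq_contraction T by move=> x; rewrite iT.
have [c c1 hc] := harnack_energy cT cT' dom.
have S0 := sq_ge0 h; exists (8 * c * sq h + 8 * sq h).
  by rewrite addr_ge0 // mulr_ge0 // mulr_ge0 //; lra.
move=> w n hw; pose v := w *: h - T' h.
have wn j : csq (w ^+ j) = 1 by rewrite csqX hw expr1n.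
have b' j : sq (drive T' (fun j => w ^+ j *: v) j) <= 4 * sq h.
  rewrite drive_resolvent; apply: le_trans (sq_le2B _ _) _.
  rewrite sqZ wn mul1r; have := iter_contraction j h cT'; lra.
have b j : sq (w ^+ j *: h - iter j T h) <= 4 * sq h.
  apply: le_trans (sq_le2B _ _) _.
  rewrite sqZ wn mul1r; have := iter_contraction j h cT; lra.
have e' : energy T' (fun j => w ^+ j *: v) n <= 4 * sq h * n.+1%:R.
  have -> : n.+1%:R = 1 + n%:R :> R by rewrite mulrS.
  rewrite /energy mulrDr mulr1; apply: lerD => //.
  rewrite mulr_natr -[X in _ *+ X]card_ord -sumr_const.
  apply: ler_sum => j _; apply: le_trans (b' j).
  by rewrite lerBlDr lerDl sq_ge0.
have := hc w hw v n; rewrite isometry_energy // => e1.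
have -> : (fun j => w ^+ j *: (T h - T' h)) =
    (fun j => w ^+ j *: v - w ^+ j *: (w *: h - T h)).
  apply/funext => j; rewrite -scalerBr; congr (_ *: _).
  by rewrite /v opprB [RHS]addrC subrKA.
rewrite driveB drive_resolvent; apply: le_trans (sq_le2B _ _) _.
have := b n; have := ler_wpM2l (le_trans ler01 c1) e'.
have : 1 <= n.+1%:R :> R by rewrite ler1n.
move: e1; move: (n.+1%:R : R) => m e1 m1 e2 e3.
by have := ler_wpM2l S0 m1; lra.
Qed.

(** Replacing T by the scalar w costs e at every application. *)
Lemma drive_scalar T w y (e : R) n : sq_contraction T -> csq w = 1 -> 0 <= e ->
  nr (T y - w *: y) <= e * nr y ->
  nr (drive T (fun j => w ^+ j *: y) n.+1 - n.+1%:R%:C *: (w ^+ n *: y)) <=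
  n.+1%:R ^+ 2 * e * nr y.
Proof.
move=> cT hw e0 hy.
have ey : 0 <= e * nr y by rewrite mulr_ge0 ?nr_ge0.
elim: n => [|n IH].
  have -> : 1%:R%:C = 1 :> R[i] by [].
  by rewrite /= raddf0 add0r !scale1r subrr /nr sq0 sqrtr0 expr1n !mul1r.
set d := drive T _ n.+1 in IH.
have -> : drive T (fun j => w ^+ j *: y) n.+2 - n.+2%:R%:C *: (w ^+ n.+1 *: y) =
    T (d - n.+1%:R%:C *: (w ^+ n *: y)) + n.+1%:R%:C *: (w ^+ n *: (T y - w *: y)).
  have -> : drive T (fun j => w ^+ j *: y) n.+2 = T d + w ^+ n.+1 *: y by [].
  have -> : n.+2%:R%:C = n.+1%:R%:C + 1 :> R[i] by rewrite !rmorph_nat mulrSr.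
  have TZ c u : T (c *: u) = c *: T u by exact: linearZ.
  rewrite [T (_ - _)]raddfB /= !TZ (scalerBr (w ^+ n)) scalerBr addrA subrK.
  by rewrite [w ^+ n *: (w *: y)]scalerA -exprSr scalerDl scale1r opprD addrACA subrr addr0.
apply: le_trans (nrD _ _) _.
have h1 := le_trans (nr_le (cT (d - n.+1%:R%:C *: (w ^+ n *: y)))) IH.
have h2 : nr (n.+1%:R%:C *: (w ^+ n *: (T y - w *: y))) <= n.+1%:R * (e * nr y).
  by rewrite nrC // nrZ ?csqX ?hw ?expr1n // ler_wpM2l.
apply: le_trans (lerD h1 h2) _.
have -> : n.+2%:R = n.+1%:R + 1 :> R by rewrite mulrSr.
have m0 : 0 <= n.+1%:R :> R by [].
move: (n.+1%:R : R) m0 => m m0.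
rewrite -(mulrA (m ^+ 2)) -(mulrA ((m + 1) ^+ 2)) -mulrDl ler_wpM2r // !expr2; lra.
Qed.

(** While n e is small the n terms of the sum point in the same direction, and the
   sum has norm about n |y|. Compare with the bound sqrt (C n) for n of
   order 1 / e. *)
Lemma growth_local T w y (C e : R) : sq_contraction T -> csq w = 1 ->
  0 < e -> e <= 2^-1 -> 0 <= C -> nr (T y - w *: y) <= e * nr y ->
  (forall n, sq (drive T (fun j => w ^+ j *: y) n) <= C * n.+1%:R) ->
  sq y <= 32 * C * e.
Proof.
move=> cT hw e0 e2 C0 hy hC.
(* The number of terms m is the integer part of 1 / (2 e). *)
have ie : 1 <= (2 * e)^-1 by rewrite invf_ge1 ?mulr_gt0 //; lra.
have /andP[t1 t2] := truncn_itv (le_trans ler01 ie).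
set m := Num.truncn _ in t1 t2.
have m1 : (0 < m)%N.
  by rewrite /m truncn_gt0.
have me : m%:R * (2 * e) <= 1 by rewrite -ler_pdivlMr ?mulr_gt0 // mul1r.
have me' : 1 < m.+1%:R * (2 * e).
  by rewrite -ltr_pdivrMr ?mulr_gt0 // mul1r.
have mR : 1 <= m%:R :> R by rewrite ler1n.
case: m m1 me me' mR {t1 t2} => // n _ me me' mR.
have hd := drive_scalar n cT hw (ltW e0) hy.
have hC' := hC n.+1; move: hd hC'; set d := drive T _ n.+1 => hd hC'.
have h1 : n.+1%:R * nr y <= nr d + n.+1%:R ^+ 2 * e * nr y.
  have -> : n.+1%:R * nr y = nr (n.+1%:R%:C *: (w ^+ n *: y)).
    by rewrite nrC // nrZ // csqX hw expr1n.
  have {1}-> : n.+1%:R%:C *: (w ^+ n *: y) = d - (d - n.+1%:R%:C *: (w ^+ n *: y)).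
    by rewrite opprB addrC subrK.
  apply: le_trans (nrD _ _) _; rewrite lerD2l.
  by rewrite {1}/nr sqN.
have n2 : n.+2%:R = n.+1%:R + 1 :> R by rewrite mulrSr.
rewrite n2 in me' hC'.
move: mR me me' h1 hC'; move: (n.+1%:R : R) => m mR me me' h1 hC'.
have y0 := nr_ge0 y; have d0 := nr_ge0 d.
have h2 : m * nr y <= 2 * nr d.
  have : m * e * (m * nr y) <= 2^-1 * (m * nr y).
    by apply: ler_wpM2r; [apply: mulr_ge0 => //; lra|lra].
  by rewrite expr2 in h1; lra.
have h3 : (m * nr y) ^+ 2 <= 4 * (C * (m + 1)).
  apply: (@le_trans _ _ ((2 * nr d) ^+ 2)).
    by rewrite ler_pXn2r ?nnegrE //; apply: mulr_ge0 => //; lra.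
  by rewrite exprMn nr_sq; lra.
rewrite exprMn nr_sq in h3.
have s0 := sq_ge0 y.
have h4 : m * sq y <= 8 * C.
  have m0 : 0 < m by lra.
  rewrite -(@ler_pM2l _ m) // mulrA -expr2; apply: le_trans h3 _.
  by have := ler_wpM2l C0 mR; lra.
have h5 : sq y <= 4 * e * (m * sq y).
  have : 1 <= 4 * e * m by have := ler_wpM2r (ltW e0) mR; lra.
  by move=> h5; have := ler_wpM2r s0 h5; lra.
by apply: le_trans h5 _; have := ler_wpM2l (ltW e0) h4; lra.
Qed.

(** Only the sign of the imaginary part decides between arccos and its reflection. *)
Lemma circle_param (z : R[i]) : csq z = 1 ->
  exists2 t : R, t \in `[0, 2 * pi[ & z = cis t.
Proof.
case: z => a b; rewrite /csq /= => h.
have a1 : -1 <= a <= 1.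
  rewrite -ler_norml -(@ler_pXn2r _ 2) ?nnegrE // expr1n real_normK ?num_real //.
  by rewrite -h lerDl sqr_ge0.
have p0 := pi_gt0 R.
have ca : cos (acos a) = a by apply: acosK; rewrite in_itv.
have sa : sin (acos a) = `|b|.
  rewrite sin_acos // -sqrtr_sqr; congr Num.sqrt.
  by rewrite -h addrAC subrr add0r.
have := acos_ge0 a1; have := acos_lepi a1 => t1 t0.
have [b0|b0] := leP 0 b.
  exists (acos a); first by rewrite in_itv /= t0 /=; lra.
  by rewrite /cis ca sa ger0_norm.
have tn0 : acos a != 0.
  by apply: contraTneq b0 => t00; rewrite -leNgt; move: sa; rewrite t00 sin0 => /esym/normr0_eq0 ->.
have tp : 0 < acos a by rewrite lt_neqAle eq_sym tn0.
exists (2 * pi - acos a); first by rewrite in_itv /=; apply/andP; split; lra.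
have -> : 2 * pi - acos a = - acos a + pi *+ 2 by rewrite mulr_natl addrC.
by rewrite /cis cosD2pi sinD2pi cosN sinN ca sa ltr0_norm // opprK.
Qed.

End SingularMaximal.

Section SingularUnitaries.
Context {R : realType} {H : hilbertType R}.
Implicit Types (x y h : H) (w : R[i]) (T : {linear H -> H}).

Lemma unitary_isometry T : contraction_op T -> unitary_op T ->
  forall x, sq (T x) = sq x.
Proof.
move=> /contraction_sq cT [h1 _] x.
have hA : is_adjoint T (adjoint T).
  by apply: (@adjoint_exists _ _ _ 1) => [u v|c u|u]; rewrite ?raddfD ?linearZ ?mul1r.
rewrite /sq (rip_adj hA); congr rip.
exact: (congr1 (@^~ x) h1).
Qed.

(** A null set of parameters is covered by intervals of arbitrarily small total
   length; the disks around their right end points then cover the set and have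
   small measure. *)
Lemma singular_local_zero (m : {measure set (borelC R) -> \bar R}) (N : set (borelC R)) (K : R) :
  0 <= K -> measurable N -> circle_lebesgue N = 0%E ->
  (forall s e : R, 0 < e -> e <= 2^-1 ->
    (m [set z | (csq ((z : R[i]) - cis s) <= e ^+ 2)%R] <= (K * e)%:E)%E) ->
  m (N `&` @unit_circle R) = 0%E.
Proof.
move=> K0 mN; set A := `[0, 2 * pi[%classic `&` @expi R @^-1` N.
rewrite /circle_lebesgue -/A => A0 hm.
have mI (s e : R) : measurable ([set z | csq ((z : R[i]) - cis s) <= e] : set (borelC R)).
  have -> : [set z | csq ((z : R[i]) - cis s) <= e] =
      (fun z : borelC R => csq ((z : R[i]) - cis s)) @^-1` `]-oo, e].
    by apply/seteqP; split=> z /=; rewrite in_itv.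
  by rewrite -[X in measurable X]setTI; apply: measurable_csqB.
apply/eqP; rewrite eq_le measure_ge0 andbT.
apply/lee_addgt0Pr => d d0; rewrite add0e.
(* hm only speaks of disks of radius at most 1/2. *)
pose d' := Num.min 2^-1 (d / (K + 1)).
have K1 : 0 < K + 1 by lra.
have d'0 : 0 < d' by rewrite lt_min invr_gt0 ltr0n divr_gt0.
have Kd : K * d' <= d.
  apply: (@le_trans _ _ (K * (d / (K + 1)))); first by rewrite ler_wpM2l // ge_min lexx orbT.
  by rewrite mulrA ler_pdivrMr //; have := ltW d0; nra.
have [_ [F [mF AF] <-] hF] : exists2 s, [set (\sum_(k <oo) wlength idfun (F k))%E |
    F in @measurable_cover _ (ocitv_type R) A] s & (s < d'%:E)%E.
  have := @lb_ereal_inf_adherent R [set (\sum_(k <oo) wlength idfun (F k))%E |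
    F in @measurable_cover _ (ocitv_type R) A] d' d'0.
  have -> : ereal_inf [set (\sum_(k <oo) wlength idfun (F k))%E |
    F in @measurable_cover _ (ocitv_type R) A] = 0%E by exact: A0.
  by rewrite add0e; apply.
have /choice[ab hab] k : exists ab : R * R, F k = `]ab.1, ab.2]%classic.
  by have [p _ <-] := mF k; exists p.
pose I k : set (borelC R) := if (ab k).1 < (ab k).2 then
  [set z | csq ((z : R[i]) - cis (ab k).2) <= ((ab k).2 - (ab k).1) ^+ 2] else set0.
have mIk k : measurable (I k) by rewrite /I; case: ifP.
have wl0 k : (0 <= wlength idfun (F k))%E by exact: wlength_ge0.
have cov : N `&` @unit_circle R `<=` \bigcup_k I k.
  move=> z [Nz]; rewrite unit_circleE /= => /circle_param[t tI zE].
  have At : A t by split => //; rewrite /preimage /= /expi -/(cis t) -zE.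
  have [k _] := AF t At; rewrite hab /= in_itv /= => /andP[at_ tb].
  exists k => //; rewrite /I (lt_le_trans at_ tb) /= zE.
  apply: le_trans (cis_lip _ _) _; rewrite -sqrrN opprB.
  by rewrite ler_pXn2r ?nnegrE //; lra.
have mIle k : (m (I k) <= K%:E * wlength idfun (F k))%E.
  rewrite /I; case: ifPn => [lt_ab|_]; last by rewrite measure0 mule_ge0.
  have wE : wlength idfun (F k) = ((ab k).2 - (ab k).1)%:E.
    by rewrite hab wlength_itv_bnd // ltW.
  rewrite wE -EFinM; apply: hm; first by rewrite subr_gt0.
  rewrite -lee_fin -wE; apply: (@le_trans _ _ (\sum_(k <oo) wlength idfun (F k))%E).
    rewrite (@nneseriesD1 _ _ k) //; first by rewrite leeDl // nneseries_ge0.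
  by apply: ltW; apply: lt_le_trans hF _; rewrite lee_fin ge_min lexx.
apply: (@le_trans _ _ (\sum_(k <oo) m (I k))%E).
  apply: measure_sigma_subadditive => //; first exact: measurableI mN (@measurable_circle R).
apply: (@le_trans _ _ (\sum_(k <oo) (K%:E * wlength idfun (F k)))%E).
  exact: lee_nneseries.
rewrite nneseriesZl //; apply: (@le_trans _ _ (K%:E * d'%:E)%E).
  by rewrite lee_wpmul2l ?lee_fin // ltW.
by rewrite -EFinM lee_fin.
Qed.

(** For g = T h - T' h the spectral measure is absolutely continuous on account of
   its growth on small disks, and singular by assumption. *)
Lemma singular_unitary_maximal T : contraction_op T -> singular_unitary T ->
  harnack_maximal T.
Proof.
move=> cT [uT [E [hE hTE] sing]]; have iT := unitary_isometry cT uT.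
have sT : sq_contraction T by exact/contraction_sq.
split=> // T' /contraction_sq cT' dom; apply/funext => h.
have [C C0 hC] := difference_growth h iT cT' dom.
set g := T h - T' h in hC.
suff : g = 0 by move=> /eqP; rewrite subr_eq0 => /eqP.
clearbody g.
have hT x : '[T x, x] = coef E x (fun z => complex.Re z) +i* coef E x (fun z => complex.Im z).
  exact: hTE.
have [N [mN NC N0]] := sing g.
have [m mE] := pvm_measure hE g.
have loc (s e : R) : 0 < e -> e <= 2^-1 ->
    (m [set z | (csq ((z : R[i]) - cis s) <= e ^+ 2)%R] <= ((32 * C) * e)%:E)%E.
  move=> e0 e2; set I := [set z | _].
  have mI : measurable (I : set (borelC R)).
    have -> : I = (fun z : borelC R => csq ((z : R[i]) - cis s)) @^-1` `]-oo, e ^+ 2].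
      by apply/seteqP; split=> z /=; rewrite in_itv.
    by rewrite -[X in measurable X]setTI; apply: measurable_csqB.
  rewrite mE lee_fin; apply: (growth_local sT (csq_cis s)) => //.
    rewrite -(@ler_pXn2r _ 2) ?nnegrE ?mulr_ge0 ?nr_ge0 ?(ltW e0) //.
    rewrite exprMn !nr_sq; apply: (spectral_local hE hT mI) => //.
    - exact: pvm_idem.
    - exact: csq_cis.
    - exact: sqr_ge0.
  move=> n; apply: le_trans (hC (cis s) n (csq_cis s)).
  have -> : drive T (fun j => cis s ^+ j *: E I g) n = E I (drive T (fun j => cis s ^+ j *: g) n).
    have EZ c u : E I (c *: u) = c *: E I u by exact: linearZ.
    have ED u v : E I (u + v) = E I u + E I v by exact: raddfD.
    elim: n => [|n IH] /=; first by rewrite raddf0.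
    by rewrite IH -(spectral_comm hE hT) // ED EZ.
  exact: pvm_le.
have mc := @measurable_circle R; have mC := measurableC mN.
have z1 := singular_local_zero (mulr_ge0 (ler0n _ 32) C0) mN N0 loc.
have z2 : E (~` N) g = 0.
  by apply: sq_eq0; move: NC; rewrite (scalar_measureE hE) // => -[].
have z3 : E N g = 0.
  apply: sq_eq0; have Ec : E (@unit_circle R) g = g by case: hE => _ -> _.
  move: z1; rewrite mE => -[]; rewrite -(pvmI hE) // Ec //.
by rewrite -(pvmT hE g) -(setUv N) (pvmU hE) ?setICr // z2 z3 addr0.
Qed.

End SingularUnitaries.

(** * Limits along an ultrafilter *)

Section UltraLimit.
Context {R : realType}.
Implicit Types (u v : nat -> R).

Lemma ultra_exists : exists G : set_system nat, UltraFilter G /\ (\oo : set_system nat) `<=` G.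
Proof. exact: ultraFilterLemma. Qed.

Definition ultra : set_system nat := sval (cid ultra_exists).

Global Instance ultra_ultra : UltraFilter ultra.
Proof. by rewrite /ultra; case: cid => G []. Qed.

Lemma ultra_eventually (A : set nat) : (\forall n \near \oo, A n) -> ultra A.
Proof. by rewrite /ultra; case: cid => G /= [_ h] hA; exact: (h A hA). Qed.

(** Limits along a free ultrafilter exist for all bounded sequences and respect sums
   and inequalities, so that no convergence has to be proved for the discrete
   approximations of spectral measures. *)
Definition ulim u : R := lim (u @ ultra).
Definition bnd u := exists C : R, forall n, `|u n| <= C.

Lemma ulim_cvg u : bnd u -> u @ ultra --> ulim u.
Proof.
move=> [C hC]; suff : exists p : R, u @ ultra --> p.
  by move=> [p hp]; rewrite /ulim (cvg_lim _ hp).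
have mem : (u @ ultra) `[(- C), C]%classic.
  suff : ultra (u @^-1` `[(- C), C]%classic) by [].
  by apply: filterE => n; rewrite /= in_itv /= -ler_norml.
have [p [_ clp]] := @segment_compact R (- C) C (u @ ultra) _ mem.
exists p => B /= Bp; have [//|nB] := in_ultra_setVsetC (u @^-1` B) ultra_ultra.
have [x [nBx Bx]] := clp (~` B) B nB Bp.
by case: nBx.
Qed.

Lemma ulim_unique u l : u @ ultra --> l -> ulim u = l.
Proof. by move=> h; apply: cvg_lim. Qed.

Lemma ulimE u l : u @ \oo --> l -> ulim u = l.
Proof.
move=> h; apply: ulim_unique; apply: cvg_trans h.
by move=> A /= hA; exact: ultra_eventually.
Qed.

Lemma ulim_cst (c : R) : ulim (fun=> c) = c.
Proof. by apply: ulim_unique; exact: cvg_cst. Qed.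

Lemma ulim_le_near u v : bnd u -> bnd v -> (\forall n \near \oo, u n <= v n) ->
  ulim u <= ulim v.
Proof.
move=> bu bv h; apply: (ler_cvg_to (ulim_cvg bu) (ulim_cvg bv)).
exact: ultra_eventually.
Qed.

Lemma ulim_le u v : bnd u -> bnd v -> (forall n, u n <= v n) -> ulim u <= ulim v.
Proof. by move=> bu bv h; apply: ulim_le_near => //; exact: nearW. Qed.

Lemma bndD u v : bnd u -> bnd v -> bnd (fun n => u n + v n).
Proof.
move=> [C hC] [D hD]; exists (C + D) => n.
by apply: le_trans (ler_normD _ _) _; exact: lerD.
Qed.

Lemma bndZ (c : R) u : bnd u -> bnd (fun n => c * u n).
Proof. by move=> [C hC]; exists (`|c| * C) => n; rewrite normrM ler_wpM2l. Qed.

Lemma bnd_cst (c : R) : bnd (fun=> c). Proof. by exists `|c|. Qed.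

Lemma bnd_itv u (a b : R) : (forall n, a <= u n <= b) -> bnd u.
Proof.
move=> h; exists (`|a| + `|b|) => n; have /andP[h1 h2] := h n.
have := ler_norm b; have := ler_norm (- a); rewrite normrN => h3 h4.
have := normr_ge0 a; have := normr_ge0 b => h5 h6.
by rewrite ler_norml; lra.
Qed.

Lemma ulimD u v : bnd u -> bnd v -> ulim (fun n => u n + v n) = ulim u + ulim v.
Proof. by move=> bu bv; apply: ulim_unique; apply: cvgD; exact: ulim_cvg. Qed.

Lemma ulimZ (c : R) u : bnd u -> ulim (fun n => c * u n) = c * ulim u.
Proof. by move=> bu; apply: ulim_unique; apply: cvgMr; exact: ulim_cvg. Qed.

Lemma ulimB u v : bnd u -> bnd v -> ulim (fun n => u n - v n) = ulim u - ulim v.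
Proof.
move=> bu bv; have := ulimD bu (bndZ (-1) bv); rewrite ulimZ // mulN1r => <-.
by congr ulim; apply/funext => n; rewrite mulN1r.
Qed.

Lemma bndB u v : bnd u -> bnd v -> bnd (fun n => u n - v n).
Proof.
move=> bu bv; have := bndD bu (bndZ (-1) bv); congr bnd.
by apply/funext => n; rewrite mulN1r.
Qed.

Lemma ulim_itv u (a b : R) : (forall n, a <= u n <= b) -> a <= ulim u <= b.
Proof.
move=> h; have bu := bnd_itv h.
rewrite -{1}(ulim_cst a) -(ulim_cst b); apply/andP; split.
  by apply: ulim_le => //; [exact: bnd_cst|move=> n; case/andP: (h n)].
by apply: ulim_le => //; [exact: bnd_cst|move=> n; case/andP: (h n)].
Qed.

Lemma ulim_lt_ex u (c : R) : bnd u -> ulim u < c -> exists n, u n < c.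
Proof.
move=> bu h; have : ultra [set n | u n < c].
  have /cvgrPdist_lt/(_ (c - ulim u)) := ulim_cvg bu.
  rewrite subr_gt0 => /(_ h); apply: filterS => n /=.
  by rewrite ltr_norml => /andP[? _]; lra.
by move=> /filter_ex[n hn]; exists n.
Qed.

Lemma cvg_inv_succ : (fun n => n.+1%:R^-1 : R) @ \oo --> (0 : R).
Proof.
apply/cvgrPdist_lt => e e0; have [k hk] := inv_succ_lt e0.
exists k => // n kn /=; rewrite sub0r normrN ger0_norm ?invr_ge0 //.
exact: hk.
Qed.

End UltraLimit.

(** * Discrete spectral measures of orbits *)

(* Keeps simplification from exposing sines and cosines. *)
#[local] Arguments unity_root : simpl never.
#[local] Arguments cis : simpl never.

Section DiscreteMeasure.
Context {R : realType} {H : hilbertType R}.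
Implicit Types (x y : H) (w : R[i]) (T S : {linear H -> H}) (s t : R).

Lemma unity_rootT n : unity_root n n = unity_root n 0 :> R[i].
Proof.
case: n => [//|n]; rewrite /unity_root mulr0 cis0 divfK ?pnatr_eq0 //.
by rewrite /cis mulr_natl cos2pi sin2pi.
Qed.

(** Expand the squares and sum over j first: the roots of unity are orthogonal. *)
Lemma vector_parseval n (u : nat -> H) :
  \sum_(j < n) sq (\sum_(k < n) conjc (unity_root n j) ^+ k *: u k) =
  n%:R * \sum_(k < n) sq (u k).
Proof.
have inner_sumr (I : Type) (r : seq I) (F : I -> H) x :
    '[x, \sum_(j <- r) F j] = \sum_(j <- r) '[x, F j].
  by rewrite innerC inner_sum conjc_sum; apply: eq_bigr => j _; rewrite -innerC.
have sqE (c : R[i]) : (sq (\sum_(k < n) conjc c ^+ k *: u k))%:C =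
    \sum_(k < n) \sum_(l < n) c ^+ l * conjc c ^+ k * '[u k, u l].
  rewrite -innerxx inner_sum; apply: eq_bigr => k _.
  rewrite inner_sumr; apply: eq_bigr => l _.
  by rewrite innerZl innerZr conjcX conjcK mulrA (mulrC (c ^+ l)).
have CS (F : 'I_n -> R) : (\sum_(j < n) F j)%:C = \sum_(j < n) (F j)%:C by exact: rmorph_sum.
have CM (a b : R) : (a * b)%:C = a%:C * b%:C by exact: rmorphM.
apply: (@complexI R); rewrite CS CM CS.
have -> : (n%:R : R)%:C = n%:R by exact: rmorph_nat.
under eq_bigr do rewrite sqE.
rewrite exchange_big mulr_sumr; apply: eq_bigr => k _.
have orth (l : 'I_n) : \sum_(j < n) unity_root n j ^+ l * conjc (unity_root n j) ^+ k *
    '[u k, u l] = (if (l : nat) == k then n%:R else 0) * '[u k, u l].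
  by rewrite -mulr_suml unity_root_orth.
rewrite exchange_big (eq_bigr _ (fun l _ => orth l)) (bigD1 k) // eqxx innerxx.
rewrite big1 /= ?addr0 // => l; rewrite -val_eqE => /negbTE /= ->.
by rewrite mul0r.
Qed.

Lemma sum_unity_root_shift n (F : R[i] -> R) :
  \sum_(j < n) F (unity_root n j.+1) = \sum_(j < n) F (unity_root n j).
Proof.
case: n => [|n]; first by rewrite !big_ord0.
by rewrite big_ord_recr [RHS]big_ord_recl /= unity_rootT addrC.
Qed.

Variables T S : {linear H -> H}.
Hypothesis TS : forall x, T (S x) = x.
Hypothesis iT : forall x, sq (T x) = sq x.

(** The nodes cover the arc with parameters in ]0, 2 pi], so that the distribution
   functions vanish at 0 and are complete at 2 pi. *)
Definition node N (j : nat) : R := 2 * pi / N.+1%:R * j.+1%:R.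
(** The Fourier transform of the orbit x, T x, T^2 x, ... truncated at N. *)
Definition dsum N w x : H := geo_sum (conjc w) T x N.
(** The normalization makes the weights of all nodes add up to sq x. *)
Definition wt N (j : nat) x : R := N.+1%:R ^- 2 * sq (dsum N.+1 (cis (node N j)) x).
Definition dist N t x : R := \sum_(j < N.+1 | node N j <= t) wt N j x.

Lemma iter_isometry k x : sq (iter k T x) = sq x.
Proof. by elim: k => //= k IH; rewrite iT. Qed.

Lemma isometry_inv x : sq (S x) = sq x.
Proof. by rewrite -(iT (S x)) TS. Qed.

Lemma dsumD N w x y : dsum N w (x + y) = dsum N w x + dsum N w y.
Proof.
by rewrite /dsum /geo_sum -big_split; apply: eq_bigr => k _; rewrite iter_add scalerDr.
Qed.

Lemma dsumZ N w c x : dsum N w (c *: x) = c *: dsum N w x.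
Proof.
rewrite /dsum /geo_sum scaler_sumr; apply: eq_bigr => k _.
by rewrite iter_scale !scalerA mulrC.
Qed.

Lemma dsumB N w x y : dsum N w (x - y) = dsum N w x - dsum N w y.
Proof. by rewrite dsumD -scaleN1r dsumZ scaleN1r. Qed.

Lemma wt_ge0 N j x : 0 <= wt N j x.
Proof. by rewrite mulr_ge0 ?invr_ge0 ?exprn_ge0 ?sq_ge0. Qed.

Lemma wt_total N x : \sum_(j < N.+1) wt N j x = sq x.
Proof.
rewrite -mulr_sumr.
rewrite (@sum_unity_root_shift N.+1 (fun w => sq (dsum N.+1 w x))).
rewrite /dsum /geo_sum (vector_parseval _ (fun k => iter k T x)).
under eq_bigr do rewrite iter_isometry.
rewrite sumr_const card_ord -[sq x *+ _]mulr_natr.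
have : N.+1%:R != 0 :> R by rewrite pnatr_eq0.
by move: (N.+1%:R : R) => m m0; field.
Qed.

Lemma dist_itv N t x : 0 <= dist N t x <= sq x.
Proof.
apply/andP; split; first by apply: sumr_ge0 => j _; exact: wt_ge0.
rewrite -(wt_total N x) [leRHS](bigID (fun j : 'I_N.+1 => node N j <= t)) /=.
by rewrite lerDl sumr_ge0 // => j _; exact: wt_ge0.
Qed.

Lemma dist_incr N s t x : s <= t ->
  dist N t x - dist N s x = \sum_(j < N.+1 | s < node N j <= t) wt N j x.
Proof.
move=> st; apply/eqP; rewrite subr_eq addrC; apply/eqP.
rewrite /dist (bigID (fun j : 'I_N.+1 => node N j <= s)) /=; congr (_ + _).
  apply: eq_bigl => j; apply/andP/idP => [[]//|h]; split=> //.
  exact: le_trans h st.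
by apply: eq_bigl => j; rewrite -ltNge andbC.
Qed.

Lemma node_gt0 N j : 0 < node N j.
Proof. by rewrite mulr_gt0 ?ltr0n // divr_gt0 ?ltr0n // mulr_gt0 // pi_gt0. Qed.

Lemma node_le N (j : 'I_N.+1) : node N j <= 2 * pi.
Proof.
rewrite /node mulrAC ler_pdivrMr ?ltr0n // ler_wpM2l ?mulr_ge0 ?pi_ge0 //.
by rewrite ler_nat.
Qed.

Lemma dist_le0 N t x : t <= 0 -> dist N t x = 0.
Proof.
move=> t0; apply: big1 => j h; exfalso; move: h; apply/negP; rewrite -ltNge.
exact: le_lt_trans t0 (node_gt0 _ _).
Qed.

Lemma dist_ge2pi N t x : 2 * pi <= t -> dist N t x = sq x.
Proof.
move=> t0; rewrite -(wt_total N x); apply: eq_bigl => j.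
exact: le_trans (node_le _) t0.
Qed.

(** The cross terms cancel. *)
Lemma sq_quad (r : R) x y : r != 0 ->
  sq (x + y) + sq (r%:C *: x - r^-1%:C *: y) =
  (1 + r ^+ 2) * sq x + (1 + r ^- 2) * sq y.
Proof. by move=> r0; rewrite sqD sqB !sqZ !csqC ripZl ripZr; field. Qed.

Lemma dist_quad N t (r : R) x y : r != 0 ->
  dist N t (x + y) + dist N t (r%:C *: x - r^-1%:C *: y) =
  (1 + r ^+ 2) * dist N t x + (1 + r ^- 2) * dist N t y.
Proof.
move=> r0; rewrite /dist !mulr_sumr -!big_split /=; apply: eq_bigr => j _.
rewrite /wt dsumD dsumB !dsumZ -mulrDr (sq_quad _ _ r0); ring.
Qed.

(** The operator A is the function f of T as far as the Fourier transforms of orbits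
   can tell: they turn A into multiplication by f up to an error that does not
   grow with N, whereas their own square norm is of order N. The Lipschitz bound
   makes f nearly constant on short arcs. *)
Definition symbol (A : H -> H) (f : R[i] -> R[i]) := exists C : R,
  [/\ 0 <= C, (forall x, sq (A x) <= C * sq x),
      (forall w, csq w = 1 -> csq (f w) <= C),
      (forall s t, csq (f (cis s) - f (cis t)) <= C * (s - t) ^+ 2) &
      forall N w x, csq w = 1 ->
        sq (dsum N w (A x) - f w *: dsum N w x) <= C * sq x].

Lemma symbol_scalar c : symbol (fun x => c *: x) (fun=> c).
Proof.
exists (csq c); split; first exact: csq_ge0.
- by move=> x; rewrite sqZ.
- by [].
- by move=> s t /=; rewrite subrr /csq /= expr0n /= addr0 mulr_ge0 ?addr_ge0 ?sqr_ge0.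
- by move=> N w x _ /=; rewrite dsumZ subrr sq0 mulr_ge0 ?csq_ge0 ?sq_ge0.
Qed.

(** The sum telescopes up to its two end terms. *)
Lemma dsum_T N w x : csq w = 1 ->
  T (dsum N w x) - w *: dsum N w x = w *: (conjc w ^+ N *: iter N T x - x).
Proof.
move=> hw; have wv : w * conjc w = 1 by rewrite csq_mulJ hw.
have e1 : dsum N.+1 w x = x + conjc w *: T (dsum N w x) by exact: geo_sumS.
have e2 : dsum N.+1 w x = dsum N w x + conjc w ^+ N *: iter N T x.
  by rewrite /dsum /geo_sum big_ord_recr.
have -> : T (dsum N w x) = w *: (dsum N.+1 w x - x).
  by rewrite e1 addrC addKr scalerA wv scale1r.
rewrite e2 -scalerBr; congr (_ *: _).
by rewrite addrAC [dsum N w x + _]addrC addrK.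
Qed.

Lemma dsum_comm N w x : dsum N w (T x) = T (dsum N w x).
Proof.
rewrite /dsum /geo_sum raddf_sum; apply: eq_bigr => k _ /=.
by rewrite linearZ /= -iterSr.
Qed.

Lemma dsum_T_err N w x : csq w = 1 ->
  sq (dsum N w (T x) - w *: dsum N w x) <= 4 * sq x.
Proof.
move=> hw; rewrite dsum_comm dsum_T // sqZ hw mul1r.
apply: le_trans (sq_le2B _ _) _.
by rewrite sqZ csqX csq_conj hw expr1n mul1r iter_isometry; lra.
Qed.

Lemma symbol_T : symbol T id.
Proof.
exists 4; split=> //.
- by move=> x; rewrite iT; have := sq_ge0 x; lra.
- by move=> w ->; lra.
- by move=> s t; apply: le_trans (cis_lip _ _) _; have := sqr_ge0 (s - t); lra.
- exact: dsum_T_err.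
Qed.

(** The relation for T at S x, multiplied by conjc w. *)
Lemma symbol_S : symbol S (fun w => conjc w).
Proof.
exists 4; split=> //.
- by move=> x; rewrite isometry_inv; have := sq_ge0 x; lra.
- by move=> w; rewrite csq_conj => ->; lra.
- move=> s t; have -> : conjc (cis s) - conjc (cis t) = conjc (cis s - cis t).
    by rewrite rmorphB.
  by rewrite csq_conj; apply: le_trans (cis_lip _ _) _; have := sqr_ge0 (s - t); lra.
- move=> N w x hw; have := dsum_T_err N (S x) hw; rewrite TS isometry_inv => h.
  apply: le_trans h; rewrite -[leRHS]sqN opprB.
  have -> : dsum N w (S x) - conjc w *: dsum N w x =
      conjc w *: (w *: dsum N w (S x) - dsum N w x).
    by rewrite scalerBr scalerA mulrC csq_mulJ hw scale1r.
  by rewrite sqZ csq_conj hw mul1r.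
Qed.

Lemma csq_le2 (a b : R[i]) : csq (a + b) <= 2 * csq a + 2 * csq b.
Proof.
case: a b => a a' [b b']; rewrite /csq /=.
by have := sqr_ge0 (a - b); have := sqr_ge0 (a' - b'); rewrite !expr2; lra.
Qed.

Lemma symbolD A f B g : symbol A f -> symbol B g ->
  symbol (fun x => A x + B x) (fun w => f w + g w).
Proof.
move=> [C [C0 hA hf lf dA]] [D [D0 hB hg lg dB]].
exists (2 * C + 2 * D); split; first by rewrite addr_ge0 ?mulr_ge0.
- by move=> x; apply: le_trans (sq_le2 _ _) _; have := hA x; have := hB x; lra.
- by move=> w hw; apply: le_trans (csq_le2 _ _) _; have := hf w hw; have := hg w hw; lra.
- move=> s t; rewrite opprD addrACA; apply: le_trans (csq_le2 _ _) _.
  by have := lf s t; have := lg s t; lra.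
- move=> N w x hw; rewrite dsumD scalerDl opprD addrACA.
  by apply: le_trans (sq_le2 _ _) _; have := dA N w x hw; have := dB N w x hw; lra.
Qed.

Lemma symbolM A f B g : symbol A f -> symbol B g ->
  symbol (fun x => A (B x)) (fun w => f w * g w).
Proof.
move=> [C [C0 hA hf lf dA]] [D [D0 hB hg lg dB]].
have CD : 0 <= C * D by rewrite mulr_ge0.
exists (4 * (C * D)); split; first by lra.
- move=> x; have := ler_wpM2l C0 (hB x); have := hA (B x); have := mulr_ge0 CD (sq_ge0 x).
  by lra.
- move=> w hw; rewrite csqM; have := ler_pM (csq_ge0 _) (csq_ge0 _) (hf w hw) (hg w hw).
  by lra.
- move=> s t.
  have -> : f (cis s) * g (cis s) - f (cis t) * g (cis t) =
      (f (cis s) - f (cis t)) * g (cis s) + f (cis t) * (g (cis s) - g (cis t)) by ring.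
  apply: le_trans (csq_le2 _ _) _; rewrite !csqM.
  have := ler_pM (csq_ge0 _) (csq_ge0 _) (lf s t) (hg _ (csq_cis s)).
  have := ler_pM (csq_ge0 _) (csq_ge0 _) (hf _ (csq_cis t)) (lg s t).
  by lra.
- move=> N w x hw.
  have -> : dsum N w (A (B x)) - (f w * g w) *: dsum N w x =
      (dsum N w (A (B x)) - f w *: dsum N w (B x)) +
      f w *: (dsum N w (B x) - g w *: dsum N w x).
    by rewrite scalerBr scalerA addrA subrK.
  apply: le_trans (sq_le2 _ _) _; rewrite sqZ.
  have := ler_pM (csq_ge0 _) (sq_ge0 _) (hf w hw) (dB N w x hw).
  have := le_trans (dA N w (B x) hw) (ler_wpM2l C0 (hB x)).
  by lra.
Qed.

Lemma symbolX A f n : symbol A f -> symbol (fun x => iter n A x) (fun w => f w ^+ n).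
Proof.
move=> sA; elim: n => [|n IH].
  have -> : (fun x => iter 0 A x) = (fun x => (1 : R[i]) *: x).
    by apply/funext => x; rewrite scale1r.
  have -> : (fun w => f w ^+ 0) = (fun=> 1) by apply/funext => w; rewrite expr0.
  exact: symbol_scalar.
have -> : (fun w => f w ^+ n.+1) = (fun w => f w * f w ^+ n).
  by apply/funext => w; rewrite exprS.
exact: symbolM sA IH.
Qed.

End DiscreteMeasure.

Section Distribution.
Context {R : realType} {H : hilbertType R}.
Implicit Types (x y : H) (w : R[i]) (s t : R).

Lemma csqB_sqr (a b : R[i]) : (csq a - csq b) ^+ 2 <= csq (a - b) * csq (a + b).
Proof.
case: a b => a a' [b b']; rewrite /csq /=.
have -> : ((a - b) ^+ 2 + (a' - b') ^+ 2) * ((a + b) ^+ 2 + (a' + b') ^+ 2) =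
  (a ^+ 2 + a' ^+ 2 - (b ^+ 2 + b' ^+ 2)) ^+ 2 + (2 * (a' * b - a * b')) ^+ 2 by ring.
by rewrite lerDl sqr_ge0.
Qed.

Lemma symbol_lip (f : R[i] -> R[i]) (C : R) : 0 <= C ->
  (forall w, csq w = 1 -> csq (f w) <= C) ->
  (forall s t, csq (f (cis s) - f (cis t)) <= C * (s - t) ^+ 2) ->
  forall s t, `|csq (f (cis s)) - csq (f (cis t))| <= 2 * C * `|s - t|.
Proof.
move=> C0 hf lf s t.
rewrite -(@ler_pXn2r _ 2) ?nnegrE ?mulr_ge0 // real_normK ?num_real //.
apply: le_trans (csqB_sqr _ _) _; rewrite exprMn real_normK ?num_real //.
have -> : (2 * C) ^+ 2 * (s - t) ^+ 2 = (C * (s - t) ^+ 2) * (2 * C + 2 * C) by ring.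
apply: ler_pM; rewrite ?csq_ge0 //.
apply: le_trans (csq_le2 _ _) _.
by have := hf _ (csq_cis s); have := hf _ (csq_cis t); lra.
Qed.


Lemma young_abs (d p q r : R) : 0 < d -> 0 <= d ^+ 2 * p + q + 2 * (d * r) ->
  0 <= d ^+ 2 * p + q - 2 * (d * r) -> `|2 * r| <= d * p + d^-1 * q.
Proof.
move=> d0 h1 h2.
have -> : d * p + d^-1 * q = (d ^+ 2 * p + q) / d by field; rewrite gt_eqF.
rewrite ler_pdivlMr // -[X in _ * X](gtr0_norm d0) -normrM ler_norml.
by apply/andP; split; lra.
Qed.

Variable T : {linear H -> H}.
Hypothesis iT : forall x, sq (T x) = sq x.

(** Expand the square of f(w) a + e, where a is the transform of x and e the error.
   The parameter d trades the cross term for a small multiple of the main term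
   and a large multiple of the error, which the normalization makes negligible. *)
Lemma wt_symbol (A : H -> H) (f : R[i] -> R[i]) (C d : R) x N j : 0 < d ->
  (forall w, csq w = 1 -> csq (f w) <= C) ->
  (forall N w x, csq w = 1 -> sq (dsum T N w (A x) - f w *: dsum T N w x) <= C * sq x) ->
  `|wt T N j (A x) - csq (f (cis (node N j))) * wt T N j x| <=
  d * C * wt T N j x + (1 + d^-1) * C * sq x * N.+1%:R ^- 2.
Proof.
move=> d0 hf dA; rewrite /wt; set w := cis (node N j); set m := N.+1%:R ^- 2.
have hw : csq w = 1 := csq_cis _.
have m0 : 0 <= m by rewrite invr_ge0 exprn_ge0.
set a := dsum T N.+1 w x; set b := dsum T N.+1 w (A x).
have : sq (b - f w *: a) <= C * sq x := dA _ _ _ hw.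
set e := b - f w *: a => he.
have -> : b = f w *: a + e by rewrite addrC subrK.
set u := f w *: a.
have ua : sq u <= C * sq a by rewrite sqZ ler_wpM2r ?sq_ge0 ?hf.
have cross : `|2 * rip u e| <= d * sq u + d^-1 * sq e.
  apply: young_abs => //.
    by have := sq_ge0 (d%:C *: u + e); rewrite (sqD (d%:C *: u)) (sqZ d%:C) csqC ripZl.
  by have := sq_ge0 (d%:C *: u - e); rewrite (sqB (d%:C *: u)) (sqZ d%:C) csqC ripZl.
rewrite (sqD u) [csq (f w) * _]mulrCA -sqZ -/u -mulrBr normrM (ger0_norm m0).
have -> : d * C * (m * sq a) + (1 + d^-1) * C * sq x * m =
  m * (d * (C * sq a) + (C * sq x + d^-1 * (C * sq x))) by ring.
rewrite ler_wpM2l //.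
have -> : sq u + sq e + 2 * rip u e - sq u = sq e + 2 * rip u e by ring.
apply: le_trans (ler_normD _ _) _; rewrite ger0_norm ?sq_ge0 //.
have di : 0 <= d^-1 by rewrite invr_ge0 ltW.
have := ler_wpM2l (ltW d0) ua; have := ler_wpM2l di he; lra.
Qed.

(** On a short arc A multiplies the discrete measures by the nearly constant |f|^2. *)
Lemma dist_symbol (A : H -> H) (f : R[i] -> R[i]) (C d : R) x N s t : 0 < d -> 0 <= C ->
  (forall w, csq w = 1 -> csq (f w) <= C) ->
  (forall s t, csq (f (cis s) - f (cis t)) <= C * (s - t) ^+ 2) ->
  (forall N w x, csq w = 1 -> sq (dsum T N w (A x) - f w *: dsum T N w x) <= C * sq x) ->
  s <= t ->
  `|(dist T N t (A x) - dist T N s (A x)) - csq (f (cis s)) * (dist T N t x - dist T N s x)| <=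
  2 * C * (t - s) * (dist T N t x - dist T N s x) + d * (C * sq x) +
  ((1 + d^-1) * C * sq x) * N.+1%:R^-1.
Proof.
move=> d0 C0 hf lf dA st; rewrite !dist_incr // !mulr_sumr -sumrB.
set c := csq (f (cis s)); set K := (1 + d^-1) * C * sq x.
have K0 : 0 <= K.
  by rewrite mulr_ge0 ?sq_ge0 // mulr_ge0 // addr_ge0 // invr_ge0 ltW.
apply: le_trans (ler_norm_sum _ _ _) _.
have tot : \sum_(j < N.+1 | s < node N j <= t) d * C * wt T N j x <= d * (C * sq x).
  rewrite -mulr_sumr -mulrA ler_wpM2l ?(ltW d0) // ler_wpM2l // -(wt_total iT N x).
  rewrite [leRHS](bigID (fun j : 'I_N.+1 => s < node N j <= t)) /=.
  by rewrite lerDl sumr_ge0 // => j _; exact: wt_ge0.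
have tot2 : \sum_(j < N.+1 | s < node N j <= t) K * N.+1%:R ^- 2 <= K * N.+1%:R^-1.
  apply: (@le_trans _ _ (\sum_(j < N.+1) K * N.+1%:R ^- 2)).
    rewrite [leRHS](bigID (fun j : 'I_N.+1 => s < node N j <= t)) /= lerDl.
    by apply: sumr_ge0 => j _; rewrite mulr_ge0 // invr_ge0 exprn_ge0.
  rewrite sumr_const card_ord -[_ *+ _]mulr_natr -mulrA ler_wpM2l //.
  have m0 : N.+1%:R != 0 :> R by rewrite pnatr_eq0.
  by rewrite expr2 invfM -mulrA mulVf // mulr1.
apply: le_trans (lerD (lerD (lexx _) tot) tot2); rewrite -!big_split /=.
apply: ler_sum => j /andP[sj jt].
have -> : wt T N j (A x) - c * wt T N j x =
  (wt T N j (A x) - csq (f (cis (node N j))) * wt T N j x) +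
  (csq (f (cis (node N j))) - c) * wt T N j x by ring.
apply: le_trans (ler_normD _ _) _; rewrite [leLHS]addrC -[leRHS]addrA.
apply: lerD; last exact: wt_symbol.
rewrite normrM [X in _ * X]ger0_norm ?wt_ge0 // ler_wpM2r ?wt_ge0 //.
apply: le_trans (symbol_lip C0 hf lf _ _) _.
rewrite ler_wpM2l ?mulr_ge0 // ger0_norm ?subr_ge0; last exact: ltW.
by rewrite lerB.
Qed.

(** The limit in N of the discrete distribution functions need not be right
   continuous; spcdf is its right limit. *)
Definition gdist t x : R := ulim (fun N => dist T N t x).
Definition spcdf t x : R := ulim (fun n => gdist (t + n.+1%:R^-1) x).

Lemma dist_bnd t x : bnd (fun N => dist T N t x).
Proof. exact: bnd_itv (fun N => dist_itv iT N t x). Qed.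

Lemma gdist_itv t x : 0 <= gdist t x <= sq x.
Proof. by apply: ulim_itv => N; exact: dist_itv. Qed.

Lemma gdist_bnd (t : nat -> R) x : bnd (fun n => gdist (t n) x).
Proof. exact: bnd_itv (fun n => gdist_itv (t n) x). Qed.

Lemma dist_mono N s t x : s <= t -> dist T N s x <= dist T N t x.
Proof.
move=> st; rewrite -subr_ge0 dist_incr // sumr_ge0 // => j _; exact: wt_ge0.
Qed.

Lemma gdist_mono s t x : s <= t -> gdist s x <= gdist t x.
Proof. by move=> st; apply: ulim_le => [||N]; [exact: dist_bnd..|exact: dist_mono]. Qed.

Lemma spcdf_itv t x : 0 <= spcdf t x <= sq x.
Proof. by apply: ulim_itv => n; exact: gdist_itv. Qed.

Lemma spcdf_mono s t x : s <= t -> spcdf s x <= spcdf t x.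
Proof.
move=> st; apply: ulim_le => [||n]; [exact: gdist_bnd..|].
by apply: gdist_mono; rewrite lerD2r.
Qed.

Lemma spcdf_le0 t x : t < 0 -> spcdf t x = 0.
Proof.
move=> t0; apply/eqP; rewrite eq_le; have /andP[-> _] := spcdf_itv t x; rewrite andbT.
rewrite -(ulim_cst 0); apply: ulim_le_near; [exact: gdist_bnd|exact: bnd_cst|].
have [k hk] : exists k, forall j, (k <= j)%N -> j.+1%:R^-1 < - t.
  by apply: inv_succ_lt; rewrite oppr_gt0.
exists k => // n kn /=; rewrite -(ulim_cst 0).
apply: ulim_le => [||N]; [exact: dist_bnd|exact: bnd_cst|].
by rewrite dist_le0 //; have := hk n kn; move: (n.+1%:R^-1) => p; lra.
Qed.

Lemma spcdf_ge2pi t x : 2 * pi <= t -> spcdf t x = sq x.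
Proof.
move=> t0; rewrite -[RHS](ulim_cst (sq x)); congr ulim; apply/funext => n.
rewrite -[RHS](ulim_cst (sq x)); congr ulim; apply/funext => N.
by rewrite dist_ge2pi //; apply: le_trans t0 _; rewrite lerDl invr_ge0.
Qed.

(** Inherited from sq_quad, as the weights are square norms of linear functions of
   the vector. *)
Lemma spcdf_quad t (r : R) x y : r != 0 ->
  spcdf t (x + y) + spcdf t (r%:C *: x - r^-1%:C *: y) =
  (1 + r ^+ 2) * spcdf t x + (1 + r ^- 2) * spcdf t y.
Proof.
move=> r0.
have g t' : gdist t' (x + y) + gdist t' (r%:C *: x - r^-1%:C *: y) =
    (1 + r ^+ 2) * gdist t' x + (1 + r ^- 2) * gdist t' y.
  rewrite -ulimD; [|exact: dist_bnd..].
  rewrite -!ulimZ; [|exact: dist_bnd..].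
  rewrite -ulimD; [|by apply: bndZ; exact: dist_bnd..].
  by congr ulim; apply/funext => N; exact: dist_quad.
rewrite -ulimD; [|exact: gdist_bnd..].
rewrite -!ulimZ; [|exact: gdist_bnd..].
rewrite -ulimD; [|by apply: bndZ; exact: gdist_bnd..].
by congr ulim; apply/funext => n; exact: g.
Qed.

Lemma spcdf_right s x (e : R) : 0 < e -> exists2 d : R, 0 < d & spcdf (s + d) x <= spcdf s x + e.
Proof.
move=> e0; have [n hn] : exists n, gdist (s + n.+1%:R^-1) x < spcdf s x + e.
  by apply: ulim_lt_ex; [exact: gdist_bnd|rewrite ltrDl].
exists (n.+1%:R^-1 / 2); first by rewrite divr_gt0 ?invr_gt0.
apply: le_trans (ltW hn); rewrite -[leRHS](ulim_cst (gdist _ x)).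
apply: ulim_le_near; [exact: gdist_bnd|exact: bnd_cst|].
have n0 : 0 < n.+1%:R^-1 / 2 :> R by rewrite divr_gt0 ?invr_gt0.
have [k hk] := inv_succ_lt n0.
exists k => // j kj /=; apply: gdist_mono; have := hk j kj.
move: (j.+1%:R^-1) (n.+1%:R^-1) => p q; lra.
Qed.

Lemma ulim_abs u v : bnd u -> bnd v -> (forall n : nat, `|u n| <= v n) -> `|ulim u| <= (ulim v : R).
Proof.
move=> bu bv h; rewrite ler_norml; apply/andP; split.
  rewrite lerNl -mulN1r -ulimZ //; apply: ulim_le => //; first exact: bndZ.
  by move=> n; rewrite mulN1r lerNl; have := h n; rewrite ler_norml => /andP[].
by apply: ulim_le => // n; exact: le_trans (ler_norm _) (h n).
Qed.

Lemma bnd_inv_succ : bnd (fun n => n.+1%:R^-1 : R).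
Proof.
apply: (@bnd_itv _ _ 0 1) => n; apply/andP; split; first by rewrite invr_ge0.
by rewrite invf_le1 ?ltr0n // ler1n.
Qed.

Lemma gdist_symbol A f C x s t : 0 <= C ->
  (forall w, csq w = 1 -> csq (f w) <= C) ->
  (forall s t, csq (f (cis s) - f (cis t)) <= C * (s - t) ^+ 2) ->
  (forall N w x, csq w = 1 -> sq (dsum T N w (A x) - f w *: dsum T N w x) <= C * sq x) ->
  s <= t ->
  `|(gdist t (A x) - gdist s (A x)) - csq (f (cis s)) * (gdist t x - gdist s x)| <=
  2 * C * (t - s) * (gdist t x - gdist s x).
Proof.
move=> C0 hf lf dA st; apply/ler_addgt0Pr => e e0.
pose d := e / (C * sq x + 1).
have c1 : 0 < C * sq x + 1 by rewrite ltr_wpDl // mulr_ge0 ?sq_ge0.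
have d0 : 0 < d by rewrite divr_gt0.
have dle : d * (C * sq x) <= e.
  rewrite /d mulrAC ler_pdivrMr // ler_wpM2l ?(ltW e0) // lerDl //.
have b1 t' y := dist_bnd t' y.
have b2 t1 t2 y : bnd (fun N => dist T N t1 y - dist T N t2 y) by apply: bndB.
have binv := bnd_inv_succ.
apply: le_trans (_ : _ <= 2 * C * (t - s) * (gdist t x - gdist s x) + d * (C * sq x)) _;
  last by rewrite lerD2l.
set K := (1 + d^-1) * C * sq x.
have -> : 2 * C * (t - s) * (gdist t x - gdist s x) + d * (C * sq x) =
  ulim (fun N => 2 * C * (t - s) * (dist T N t x - dist T N s x) + d * (C * sq x) +
  K * N.+1%:R^-1).
  rewrite ulimD; [|by apply: bndD; [exact: bndZ|exact: bnd_cst]|exact: bndZ].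
  rewrite ulimD; [|exact: bndZ|exact: bnd_cst].
  have /= -> := ulimZ (2 * C * (t - s)) (b2 t s x).
  have /= -> := ulimB (b1 t x) (b1 s x).
  by rewrite ulim_cst ulimZ // (ulimE cvg_inv_succ) mulr0 addr0.
have -> : (gdist t (A x) - gdist s (A x)) - csq (f (cis s)) * (gdist t x - gdist s x) =
  ulim (fun N => (dist T N t (A x) - dist T N s (A x)) -
    csq (f (cis s)) * (dist T N t x - dist T N s x)).
  have /= -> := ulimB (b2 t s (A x)) (bndZ (csq (f (cis s))) (b2 t s x)).
  by rewrite ulimZ // !ulimB.
apply: ulim_abs => [||N]; last exact: dist_symbol.
  by apply: bndB => //; exact: bndZ.
by apply: bndD; [apply: bndD; [exact: bndZ|exact: bnd_cst]|exact: bndZ].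
Qed.

Lemma spcdf_symbol A f C x s t : 0 <= C ->
  (forall w, csq w = 1 -> csq (f w) <= C) ->
  (forall s t, csq (f (cis s) - f (cis t)) <= C * (s - t) ^+ 2) ->
  (forall N w x, csq w = 1 -> sq (dsum T N w (A x) - f w *: dsum T N w x) <= C * sq x) ->
  s <= t ->
  `|(spcdf t (A x) - spcdf s (A x)) - csq (f (cis s)) * (spcdf t x - spcdf s x)| <=
  2 * C * (t - s) * (spcdf t x - spcdf s x).
Proof.
move=> C0 hf lf dA st.
have b1 (r : R) y : bnd (fun n => gdist (r + n.+1%:R^-1) y) by exact: gdist_bnd.
have b2 (r r' : R) y : bnd (fun n => gdist (r + n.+1%:R^-1) y - gdist (r' + n.+1%:R^-1) y).
  exact: bndB.
have binv := bnd_inv_succ.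
have -> : 2 * C * (t - s) * (spcdf t x - spcdf s x) =
  ulim (fun n => 2 * C * (t - s) * (gdist (t + n.+1%:R^-1) x - gdist (s + n.+1%:R^-1) x) +
    2 * C * sq x * n.+1%:R^-1).
  rewrite ulimD; [|exact: bndZ..].
  have /= -> := ulimZ (2 * C * (t - s)) (b2 t s x).
  have /= -> := ulimB (b1 t x) (b1 s x).
  by rewrite ulimZ // (ulimE cvg_inv_succ) mulr0 addr0.
have -> : (spcdf t (A x) - spcdf s (A x)) - csq (f (cis s)) * (spcdf t x - spcdf s x) =
  ulim (fun n => (gdist (t + n.+1%:R^-1) (A x) - gdist (s + n.+1%:R^-1) (A x)) -
    csq (f (cis s)) * (gdist (t + n.+1%:R^-1) x - gdist (s + n.+1%:R^-1) x)).
  have /= -> := ulimB (b2 t s (A x)) (bndZ (csq (f (cis s))) (b2 t s x)).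
  by rewrite ulimZ // !ulimB.
apply: ulim_abs => [||n].
- by apply: bndB => //; exact: bndZ.
- by apply: bndD; exact: bndZ.
set h := n.+1%:R^-1; have h0 : 0 <= h by rewrite invr_ge0.
have sth : s + h <= t + h by rewrite lerD2r.
have := gdist_symbol x C0 hf lf dA sth.
set D := gdist (t + h) x - gdist (s + h) x.
have D0 : 0 <= D by rewrite subr_ge0 gdist_mono.
have D1 : D <= sq x.
  by have /andP[? ?] := gdist_itv (t + h) x; have /andP[? ?] := gdist_itv (s + h) x; rewrite /D; lra.
have := symbol_lip C0 hf lf (s + h) s; rewrite (addrC s h) addrK (ger0_norm h0).
set c := csq (f (cis (h + s))); set c0 := csq (f (cis s)); set G := gdist _ (A x) - _.
have -> : t + h - (h + s) = t - s by ring.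
move=> h1 h2.
have -> : G - c0 * D = (G - c * D) + (c - c0) * D by ring.
apply: le_trans (ler_normD _ _) _; apply: lerD => //.
rewrite normrM (ger0_norm D0) [leRHS]mulrAC.
by apply: ler_pM => //; rewrite mulr_ge0 // mulr_ge0.
Qed.

End Distribution.

(** * The spectral measures of vectors *)

Section LineMeasure.
Context {R : realType} {H : hilbertType R}.
Implicit Types (x y : H) (w : R[i]) (s t a b : R).

Lemma stieltjes_itv (F : cumulative R R) a b : a <= b ->
  lebesgue_stieltjes_measure F `]a, b]%classic = (F b - F a)%:E.
Proof.
move=> ab; rewrite /lebesgue_stieltjes_measure /measure_extension/=.
rewrite measurable_mu_extE/=; last exact: is_ocitv.
by rewrite wlength_itv_bnd.
Qed.

Variable T : {linear H -> H}.
Hypothesis iT : forall x, sq (T x) = sq x.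

Lemma spcdf_right_continuous x s : spcdf T^~ x @ s^'+ --> spcdf T s x.
Proof.
apply/cvgrPdist_lt => e e0.
have [d d0 hd] := spcdf_right iT s x (divr_gt0 e0 (ltr0Sn R 1)).
near=> t.
have st : s < t by near: t; exact: nbhs_right_gt.
have td : t <= s + d by apply: ltW; near: t; apply: nbhs_right_lt; rewrite ltrDl.
have h1 := spcdf_mono iT x (ltW st); have h2 := spcdf_mono iT x td.
by rewrite ler0_norm ?subr_le0 // opprB; lra.
Unshelve. all: by end_near. Qed.

Lemma line_measure_exists x :
  exists m : {measure set (measurableTypeR R) -> \bar R},
    forall a b, a <= b -> m `]a, b]%classic = (spcdf T b x - spcdf T a x)%:E.
Proof.
pose f t := spcdf T t x.
have nd : nondecreasing f by move=> s t; exact: spcdf_mono.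
have rc : right_continuous f by move=> s; exact: spcdf_right_continuous.
pose F : cumulative R R := HB.pack f (isCumulative.Build R _ R f nd rc).
exists (lebesgue_stieltjes_measure F) => a b ab.
exact: stieltjes_itv.
Qed.

Variable m : H -> {measure set (measurableTypeR R) -> \bar R}.
Hypothesis mE : forall x a b, a <= b -> m x `]a, b]%classic = (spcdf T b x - spcdf T a x)%:E.

(** Intervals that exhaust the line and already carry the whole mass. *)
Definition growing n : set (measurableTypeR R) := `](- n.+1%:R), (2 * pi + n%:R)]%classic.

Lemma growing_cover : \bigcup_n growing n = setT.
Proof.
apply/seteqP; split=> // t _; exists (Num.truncn `|t|) => //.
have h : `|t| < (Num.truncn `|t|).+1%:R by exact: truncnS_gt.
rewrite /growing /= in_itv /=; move: h; rewrite -natr1.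
move: ((Num.truncn `|t|)%:R : R) => k h.
have := ler_norm t; have := ler_norm (- t); rewrite normrN => h1 h2.
have pi2 := pi_ge2 R.
by apply/andP; split; lra.
Qed.

Lemma growing_mass x n : m x (growing n) = (sq x)%:E.
Proof.
have p0 := pi_gt0 R; have n0 : 0 <= n%:R :> R by [].
have n1 : - n.+1%:R < 0 :> R by rewrite oppr_lt0 ltr0n.
rewrite mE; last by lra.
rewrite spcdf_ge2pi //; last by lra.
by rewrite spcdf_le0 // subr0.
Qed.

Lemma line_total x : m x setT = (sq x)%:E.
Proof.
have nd : {homo growing : i j / (i <= j)%N >-> (i <= j)%O}.
  move=> i j ij; apply/subsetPset => t; rewrite /growing /= !in_itv /= => /andP[h1 h2].
  have ijR : i%:R <= j%:R :> R by rewrite ler_nat.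
  have ijR' : i.+1%:R <= j.+1%:R :> R by rewrite ler_nat.
  by apply/andP; split; lra.
have := @nondecreasing_cvg_mu _ _ _ (m x) growing.
have mg n : measurable (growing n) by exact: measurable_itv.
rewrite growing_cover => /(_ mg (@measurableT _ _) nd).
have -> : m x \o growing = (fun=> (sq x)%:E) by apply/funext => n; exact: growing_mass.
move=> h; have := cvg_unique _ h (cvg_cst ((sq x)%:E : \bar R)).
by apply.
Qed.

Lemma line_unique (m1 m2 : {measure set (measurableTypeR R) -> \bar R}) :
  (forall a b, a <= b -> m1 `]a, b]%classic = m2 `]a, b]%classic) ->
  (forall n, (m1 (growing n) < +oo)%E) ->
  forall B, measurable B -> m1 B = m2 B.
Proof.
move=> h fin B mB; apply: (@measure_unique _ _ (measurableTypeR R) (@ocitv R) growing) => //.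
- exact: ocitvI.
- by move=> n; exact: is_ocitv.
- exact: growing_cover.
- move=> A [[a b] _ <-] /=; have [ab|ba] := leP a b; first exact: h.
  by rewrite set_itv_ge ?measure0 // bnd_simp -leNgt ltW.
Qed.

(** In spcdf_quad the measure of r x - y / r is dropped. *)
Lemma line_quad x y (r : R) B : r != 0 -> measurable B ->
  (m (x + y)%R B <= (1 + r ^+ 2)%:E * m x B + (1 + r ^- 2)%:E * m y B)%E.
Proof.
move=> r0 mB; pose c1 : {nonneg R} := NngNum (addr_ge0 ler01 (sqr_ge0 r)).
have c20 : 0 <= 1 + r ^- 2 by rewrite addr_ge0 // invr_ge0 sqr_ge0.
pose c2 : {nonneg R} := NngNum c20.
pose m1 := measure_add (m (x + y)) (m (r%:C *: x - r^-1%:C *: y)).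
pose m2 := measure_add (mscale c1 (m x)) (mscale c2 (m y)).
have E1 A : m1 A = (m (x + y)%R A + m (r%:C *: x - r^-1%:C *: y)%R A)%E.
  exact: measure_addE.
have E2 A : m2 A = ((1 + r ^+ 2)%:E * m x A + (1 + r ^- 2)%:E * m y A)%E.
  exact: measure_addE.
have E12 : m1 B = m2 B.
  apply: (@line_unique m1 m2) => // [a b ab|n].
    apply: (etrans (E1 _)); apply: (etrans _ (esym (E2 _))).
    rewrite !mE // -!EFinM -!EFinD; congr EFin.
    have := spcdf_quad iT b x y r0; have := spcdf_quad iT a x y r0; lra.
  by apply: (@le_lt_trans _ _ (m1 (growing n))) => //; rewrite E1 !growing_mass -EFinD ltry.
by rewrite -E2 -E12 E1 leeDl.
Qed.

End LineMeasure.

Section LineDensity.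
Context {R : realType} {H : hilbertType R}.
Implicit Types (x y : H) (w : R[i]) (s t a b : R).

Lemma density_measure d (X : measurableType d) (mu : {measure set X -> \bar R})
    (f : X -> R) : measurable_fun setT f -> (forall z : X, 0 <= f z) ->
  exists nu : {measure set X -> \bar R}, forall B, nu B = (\int[mu]_(z in B) (f z)%:E)%E.
Proof.
move=> mf f0; pose nu B := (\int[mu]_(z in B) (f z)%:E)%E.
have nu0 : nu set0 = 0%E by exact: integral_set0.
have nuge0 B : (0 <= nu B)%E by apply: integral_ge0 => x _; rewrite lee_fin.
have nuadd : semi_sigma_additive nu.
  move=> F mF tF mUF; rewrite /nu ge0_integral_bigcup //.
  - by apply: is_cvg_ereal_nneg_natsum => n _; exact: nuge0.
  - by apply/measurable_EFinP; exact: measurable_funTS.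
  - by move=> x _; rewrite lee_fin.
by exists (HB.pack nu (isMeasure.Build _ _ _ nu nu0 nuge0 nuadd) :
  {measure set X -> \bar R}).
Qed.

(** Halving an interval halves the factor b - a, so n bisections improve the bound on
   Phi a b by a factor 2^n. *)
Lemma additive_interval_zero (Phi Delta : R -> R -> R) (K : R) :
  (forall a c b, a <= c -> c <= b -> Phi a b = Phi a c + Phi c b) ->
  (forall a c b, a <= c -> c <= b -> Delta a b = Delta a c + Delta c b) ->
  (forall a b, a <= b -> `|Phi a b| <= K * (b - a) * Delta a b) ->
  forall a b, a <= b -> Phi a b = 0.
Proof.
move=> Phiadd Dadd hK a b ab.
have small n : forall a b, a <= b -> 2 ^+ n * `|Phi a b| <= K * (b - a) * Delta a b.
  elim: n => [|n IH] {ab}a {}b ab; first by rewrite expr0 mul1r hK.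
  pose c := (a + b) / 2.
  have ac : a <= c by rewrite /c; lra.
  have cb : c <= b by rewrite /c; lra.
  have := IH _ _ ac; have := IH _ _ cb; rewrite (Phiadd a c b) // (Dadd a c b) //.
  have := ler_normD (Phi a c) (Phi c b); rewrite exprS.
  have -> : b - c = (b - a) / 2 by rewrite /c; field.
  have -> : c - a = (b - a) / 2 by rewrite /c; field.
  have p0 : 0 <= 2 ^+ n :> R by rewrite exprn_ge0.
  move: (2 ^+ n) p0 => p p0 h1 h2 h3; have := ler_wpM2l p0 h1; lra.
apply/eqP; rewrite -normr_eq0 eq_le normr_ge0 andbT.
apply: (@archi_le _ (- (K * (b - a) * Delta a b))) => n.
have := small n a b ab; have : n%:R * `|Phi a b| <= 2 ^+ n * `|Phi a b|.
  by rewrite ler_wpM2r // -natrX ler_nat ltnW // ltn_expl.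
lra.
Qed.

Variable T : {linear H -> H}.
Hypothesis iT : forall x, sq (T x) = sq x.
Variable m : H -> {measure set (measurableTypeR R) -> \bar R}.
Hypothesis mE : forall x a b, a <= b -> m x `]a, b]%classic = (spcdf T b x - spcdf T a x)%:E.

Lemma symbol_measurable A f : symbol T A f ->
  measurable_fun setT (fun t : measurableTypeR R => csq (f (cis t)) : measurableTypeR R).
Proof.
move=> [C [C0 _ hf lf _]]; apply: continuous_measurable_fun => s.
apply/cvgrPdist_lt => e e0.
have C1 : 0 < 2 * C + 1 by lra.
near=> t; apply: le_lt_trans (symbol_lip C0 hf lf _ _) _.
apply: (@le_lt_trans _ _ ((2 * C + 1) * `|s - t|)); first by rewrite ler_wpM2r // lerDl.
rewrite mulrC -ltr_pdivlMr //.
near: t; apply: cvgr_dist_lt => //; exact: divr_gt0.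
Unshelve. all: by end_near. Qed.

(** On short intervals both sides are |f|^2 times the mass, up to an error of higher
   order, and their difference is additive. *)
Lemma line_symbol A f x B : symbol T A f -> measurable B ->
  m (A x) B = (\int[m x]_(t in B) (csq (f (cis t)))%:E)%E.
Proof.
move=> sA mB; have mf := symbol_measurable sA.
have [C [C0 hA hf lf dA]] := sA.
pose F t := csq (f (cis t)).
have F0 t : 0 <= F t by exact: csq_ge0.
have FC t : F t <= C by apply: hf; exact: csq_cis.
have [nu nuE] := density_measure (m x) mf F0.
have fin a b : (m x `]a, b]%classic < +oo)%E.
  have [ab|ba] := leP a b; first by rewrite mE // ltry.
  by rewrite set_itv_ge ?measure0 // bnd_simp -leNgt ltW.
have intF a b : (m x).-integrable `]a, b]%classic (EFin \o F).
  apply: measurable_bounded_integrable => //; first exact: measurable_funTS.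
  exists C; split; first exact: num_real.
  by move=> N CN t _ /=; rewrite ger0_norm //; apply: le_trans (FC t) (ltW CN).
pose J a b := \int[m x]_(t in `]a, b]%classic) F t.
pose D y a b := spcdf T b y - spcdf T a y.
have Jadd a c b : a <= c -> c <= b -> J a b = J a c + J c b.
  move=> ac cb; rewrite /J.
  have UE : `]a, b]%classic = `]a, c]%classic `|` `]c, b]%classic.
    by rewrite -itv_bndbnd_setU // bnd_simp.
  rewrite UE Rintegral_setU //; first by rewrite -UE.
  apply/disj_set2P; apply/seteqP; split=> t //=; rewrite !in_itv /= => -[/andP[_ h1] /andP[h2 _]].
  by move: h2; rewrite ltNge h1.
have Dadd y a c b : a <= c -> c <= b -> D y a b = D y a c + D y c b.
  by move=> _ _; rewrite /D; ring.
have Jest a b : a <= b -> `|J a b - F a * D x a b| <= 2 * C * (b - a) * D x a b.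
  move=> ab; pose h := 2 * C * (b - a).
  have h0 : 0 <= h by rewrite mulr_ge0 ?subr_ge0 // mulr_ge0.
  have near_ t : t \in `]a, b] -> `|F t - F a| <= h.
    rewrite in_itv /= => /andP[at_ tb]; apply: le_trans (symbol_lip C0 hf lf _ _) _.
    rewrite ler_wpM2l ?mulr_ge0 // ger0_norm ?subr_ge0; last exact: ltW.
    by rewrite lerB.
  have intc (c : R) : (m x).-integrable `]a, b]%classic (EFin \o (fun=> c)).
    apply: measurable_bounded_integrable => //.
    exists `|c|; split; first exact: num_real.
    by move=> N cN t _ /=; exact: ltW.
  have cst (c : R) : \int[m x]_(t in `]a, b]%classic) c = c * D x a b.
    by rewrite Rintegral_cst // mE.
  have up : J a b <= (F a + h) * D x a b.
    rewrite -cst; apply: le_Rintegral => // t /= tI.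
    by have := near_ t tI; rewrite ler_norml => /andP[_]; lra.
  have lo : (F a - h) * D x a b <= J a b.
    rewrite -cst; apply: le_Rintegral => // t /= tI.
    by have := near_ t tI; rewrite ler_norml => /andP[+ _]; lra.
  by rewrite -/h ler_norml; apply/andP; split; lra.
have key a b : a <= b -> D (A x) a b - J a b = 0.
  apply: (@additive_interval_zero (fun a b => D (A x) a b - J a b) (D x) (4 * C)).
  - by move=> {}a c {}b ac cb; rewrite (Jadd a c b) // (Dadd _ a c b) //; ring.
  - exact: Dadd.
  - move=> {}a {}b ab; have h1 := Jest a b ab.
    have h2 := spcdf_symbol iT x C0 hf lf dA ab; rewrite -!/(D _ a b) -/(F a) in h2.
    have -> : D (A x) a b - J a b = (D (A x) a b - F a * D x a b) - (J a b - F a * D x a b).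
      by ring.
    by apply: le_trans (ler_normB _ _) _; lra.
rewrite -nuE; apply: (line_unique _ _ mB) => [a b ab|n].
  rewrite mE // nuE; have := key a b ab => /eqP; rewrite subr_eq0 => /eqP.
  rewrite /D => ->; rewrite /J /Rintegral fineK //.
  by apply: integrable_fin_num.
by rewrite (growing_mass iT mE) ltry.
Qed.

End LineDensity.

Section CircleMeasure.
Context {R : realType} {H : hilbertType R}.
Implicit Types (x y : H) (B : set (borelC R)).
Variable T : {linear H -> H}.

(** What is kept of the measures mu x. The third condition replaces the sesquilinear
   structure: it lets vectors of measure 0 on B be ignored on B, by choosing r
   small or large. The fourth one identifies the functions of T. *)
Definition circle_family (mu : H -> {measure set (borelC R) -> \bar R}) :=
  [/\ forall x, mu x setT = (sq x)%:E,
      forall x, mu x (~` @unit_circle R) = 0%E,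
      forall x y (r : R) B, r != 0 -> measurable B ->
        (mu (x + y)%R B <= (1 + r ^+ 2)%:E * mu x B + (1 + r ^- 2)%:E * mu y B)%E &
      forall A f x B, symbol T A f ->
        measurable_fun setT (fun z : borelC R => csq (f z)) -> measurable B ->
        mu (A x) B = (\int[mu x]_(z in B) (csq (f z))%:E)%E].

(** The images under t |-> cis t of the measures on the line. *)
Lemma circle_family_exists : (forall x, sq (T x) = sq x) ->
  exists mu, circle_family mu.
Proof.
move=> iT; have [m mE] := choice (line_measure_exists iT).
have me : measurable_fun setT (@expi R : measurableTypeR R -> borelC R).
  exact: measurable_expi.
have mpre B : measurable B -> measurable ((@expi R : measurableTypeR R -> borelC R) @^-1` B).
  by move=> mB; rewrite -[X in measurable X]setTI; exact: me.
pose mu x : {measure set (borelC R) -> \bar R} := measure_function_pushforward__canonical__measure_function_Measure (m x) me.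
exists mu; split.
- by move=> x; exact: line_total.
- move=> x; have -> : mu x (~` @unit_circle R) = m x set0.
    congr (m x _); apply/seteqP; split=> // t /=; apply; exact: expi_circle.
  exact: measure0.
- by move=> x y r B r0 mB; apply: line_quad => //; exact: mpre.
- move=> A f x B hs mf mB; have -> : mu (A x) B = m (A x) (@expi R @^-1` B) by [].
  rewrite (line_symbol iT mE x hs (mpre B mB)).
  have h := @ge0_integral_pushforward _ _ _ _ R _ me (m x) B (fun z => (csq (f z))%:E) mB.
  symmetry; apply: h => [|z _]; last by rewrite lee_fin csq_ge0.
  by apply: measurable_funTS; apply/measurable_EFinP.
Qed.

End CircleMeasure.

(** * Splitting vectors along Borel sets *)

Section Mass.
Context {R : realType} {H : hilbertType R}.
Implicit Types (x y p q : H) (A B : set (borelC R)).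
Variable T : {linear H -> H}.
Variable mu : H -> {measure set (borelC R) -> \bar R}.
Hypothesis hmu : circle_family T mu.

Definition mass x B : R := fine (mu x B).

Lemma mu_le x B : measurable B -> (mu x B <= (sq x)%:E)%E.
Proof.
by move=> mB; have [<- _ _ _] := hmu; apply: le_measure; rewrite ?inE.
Qed.

Lemma massE x B : measurable B -> (mass x B)%:E = mu x B.
Proof.
move=> mB; rewrite fineK // ge0_fin_numE //.
by apply: le_lt_trans (mu_le x mB) _; rewrite ltry.
Qed.

Lemma mass_ge0 x B : 0 <= mass x B.
Proof. by rewrite fine_ge0. Qed.

Lemma massT x : mass x setT = sq x.
Proof. by rewrite /mass; have [-> _ _ _] := hmu. Qed.

Lemma mass_le x A B : measurable A -> measurable B -> A `<=` B -> mass x A <= mass x B.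
Proof.
by move=> mA mB AB; rewrite -lee_fin !massE //; apply: le_measure; rewrite ?inE.
Qed.

Lemma mass_leT x B : measurable B -> mass x B <= sq x.
Proof. by move=> mB; rewrite -massT; exact: mass_le. Qed.

Lemma massU x A B : measurable A -> measurable B -> A `&` B = set0 ->
  mass x (A `|` B) = mass x A + mass x B.
Proof.
move=> mA mB AB; apply: EFin_inj; rewrite EFinD !massE //; last exact: measurableU.
by rewrite measureU.
Qed.

Lemma massIC x A B : measurable A -> measurable B ->
  mass x A = mass x (A `&` B) + mass x (A `&` ~` B).
Proof.
move=> mA mB; have mC := measurableC mB.
rewrite -massU -?setIUr ?setUCr ?setIT //; try exact: measurableI.
by rewrite setIACA setICr setI0.
Qed.

Lemma mass_quad x y (r : R) B : r != 0 -> measurable B ->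
  mass (x + y) B <= (1 + r ^+ 2) * mass x B + (1 + r ^- 2) * mass y B.
Proof.
move=> r0 mB; rewrite -lee_fin EFinD !EFinM !massE //.
by have [_ _ h _] := hmu; exact: h.
Qed.

Lemma mass_le2 x y B : measurable B ->
  mass (x + y) B <= 2 * mass x B + 2 * mass y B.
Proof.
move=> mB; apply: le_trans (mass_quad x y (oner_neq0 R) mB) _.
by rewrite expr1n invr1.
Qed.

Lemma mass_symbol (L : H -> H) f x B : symbol T L f ->
  measurable_fun setT (fun z : borelC R => csq (f z)) -> measurable B ->
  (mass (L x) B)%:E = (\int[mu x]_(z in B) (csq (f z))%:E)%E.
Proof. by move=> hs mf mB; rewrite massE //; have [_ _ _ h] := hmu; exact: h. Qed.

Lemma massZ (c : R[i]) x B : measurable B -> mass (c *: x) B = csq c * mass x B.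
Proof.
move=> mB; apply: EFin_inj; rewrite (mass_symbol x (symbol_scalar T c)) //.
by rewrite integral_cst // EFinM massE.
Qed.

Lemma massN x B : measurable B -> mass (- x) B = mass x B.
Proof.
by move=> mB; rewrite -scaleN1r massZ // /csq /= oppr0 expr0n sqrrN expr1n addr0 mul1r.
Qed.

(** Let r tend to 0 in mass_quad, for y and for - y. *)
Lemma massD_null x y B : measurable B -> mass y B = 0 -> mass (x + y) B = mass x B.
Proof.
move=> mB; have le u v : mass v B = 0 -> mass (u + v) B <= mass u B.
  move=> v0; apply/ler_addgt0Pr => e e0.
  have m0 := mass_ge0 u B.
  pose k := e / (mass u B + 1).
  have k0 : 0 < k by rewrite divr_gt0 // ltr_wpDl.
  have r0 : Num.sqrt k != 0 by rewrite gt_eqF // sqrtr_gt0.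
  have := mass_quad u v r0 mB; rewrite v0 mulr0 addr0 sqr_sqrtr ?(ltW k0) // => h.
  apply: le_trans h _; rewrite mulrDl mul1r lerD2l /k.
  rewrite mulrAC ler_pdivrMr ?ltr_wpDl // ler_wpM2l ?(ltW e0) //; lra.
move=> y0; apply/eqP; rewrite eq_le le //=.
by rewrite -{1}(addrK y x); apply: le; rewrite massN.
Qed.

Lemma null_add x y B : measurable B -> mass x B = 0 -> mass y B = 0 -> mass (x + y) B = 0.
Proof. by move=> mB x0 y0; rewrite massD_null. Qed.

Lemma null_sub x y B : measurable B -> mass x B = 0 -> mass y B = 0 -> mass (x - y) B = 0.
Proof. by move=> mB x0 y0; rewrite null_add ?massN. Qed.

Lemma null_le x A B : measurable A -> measurable B -> A `<=` B ->
  mass x B = 0 -> mass x A = 0.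
Proof.
move=> mA mB AB x0; apply/eqP; rewrite eq_le mass_ge0 andbT -x0.
exact: mass_le.
Qed.

(** The mass on B is at most 2 |x - u n|^2 + 2 mass (u n) B. *)
Lemma null_limit (u : nat -> H) x B : measurable B -> sq_cvg u x ->
  (forall e : R, 0 < e -> exists N, forall n, (N <= n)%N -> mass (u n) B < e) -> mass x B = 0.
Proof.
move=> mB hu hm; apply/eqP; rewrite eq_le mass_ge0 andbT.
apply/ler_addgt0Pr => e e0; rewrite add0r; have e4 : 0 < e / 4 by rewrite divr_gt0.
have [N hN] := hu _ e4; have [M hM] := hm _ e4.
have h1 := hN (maxn N M) (leq_maxl _ _); have h2 := hM (maxn N M) (leq_maxr _ _).
move: h1 h2; set n := maxn N M => h1 h2.
have := mass_le2 (x - u n) (u n) mB; rewrite subrK.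
have := mass_leT (x - u n) mB.
have -> : sq (x - u n) = sq (u n - x) by rewrite -sqN opprB.
lra.
Qed.

(** On B the sum p + q has the mass of p, off B that of q, so the theorem of
   Pythagoras holds for p and all multiples of q. *)
Lemma carried_orth p q B : measurable B -> mass p (~` B) = 0 -> mass q B = 0 ->
  '[p, q] = 0.
Proof.
move=> mB; have mC := measurableC mB.
have pyth u v : mass u (~` B) = 0 -> mass v B = 0 -> rip u v = 0.
  move=> u0 v0; have dec w : sq w = mass w B + mass w (~` B).
    by rewrite -massT (massIC w (@measurableT _ _) mB) !setTI.
  have := sqD u v; rewrite (dec (u + v)) massD_null //.
  rewrite (addrC u) massD_null // (dec u) (dec v) u0 v0; lra.
move=> p0 q0; apply: inner_eq0 => c; apply: pyth => //.
by rewrite massZ // q0 mulr0.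
Qed.

End Mass.

Section Splitting.
Context {R : realType} {H : hilbertType R}.
Implicit Types (x y p q : H) (A B : set (borelC R)).
Variable T : {linear H -> H}.
Variable mu : H -> {measure set (borelC R) -> \bar R}.
Hypothesis hmu : circle_family T mu.

(** The vector p is going to be E B x. *)
Definition splits_at B x p := mass mu p (~` B) = 0 /\ mass mu (x - p) B = 0.

Definition splitting B := measurable B /\ forall x, exists p, splits_at B x p.

(** The difference q - p is carried by B minus A, and it differs from x by vectors of
   mass 0 there. *)
Lemma split_diff A B x p q : measurable A -> measurable B -> A `<=` B ->
  splits_at A x p -> splits_at B x q -> sq (q - p) = mass mu x (B `&` ~` A).
Proof.
move=> mA mB AB [p1 p2] [q1 q2].
have mCA := measurableC mA; have mCB := measurableC mB.
have mD : measurable (B `&` ~` A) by exact: measurableI.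
have -> : x = (q - p) + (p + (x - q)) by rewrite [RHS]addrA subrK subrKC.
rewrite (massD_null hmu) //; last first.
  apply: (null_add hmu) => //.
    by apply: (null_le hmu mD mCA _ p1); exact: subIsetr.
  by apply: (null_le hmu mD mB _ q2); exact: subIsetl.
rewrite -(massT hmu) (massIC hmu _ (@measurableT _ _) mA) !setTI.
have -> : mass mu (q - p) A = 0.
  have -> : q - p = (x - p) - (x - q) by rewrite opprB [RHS]addrC subrKA.
  by apply: (null_sub hmu) => //; exact: (null_le hmu mA mB AB q2).
rewrite add0r (massIC hmu _ mCA mB) setIC.
have -> : mass mu (q - p) (~` A `&` ~` B) = 0.
  apply: (@null_le _ _ _ _ hmu _ _ (~` B)) => //; first exact: measurableI.
  apply: (null_sub hmu) => //.
  by apply: (null_le hmu mCB mCA _ p1); exact: subsetC.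
by rewrite addr0.
Qed.

Lemma split_unique B x p q : measurable B -> splits_at B x p -> splits_at B x q -> q = p.
Proof.
move=> mB hp hq; apply/eqP; rewrite -subr_eq0; apply/eqP; apply: sq_eq0.
by rewrite (split_diff mB mB _ hp hq) // setICr /mass measure0.
Qed.

Lemma splittingC B : splitting B -> splitting (~` B).
Proof.
move=> [mB h]; split; first exact: measurableC.
move=> x; have [p [h1 h2]] := h x; exists (x - p); split; first by rewrite setCK.
by rewrite opprB addrC subrK.
Qed.

Lemma splitting_null B : measurable B -> (forall x, mass mu x B = 0) -> splitting B.
Proof.
move=> mB h; split=> // x; exists 0; split; last exact: h.
apply/eqP; rewrite eq_le mass_ge0 andbT.
by rewrite -(sq0 (H := H)) (mass_leT hmu) //; exact: measurableC.
Qed.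

(** Split along A, and then the part carried by A along B. *)
Lemma splittingI A B : splitting A -> splitting B -> splitting (A `&` B).
Proof.
move=> [mA hA] [mB hB]; have mAB : measurable (A `&` B) by exact: measurableI.
split=> // x; have [p [p1 p2]] := hA x; have [q [q1 q2]] := hB p.
have mCA := measurableC mA; have mCB := measurableC mB.
have mD : measurable (B `&` ~` A) by exact: measurableI.
exists q; split.
  rewrite (massIC hmu _ (measurableC mAB) mB).
  have -> : ~` (A `&` B) `&` B = B `&` ~` A.
    by rewrite setCI setIUl setICl setU0 setIC.
  have -> : mass mu q (B `&` ~` A) = 0.
    have := massD_null hmu q mD (null_le hmu mD mB (@subIsetl _ _ _) q2).
    rewrite addrC subrK => <-.
    by apply: (null_le hmu mD mCA _ p1); exact: subIsetr.
  rewrite add0r; apply: (null_le hmu _ mCB _ q1); last exact: subIsetr.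
  by apply: measurableI => //; exact: measurableC.
have -> : x - q = (x - p) + (p - q) by rewrite addrA subrK.
apply: (null_add hmu) => //.
  by apply: (null_le hmu mAB mA _ p2); exact: subIsetl.
by apply: (null_le hmu mAB mB _ q2); exact: subIsetr.
Qed.

Lemma splittingU A B : splitting A -> splitting B -> splitting (A `|` B).
Proof.
by move=> hA hB; rewrite -(setCK (A `|` B)) setCU; apply/splittingC/splittingI; exact: splittingC.
Qed.

Lemma tail_mass x (G : (set (borelC R))^nat) : (forall n, measurable (G n)) ->
  {homo G : m n / (m <= n)%N >-> m `<=` n} -> forall e : R, 0 < e ->
  exists N, forall n, (N <= n)%N -> mass mu x (\bigcup_n G n `&` ~` G n) < e.
Proof.
move=> mG nd e e0; have mU : measurable (\bigcup_n G n) by exact: bigcupT_measurable.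
have /cvgrPdist_lt/(_ e e0)[N _ hN] : (fun n => mass mu x (G n)) @ \oo --> mass mu x (\bigcup_n G n).
  rewrite /mass; apply: fine_cvg; rewrite -/(mass mu x _) (massE hmu _ mU).
  apply: nondecreasing_cvg_mu => // m n mn.
  by apply/subsetPset; exact: nd.
exists N => n Nn; have := hN n Nn.
rewrite (massIC hmu _ mU (mG n)).
have -> : \bigcup_n G n `&` G n = G n.
  by rewrite setIC; apply/setIidPl => z Gz; exists n.
by rewrite addrAC subrr add0r ger0_norm // mass_ge0.
Qed.

(** The parts carried by the G n form a Cauchy sequence by split_diff, since the mass
   of x on the union not yet exhausted by G n tends to 0. *)
Lemma splitting_bigcup_nd (G : (set (borelC R))^nat) : (forall n, splitting (G n)) ->
  {homo G : m n / (m <= n)%N >-> m `<=` n} -> splitting (\bigcup_n G n).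
Proof.
move=> sG nd; have mG n : measurable (G n) by case: (sG n).
have mU : measurable (\bigcup_n G n) by exact: bigcupT_measurable.
split=> // x; have /choice[p hp] : forall n, exists p, splits_at (G n) x p.
  by move=> n; case: (sG n).
have dist m n : (m <= n)%N -> sq (p n - p m) <= mass mu x (\bigcup_n G n `&` ~` G m).
  move=> mn; rewrite (split_diff (mG m) (mG n) (nd _ _ mn) (hp m) (hp n)).
  apply: (mass_le hmu); try by apply: measurableI => //; exact: measurableC.
  by move=> z [Gz nGz]; split=> //; exists n.
have [u hu] : exists u, sq_cvg p u.
  apply: sq_complete => e e0; have e4 : 0 < e / 4 by rewrite divr_gt0.
  have [N hN] := tail_mass x mG nd e4; exists N => m n Nm Nn.
  have h1 := le_lt_trans (dist _ _ Nm) (hN N (leqnn _)).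
  have h2 := le_lt_trans (dist _ _ Nn) (hN N (leqnn _)).
  have := sq_le2B (p m - p N) (p n - p N); rewrite opprB subrKA.
  move: h1 h2; lra.
exists u; split.
  apply: (null_limit hmu (measurableC mU) hu) => e e0; exists 0%N => n _.
  have [h _] := hp n. suff -> : mass mu (p n) (~` (\bigcup_n G n)) = 0 by [].
  apply: (null_le hmu (measurableC mU) (measurableC (mG n)) _ h).
  by apply: subsetC => z Gz; exists n.
have hxu : sq_cvg (fun n => x - p n) (x - u).
  move=> e e0; have [N hN] := hu e e0; exists N => n /hN.
  suff -> : x - p n - (x - u) = - (p n - u) by rewrite sqN.
  by rewrite !opprB [LHS]addrC subrKA.
have null_G m : mass mu (x - u) (G m) = 0.
  apply: (null_limit hmu (mG m) hxu) => e e0; exists m => n mn.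
  have [_ h] := hp n; suff -> : mass mu (x - p n) (G m) = 0 by [].
  by apply: (null_le hmu (mG m) (mG n) _ h); exact: nd.
apply/eqP; rewrite eq_le mass_ge0 andbT; apply/ler_addgt0Pr => e e0; rewrite add0r.
have [N hN] := tail_mass (x - u) mG nd e0; have := hN N (leqnn _) => /ltW; apply: le_trans.
rewrite (massIC hmu _ mU (mG N)).
have -> : \bigcup_n G n `&` G N = G N.
  by rewrite setIC; apply/setIidPl => z Gz; exists N.
by rewrite (null_G N) add0r.
Qed.

Lemma splitting_bigcup (F : (set (borelC R))^nat) : (forall n, splitting (F n)) ->
  splitting (\bigcup_n F n).
Proof.
move=> sF; rewrite -bigcup_bigsetU_bigcup; apply: splitting_bigcup_nd.
  elim=> [|n IH]; last by rewrite big_ord_recr; exact: splittingU.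
  by rewrite big_ord_recr big_ord0 /= set0U.
by move=> m n mn; exact: (@subset_bigsetU _ F m.+1 n.+1 mn).
Qed.

End Splitting.

Section StepPolynomials.
Context {R : realType}.
Implicit Types (s b : R) (k m n : nat).

Lemma bernoulli_ge b n : 0 <= b <= 1 -> 1 - n%:R * b <= (1 - b) ^+ n.
Proof.
move=> /andP[b0 b1]; elim: n => [|n IH]; first by rewrite mul0r subr0 expr0.
rewrite exprS -natr1; have n0 : 0 <= n%:R :> R by [].
apply: (@le_trans _ _ ((1 - b) * (1 - n%:R * b))); last by rewrite ler_wpM2l // subr_ge0.
have := mulr_ge0 n0 (mulr_ge0 b0 b0); lra.
Qed.

(** The inequalities (1 - b) (1 + b) <= 1 and 1 + n b <= (1 + b)^n in one induction. *)
Lemma bernoulli_le b n : 0 <= b <= 1 -> (1 - b) ^+ n * (1 + n%:R * b) <= 1.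
Proof.
move=> /andP[b0 b1]; elim: n => [|n IH]; first by rewrite mul0r addr0 expr0 mulr1.
apply: le_trans IH; rewrite exprSr -mulrA ler_wpM2l ?exprn_ge0 ?subr_ge0 //.
rewrite -natr1; have n0 : 0 <= n%:R :> R by [].
have := mulr_ge0 n0 (mulr_ge0 b0 b0); have := mulr_ge0 b0 b0; lra.
Qed.

(** A polynomial that tends to 1 for s < 1 / k and to 0 for s >= 1 / k: with
   t = s k, the quantity m t^(2m) that decides tends to 0 or is at least m. *)
Definition step k m s : R := (1 - s ^+ (2 * m)) ^+ (m * k ^ (2 * m)).

Lemma step_itv k m s : 0 <= s <= 1 -> 0 <= step k m s <= 1.
Proof.
move=> /andP[s0 s1]; have p0 := exprn_ge0 (2 * m) s0.
have p1 : s ^+ (2 * m) <= 1 by rewrite exprn_ile1.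
by rewrite /step exprn_ge0 ?exprn_ile1 ?subr_ge0 // lerBlDr lerDl.
Qed.

(** Bernoulli's inequality from both sides. The exponent 2 m, rather than m, leaves a
   factor t^m after m t^m has been bounded by 1 / (1 - t). *)
Lemma step_cvg k s : (0 < k)%N -> 0 <= s <= 1 ->
  (fun m => (step k m s - (s * k%:R < 1)%R%:R) ^+ 2) @ \oo --> (0 : R).
Proof.
move=> k0 hs; have /andP[s0 s1] := hs.
have pw m : 0 <= s ^+ (2 * m) <= 1 by rewrite exprn_ge0 // exprn_ile1.
have scale m : (m * k ^ (2 * m))%:R * s ^+ (2 * m) = m%:R * (s * k%:R) ^+ (2 * m).
  by rewrite natrM natrX -mulrA -exprMn [_ * s]mulrC.
have t0 : 0 <= s * k%:R by rewrite mulr_ge0.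
have [t1|t1] := ltP (s * k%:R) 1.
- have b0 : 0 < 1 - s * k%:R by rewrite subr_gt0.
  have := @cvg_expr R (s * k%:R); rewrite ger0_norm // => /(_ t1) h.
  apply: (@squeeze_cvgr _ _ _ _ (fun=> 0) (fun m => (1 - s * k%:R)^-1 * (s * k%:R) ^+ m)).
  + apply: nearW => m; rewrite sqr_ge0 /=.
    have := bernoulli_ge (m * k ^ (2 * m)) (pw m); rewrite scale.
    have /andP[] := step_itv k m hs; rewrite -/(step k m s).
    move: (step k m s) => g g0 g1 hg.
    have : m%:R * (s * k%:R) ^+ (2 * m) <= (1 - s * k%:R)^-1 * (s * k%:R) ^+ m.
      rewrite mul2n -addnn exprD mulrA ler_wpM2r ?exprn_ge0 //.
      rewrite -[leRHS]mul1r ler_pdivlMr //.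
      have := @bernoulli_le (1 - s * k%:R) m; rewrite subKr => hb.
      have := hb _; rewrite (ltW b0) lerBlDr lerDl t0 => /(_ isT).
      have := exprn_ge0 m t0; lra.
    have g1' : 0 <= 1 - g by rewrite subr_ge0.
    have := mulr_ge0 g0 g1'.
    rewrite mulr1n expr2; lra.
  + exact: cvg_cst.
  + by rewrite -[X in _ --> X](mulr0 (1 - s * k%:R)^-1); apply: cvgMr.
- apply: (@squeeze_cvgr _ _ _ _ (fun=> 0) (fun m => m.+1%:R^-1)).
  + apply: nearW => m; rewrite sqr_ge0 /=.
    have := bernoulli_le (m * k ^ (2 * m)) (pw m); rewrite scale.
    have /andP[] := step_itv k m hs; rewrite -/(step k m s).
    move: (step k m s) => g g0 g1 hg.
    have hm : m%:R <= m%:R * (s * k%:R) ^+ (2 * m) by rewrite ler_peMr // exprn_ege1.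
    rewrite -[leRHS]mul1r ler_pdivlMr ?ltr0n // -natr1.
    have n0 : 0 <= m%:R :> R by [].
    apply: le_trans hg; rewrite mulr0n subr0 expr2 -mulrA ler_wpM2l //.
    apply: (@le_trans _ _ (1 * (m%:R + 1))); first by rewrite ler_wpM2r // addr_ge0.
    by rewrite mul1r addrC lerD2l.
  + exact: cvg_cst.
  + exact: cvg_inv_succ.
Qed.

End StepPolynomials.

Section Threshold.
Context {R : realType} {H : hilbertType R}.
Implicit Types (x y p q : H) (A B : set (borelC R)).
Variable T : {linear H -> H}.
Variable mu : H -> {measure set (borelC R) -> \bar R}.
Hypothesis hmu : circle_family T mu.

(** There is no mass off the circle, so both bounds are only asked for on it. *)
Lemma mass_symbol_le (L : H -> H) x B (h g : borelC R -> R) :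
  symbol T L (fun z => (h z)%:C) -> measurable_fun setT h -> measurable_fun setT g ->
  measurable B -> (forall z, unit_circle z -> 0 <= g z) ->
  (forall z, B z -> unit_circle z -> h z ^+ 2 <= g z) ->
  ((mass mu (L x) B)%:E <= \int[mu x]_(z in @unit_circle R) (g z)%:E)%E.
Proof.
move=> sL mh mg mB g0 fg; have mf : measurable_fun setT (fun z : borelC R => csq (h z)%:C).
  rewrite (_ : (fun z => _) = (fun z => h z ^+ 2)); first exact: measurable_funX.
  by apply/funext => z; rewrite csqC.
have mc := @measurable_circle R.
have mCc := measurableC mc.
have off : mass mu (L x) (B `&` ~` @unit_circle R) = 0.
  apply: (@null_le _ _ _ _ hmu _ _ (~` @unit_circle R)) => //.
  - exact: measurableI.
  - by rewrite /mass; have [_ -> _ _] := hmu.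
rewrite (massIC hmu _ mB mc) off addr0 (mass_symbol hmu _ sL) //; last exact: measurableI.
apply: (@le_trans _ _ (\int[mu x]_(z in B `&` @unit_circle R) (g z)%:E)%E).
  apply: ge0_le_integral.
  - exact: measurableI.
  - by move=> z _; rewrite lee_fin csq_ge0.
  - by apply: measurable_funTS; apply/measurable_EFinP.
  - by apply: measurable_funTS; apply/measurable_EFinP.
  - by move=> z [Bz cz]; rewrite lee_fin csqC fg.
apply: ge0_subset_integral => //.
- exact: measurableI.
- by apply: measurable_funTS; apply/measurable_EFinP.
Qed.

(** The vectors step k m (L) x form a Cauchy sequence, because their distances are
   integrals of differences of the polynomials, which converge to the indicator
   of the set. The limit is the part of x carried by it. *)
Lemma splitting_threshold (L : H -> H) (s : borelC R -> R) k : (0 < k)%N ->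
  symbol T L (fun z => (s z)%:C) -> measurable_fun setT s ->
  (forall z, unit_circle z -> 0 <= s z <= 1) -> splitting mu [set z | s z * k%:R < 1].
Proof.
move=> k0 sL ms s01; set G := [set z | _].
have mG : measurable G.
  have -> : G = (fun z => s z * k%:R) @^-1` [set` `]-oo, 1[].
    by apply/seteqP; split=> z /=; rewrite in_itv.
  rewrite -[X in measurable X]setTI; apply: measurable_funM => //.
split=> // x.
pose pow m y := iter (m * k ^ (2 * m)) (fun y => 1 *: y + (-1) *: iter (2 * m) L y) y.
have spow m : symbol T (pow m) (fun z => (step k m (s z))%:C).
  have -> : (fun z => (step k m (s z))%:C) =
      (fun z => (1 + (-1) * (s z)%:C ^+ (2 * m)) ^+ (m * k ^ (2 * m))).
    by apply/funext => z; rewrite /step mulN1r rmorphXn rmorphB rmorphXn.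
  apply: symbolX; apply: symbolD (symbol_scalar T 1) _.
  by apply: symbolM (symbol_scalar T (-1)) _; exact: symbolX.
pose chi (z : borelC R) : R := (s z * k%:R < 1)%R%:R.
pose err m (z : borelC R) := (step k m (s z) - chi z) ^+ 2.
have mstep m : measurable_fun setT (fun z => step k m (s z)).
  apply: measurable_funX; apply: measurable_funB => //; exact: measurable_funX.
have mchi : measurable_fun setT chi.
  suff -> : chi = \1_G by exact: measurable_indic.
  by apply/funext => z; rewrite /chi indicE; suff -> : (z \in G) = (s z * k%:R < 1) by [];
    apply/idP/idP; rewrite inE.
have merr m : measurable_fun setT (err m).
  by apply: measurable_funX; apply: measurable_funB.
have err_ge0 m z : 0 <= err m z by exact: sqr_ge0.
have err_le1 m z : unit_circle z -> err m z <= 1.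
  move=> cz; have /andP[] := step_itv k m (s01 z cz).
  rewrite /err /chi; move: (step _ _ _) => g g0 g1.
  have g1' : 0 <= 1 - g by rewrite subr_ge0.
  have := mulr_ge0 g0 g1'; case: (_ < _); rewrite ?mulr1n ?mulr0n expr2; lra.
have fin : (mu x (@unit_circle R) < +oo)%E.
  by rewrite -(massE hmu) ?ltry //; exact: measurable_circle.
have ierr m : (mu x).-integrable (@unit_circle R) (EFin \o err m).
  apply: circle_integrable => //; exists 1 => z cz.
  by rewrite ger0_norm ?err_le1.
pose I m := (\int[mu x]_(z in @unit_circle R) (err m z)%:E)%E.
pose i m := fine (I m).
have iE m : (i m)%:E = I m by rewrite fineK //; exact: (integrable_fin_num (@measurable_circle R) (ierr m)).
have i_ge0 m : 0 <= i m.
  by rewrite fine_ge0 // integral_ge0 // => z _; rewrite lee_fin err_ge0.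
have i0 : forall e : R, 0 < e -> exists N, forall n, (N <= n)%N -> i n < e.
  have I0 : I @ \oo --> 0%E.
    have -> : 0%E = (\int[mu x]_(z in @unit_circle R) 0)%E by rewrite integral0.
    apply: (@dominated_cvg _ _ _ _ _ _ _ (fun=> 0%E) (fun=> 1%:E)).
    - exact: measurable_circle.
    - by move=> m; apply: measurable_funTS; apply/measurable_EFinP.
    - move=> z cz; apply: cvg_EFin; first exact: nearW.
      exact: step_cvg (s01 z cz).
    - by [].
    - by apply: (@circle_integrable _ _ (cst 1)) => //; exists 1 => z _; rewrite normr1.
    - by move=> m z cz; rewrite gee0_abs ?lee_fin ?err_le1.
  move=> e e0; have /fine_cvg/cvgrPdist_lt/(_ e e0)[N _ hN] := I0.
  by exists N => n /hN; rewrite sub0r normrN (ger0_norm (i_ge0 n)).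
have sB L1 L2 (h1 h2 : borelC R -> R) : symbol T L1 (fun z => (h1 z)%:C) ->
    symbol T L2 (fun z => (h2 z)%:C) ->
    symbol T (fun y => L1 y + (-1) *: L2 y) (fun z => (h1 z - h2 z)%:C).
  move=> s1 s2; have := symbolD s1 (symbolM (symbol_scalar T (-1)) s2).
  by congr (symbol _ _ _); apply/funext => z; rewrite mulN1r rmorphB.
have pow_err m l : sq (pow m x - pow l x) <= 2 * i m + 2 * i l.
  rewrite -(massT hmu) -lee_fin -scaleN1r.
  apply: le_trans (mass_symbol_le (g := fun z => 2 * err m z + 2 * err l z) _
    (sB _ _ _ _ (spow m) (spow l)) _ _ _ _ _) _ => //.
  - exact: measurable_funB.
  - by apply: measurable_funD; exact: measurable_funM.
  - by move=> z _; rewrite addr_ge0 // mulr_ge0.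
  - move=> z _ cz; rewrite /err; move: (step k m _) (step k l _) (chi z) => a b c.
    have := sqr_ge0 (a + b - 2 * c); rewrite !expr2; lra.
  - have mc := @measurable_circle R.
    rewrite EFinD !EFinM !iE -(integralZl mc (ierr m)) -(integralZl mc (ierr l)).
    by rewrite -(integralD mc (integrableZl mc 2 (ierr m)) (integrableZl mc 2 (ierr l))).
have pow_out m : mass mu (pow m x) (~` G) <= i m.
  rewrite -lee_fin iE; apply: (mass_symbol_le _ (spow m)) => //.
  - exact: measurableC.
  - move=> z nGz cz; rewrite /err /chi.
    by have -> : (s z * k%:R < 1) = false; [apply/negP | rewrite mulr0n subr0].
have pow_in m : mass mu (x - pow m x) G <= i m.
  rewrite -lee_fin iE -scaleN1r -{1}(scale1r x).
  have s1 : symbol T (fun y => 1 *: y) (fun z => ((fun=> 1 : R) z)%:C).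
    exact: symbol_scalar.
  apply: (mass_symbol_le _ (sB _ _ _ _ s1 (spow m))) => //.
  - exact: measurable_funB.
  - move=> z Gz cz; rewrite /err /chi.
    by have -> : (s z * k%:R < 1) = true; [apply/negP | rewrite mulr1n -sqrrN opprB].
have [u hu] : exists u, sq_cvg (pow^~ x) u.
  apply: sq_complete => e e0; have [N hN] := i0 (e / 4) (divr_gt0 e0 (ltr0n _ 4)).
  exists N => m n Nm Nn; apply: le_lt_trans (pow_err m n) _.
  have := hN _ Nm; have := hN _ Nn; lra.
exists u; split.
  apply: (null_limit hmu (measurableC mG) hu) => e e0; have [N hN] := i0 e e0.
  by exists N => n /hN; apply: le_lt_trans.
have hxu : sq_cvg (fun n => x - pow n x) (x - u).
  move=> e e0; have [N hN] := hu e e0; exists N => n /hN.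
  suff -> : x - pow n x - (x - u) = - (pow n x - u) by rewrite sqN.
  by rewrite !opprB [LHS]addrC subrKA.
apply: (null_limit hmu mG hxu) => e e0; have [N hN] := i0 e e0.
by exists N => n /hN; apply: le_lt_trans.
Qed.

End Threshold.

Section BorelSplitting.
Context {R : realType} {H : hilbertType R}.
Implicit Types (x y p q : H) (A B : set (borelC R)).

Lemma csqN (w : R[i]) : csq (- w) = csq w.
Proof. by case: w => a b; rewrite /csq /= !sqrrN. Qed.

Lemma csq_mulB (z w : R[i]) :
  (csq (z - w))%:C = (z + (- w)) * (conjc z + - conjc w).
Proof.
case: z w => a b [c d]; rewrite /csq /=; apply/eqP.
by rewrite eq_complex /=; apply/andP; split; apply/eqP; ring.
Qed.

Definition disk (w : R[i]) (r : R) : set (borelC R) := [set z | csq ((z : R[i]) - w) < r].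

(** Rational disks form a countable base of the topology. *)
Lemma open_disk (U : set R[i]^o) (z : R[i]) : open U -> U z ->
  exists a b c : rat, [/\ 0 < c, disk (ratr a +i* ratr b) (ratr c) z &
    disk (ratr a +i* ratr b) (ratr c) `<=` U].
Proof.
rewrite openE => oU /oU /nbhs_ballP[eps /= eps0 hU].
have [e e0 hUe] : exists2 e : R, 0 < e & forall y : R[i], csq (y - z) < e -> U y.
  move: eps0 hU; case: eps => e i; rewrite ltcE /= => /andP[/eqP -> e0] hU.
  exists (e ^+ 2); first exact: exprn_gt0.
  move=> y yz; apply: hU; rewrite /ball /= csq_norm ltcR.
  have se : e = Num.sqrt (e ^+ 2) by rewrite sqrtr_sqr gtr0_norm.
  rewrite [ltRHS]se ltr_sqrt ?exprn_gt0 //; suff -> : csq (z - y) = csq (y - z) by [].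
  by rewrite -(opprB y) csqN.
have [c] : exists c : rat, ratr c \in `]0, (e / 4)[ by apply: rat_in_itvoo; rewrite divr_gt0.
rewrite in_itv /= => /andP[c0 ce].
pose d := Num.sqrt ((ratr c : R) / 2).
have d0 : 0 < d by rewrite sqrtr_gt0 divr_gt0.
have d2 : d ^+ 2 = ratr c / 2 by rewrite sqr_sqrtr // divr_ge0 // ltW.
have near (v : R) : exists a : rat, (v - ratr a) ^+ 2 < ratr c / 2.
  have [a] : exists a : rat, ratr a \in `](v - d), (v + d)[.
    by apply: rat_in_itvoo; lra.
  rewrite in_itv /= => /andP[h1 h2]; exists a; rewrite -d2.
  rewrite -[ltLHS]real_normK ?num_real // ltr_pXn2r ?nnegrE ?normr_ge0 ?(ltW d0) //.
  by rewrite ltr_norml; lra.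
have [a ha] := near (complex.Re z); have [b hb] := near (complex.Im z).
have zw : csq (z - (ratr a +i* ratr b)) < ratr c.
  by move: ha hb; case: (z) => u v; rewrite /csq /=; lra.
exists a, b, c; split=> // [|y]; first by rewrite ltr0q in c0.
rewrite /disk /= => yw; apply: hUe.
have := csq_le2 (y - (ratr a +i* ratr b)) ((ratr a +i* ratr b) - z).
rewrite subrKA.
have -> : csq ((ratr a +i* ratr b) - z) = csq (z - (ratr a +i* ratr b)).
  by rewrite -(opprB z) csqN.
lra.
Qed.

Variables T S : {linear H -> H}.
Hypothesis TS : forall x, T (S x) = x.
Hypothesis iT : forall x, sq (T x) = sq x.
Variable mu : H -> {measure set (borelC R) -> \bar R}.
Hypothesis hmu : circle_family T mu.

(** |z - w|^2 is the symbol of (T - w) (S - conjc w), where S is the inverse of T. *)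
Lemma splitting_disk (w : R[i]) (r : R) : 0 < r -> splitting mu (disk w r).
Proof.
(* K is an integral multiple k of r and exceeds |z - w|^2 on the circle, so that
   s takes values in [0, 1] there and the threshold s < 1 / k is |z - w|^2 < r. *)
move=> r0; pose k := (Num.truncn ((2 + 2 * csq w) / r)).+1.
have k0 : 0 < k%:R :> R by rewrite ltr0n.
have hk : 2 + 2 * csq w <= r * k%:R.
  by rewrite [leRHS]mulrC -ler_pdivrMr //; exact: ltW (truncnS_gt _).
pose K := r * k%:R; have K0 : 0 < K by rewrite mulr_gt0.
pose s (z : borelC R) := K^-1 * csq ((z : R[i]) - w).
have -> : disk w r = [set z | s z * k%:R < 1].
  apply/seteqP; split=> z; rewrite /disk /s /K /= invfM mulrAC divfK ?gt_eqF //.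
    by rewrite mulrC ltr_pdivrMr // mul1r.
  by rewrite mulrC ltr_pdivrMr // mul1r.
pose L x := (K^-1)%:C *: ((T (S x + (- conjc w) *: x)) + (- w) *: (S x + (- conjc w) *: x)).
apply: (@splitting_threshold _ _ T mu hmu L) => //.
- have -> : (fun z => (s z)%:C) =
      (fun z => (K^-1)%:C * ((z + (- w)) * (conjc z + - conjc w))).
    apply/funext => z; rewrite /s rmorphM; congr (_ * _).
    exact: csq_mulB.
  apply: symbolM (symbol_scalar T _) _.
  apply: symbolM (symbolD (symbol_T iT) (symbol_scalar T _)) _.
  exact: symbolD (symbol_S TS iT) (symbol_scalar T _).
- by apply: measurable_funM => //; exact: measurable_csqB.
- move=> z; rewrite unit_circleE /= => cz; rewrite /s.
  rewrite mulr_ge0 ?csq_ge0 ?invr_ge0 ?(ltW K0) //= mulrC ler_pdivrMr // mul1r.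
  have := csq_le2 z (- w).
  rewrite csqN.
  by rewrite cz /K; lra.
Qed.

Lemma splitting_open (U : set R[i]^o) : open U -> splitting mu (U : set (borelC R)).
Proof.
move=> oU.
pose F n : set (borelC R) := if @unpickle (rat * rat * rat)%type n is Some (a, b, c) then
  if `[< 0 < c /\ disk (ratr a +i* ratr b) (ratr c) `<=` U >]
  then disk (ratr a +i* ratr b) (ratr c) else set0 else set0.
have s0 : splitting mu set0 by apply: (splitting_null hmu) => // x; rewrite /mass measure0.
suff -> : U = \bigcup_n F n.
  apply: (splitting_bigcup hmu) => n; rewrite /F.
  case: unpickle => [[[a b] c]|//]; case: asboolP => // -[c0 _].
  by apply: splitting_disk; rewrite ltr0q.
apply/seteqP; split=> z.
  move=> Uz; have [a [b [c [c0 zd dU]]]] := open_disk oU Uz.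
  exists (pickle (a, b, c)); first exact: I.
  by rewrite /F pickleK asboolT.
by move=> [n _]; rewrite /F; case: unpickle => [[[a b] c]|//]; case: asboolP => // -[_]; apply.
Qed.

Lemma splitting_borel B : measurable B -> splitting mu B.
Proof.
apply: smallest_sub => [|U oU]; last exact: splitting_open.
split=> [|A hA|F hF].
- by apply: (splitting_null hmu) => // x; rewrite /mass measure0.
- by rewrite setTD; exact: (splittingC hA).
- by apply: (splitting_bigcup hmu) => n; exact: hF.
Qed.

End BorelSplitting.

(** * The spectral theorem for unitary operators *)

Section SpectralTheorem.
Context {R : realType} {H : hilbertType R}.
Implicit Types (x y p q : H) (A B : set (borelC R)).
Variable T : {linear H -> H}.
Variable mu : H -> {measure set (borelC R) -> \bar R}.
Hypothesis hmu : circle_family T mu.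

Lemma splits_atD B x y p q : measurable B -> splits_at mu B x p ->
  splits_at mu B y q -> splits_at mu B (x + y) (p + q).
Proof.
move=> mB [p1 p2] [q1 q2]; split; first by apply: (null_add hmu) => //; exact: measurableC.
by rewrite opprD addrACA; apply: (null_add hmu).
Qed.

Lemma splits_atZ B (c : R[i]) x p : measurable B -> splits_at mu B x p ->
  splits_at mu B (c *: x) (c *: p).
Proof.
move=> mB [p1 p2]; split; first by rewrite (massZ hmu) ?p1 ?mulr0 //; exact: measurableC.
by rewrite -scalerBr (massZ hmu) // p2 mulr0.
Qed.

Lemma null0 B : measurable B -> mass mu 0 B = 0.
Proof. by move=> mB; apply/eqP; rewrite eq_le mass_ge0 andbT -(sq0 (H := H)) (mass_leT hmu). Qed.

(** The splitting of a vector is unique, hence depends linearly on it. *)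
Lemma spectral_family_exists : (forall B, measurable B -> splitting mu B) ->
  exists E : set (borelC R) -> {linear H -> H},
    forall B, measurable B -> forall x, splits_at mu B x (E B x).
Proof.
move=> hB; suff /choice[E hE] : forall B, exists L : {linear H -> H},
    measurable B -> forall x, splits_at mu B x (L x) by exists E => B; exact: hE.
move=> B.
have [mB|nB] := pselect (measurable B); last first.
  by exists (idfun : {linear H -> H}) => mB; exfalso; exact: nB.
have [f hf] := choice (hB B mB).2.
have [x y|c x|L LE] := @exists_linear _ _ f.
- by apply/esym/(split_unique hmu mB (hf (x + y))); exact: splits_atD.
- by apply/esym/(split_unique hmu mB (hf (c *: x))); exact: splits_atZ.
by exists L => _ x; rewrite LE.
Qed.

Variable E : set (borelC R) -> {linear H -> H}.
Hypothesis hE : forall B, measurable B -> forall x, splits_at mu B x (E B x).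

Lemma family_unique B x p : measurable B -> splits_at mu B x p -> E B x = p.
Proof. by move=> mB hp; exact: (split_unique hmu mB hp (hE mB x)). Qed.

Lemma family_orth B x y : measurable B -> '[E B x, y - E B y] = 0.
Proof.
by move=> mB; have [h1 _] := hE mB x; have [_ h2] := hE mB y; exact: (carried_orth hmu mB).
Qed.

Lemma family_adjoint B : measurable B -> is_adjoint (E B) (E B).
Proof.
move=> mB x y; have h1 := family_orth x y mB; have h2 := family_orth y x mB.
have -> : '[E B x, y] = '[E B x, E B y] + '[E B x, y - E B y] by rewrite -innerDr subrKC.
have -> : '[x, E B y] = '[E B x, E B y] + '[x - E B x, E B y] by rewrite -innerDl subrKC.
by rewrite h1 [X in _ = _ + X]innerC h2 rmorph0.
Qed.

Lemma familyU A B x : measurable A -> measurable B -> A `&` B = set0 ->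
  E (A `|` B) x = E A x + E B x.
Proof.
move=> mA mB AB; have mU := measurableU _ _ mA mB.
have [a1 a2] := hE mA x; have [b1 b2] := hE mB x.
apply: family_unique => //; split.
  apply: (null_add hmu); first exact: measurableC.
    by apply: (null_le hmu (measurableC mU) (measurableC mA) _ a1); apply: subsetC; left.
  by apply: (null_le hmu (measurableC mU) (measurableC mB) _ b1); apply: subsetC; right.
have null_on C D : measurable C -> measurable D -> C `&` D = set0 ->
    mass mu (x - (E C x + E D x)) C = 0.
  move=> mC mD CD; have [_ c2] := hE mC x; have [d1 _] := hE mD x.
  rewrite opprD addrA; apply: (null_sub hmu) => //.
  apply: (null_le hmu mC (measurableC mD) _ d1) => z Cz Dz.
  by have : (C `&` D) z by []; rewrite CD.
by rewrite (massU hmu) // null_on // add0r [E A x + _]addrC null_on // setIC.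
Qed.

Lemma family_series (F : (set (borelC R))^nat) x n : (forall n, measurable (F n)) -> trivIset setT F ->
  E (\big[setU/set0]_(i < n) F i) x = \sum_(i < n) E (F i) x.
Proof.
move=> mF tF; elim: n => [|n IH].
  rewrite !big_ord0; apply: family_unique => //; split; first by apply: null0; exact: measurableC.
  by rewrite /mass measure0.
rewrite !big_ord_recr /= familyU ?IH //.
  by apply: bigsetU_measurable.
rewrite big_distrl /= big1 // => i _.
by move/trivIsetP : tF; apply=> //; rewrite neq_ltn ltn_ord.
Qed.

(** Partial sums are the projections of the finite unions, and split_diff measures
   their distance to the projection of the whole union. *)
Lemma family_pvm : projection_valued_measure E.
Proof.
split.
- move=> B mB; split; last exact: family_adjoint.
  apply/funext => x /=; apply: family_unique => //; have [h1 h2] := hE mB x; split=> //.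
  by rewrite subrr null0.
- apply/funext => x; apply: family_unique; first exact: measurable_circle.
  split; last by rewrite subrr null0 //; exact: measurable_circle.
  by rewrite /mass; have [_ -> _ _] := hmu.
- move=> F mF tF x; apply: sq_cvg_cvg => e e0.
  pose G n := \big[setU/set0]_(i < n) F i.
  have mG n : measurable (G n) by apply: bigsetU_measurable.
  have nd : {homo G : m n / (m <= n)%N >-> m `<=` n} by exact: subset_bigsetU.
  have UG : \bigcup_n F n = \bigcup_n G n.
    rewrite -bigcup_bigsetU_bigcup; apply/seteqP; split=> z [n _ Gz].
      by exists n.+1.
    by exists n => //; apply: (nd n n.+1).
  have mU : measurable (\bigcup_n G n) by exact: bigcupT_measurable.
  have [N hN] := tail_mass hmu x mG nd e0; exists N => n /hN.
  rewrite UG /series /= big_mkord -family_series //.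
  rewrite -sqN opprB (split_diff hmu (mG n) mU _ (hE (mG n) x) (hE mU x)) //.
  by move=> z Gz; exists n.
Qed.

Lemma family_mass B x : measurable B -> sq (E B x) = mass mu x B.
Proof.
move=> mB; have [h1 h2] := hE mB x.
rewrite -(massT hmu) (massIC hmu _ (@measurableT _ _) mB) !setTI h1 addr0.
by rewrite -{2}(subrKC (E B x) x) (massD_null hmu).
Qed.

Hypothesis iT : forall x, sq (T x) = sq x.

(** Compare the mass of T x + c x, which is 2 |x|^2 + 2 Re <T x, c x>, with the
   integral of |z + c|^2 = 2 + 2 f z. *)
Lemma moment (c : R[i]) (f : borelC R -> R) x : csq c = 1 -> measurable_fun setT f ->
  (forall z, unit_circle z -> csq ((z : R[i]) + c) = 2 + 2 * f z) ->
  (\int[mu x]_(z in @unit_circle R) (f z)%:E)%E = (rip (T x) (c *: x))%:E.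
Proof.
move=> c1 mf hf; have mc := @measurable_circle R.
have fin : (mu x (@unit_circle R) < +oo)%E by rewrite -(massE hmu) ?ltry.
have intf : (mu x).-integrable (@unit_circle R) (EFin \o f).
  apply: circle_integrable => //; exists 1 => z cz.
  have h1 := hf z cz; have h2 := csq_ge0 (z + c); have h3 := csq_le2 z c.
  have z1 : csq z = 1 by move: cz; rewrite unit_circleE.
  by rewrite ler_norml; lra.
have sTc := symbolD (symbol_T iT) (symbol_scalar T c).
have mcsq : measurable_fun setT (fun z : borelC R => csq ((z : R[i]) + c)).
  by rewrite -(opprK c); exact: measurable_csqB.
have := mass_symbol hmu x sTc mcsq mc.
have mcir y : mass mu y (@unit_circle R) = sq y.
  rewrite -(massT hmu) (massIC hmu y (@measurableT _ _) mc) !setTI.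
  by rewrite [X in _ = _ + X]/mass; have [_ -> _ _] := hmu; rewrite addr0.
rewrite mcir sqD iT sqZ c1 mul1r.
have -> : (\int[mu x]_(z in @unit_circle R) (csq ((z : R[i]) + c))%:E)%E =
    (\int[mu x]_(z in @unit_circle R) (2%:E + 2%:E * (f z)%:E))%E.
  by apply: eq_integral => z; rewrite inE => /hf ->; rewrite EFinD EFinM.
have int2 : (mu x).-integrable (@unit_circle R) (cst 2%:E).
  by apply: (@circle_integrable _ _ (cst 2)) => //; exists 2 => z _; rewrite ger0_norm.
rewrite (integralD mc int2 (integrableZl mc 2 intf)) (integralZl mc intf).
rewrite integral_cst // -(massE hmu) // mcir.
have /fineK <- := integrable_fin_num mc intf.
by rewrite -!EFinM -EFinD => -[h]; congr (_%:E); lra.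
Qed.

Lemma family_spectral : spectral_measure T E.
Proof.
split=> [|x]; first exact: family_pvm.
have sE B : measurable B -> scalar_measure E x B = mu x B.
  by move=> mB; rewrite (scalar_measureE family_pvm) // family_mass // (massE hmu).
rewrite !(eq_integral_measurable _ _ sE).
have c1 : csq (1 : R[i]) = 1 by rewrite /csq /= expr1n expr0n addr0.
have ci : csq ('i : R[i]) = 1 by rewrite /csq /= expr1n expr0n add0r.
rewrite (moment x c1 (@measurable_Re R)) => [|z]; last first.
  rewrite unit_circleE /csq /=; case: (z : R[i]) => a b /=; rewrite addr0 !expr2; lra.
rewrite (moment x ci (@measurable_Im R)) => [|z]; last first.
  rewrite unit_circleE /csq /=; case: (z : R[i]) => a b /=; rewrite addr0 !expr2; lra.
rewrite scale1r /= {2}/rip innerZr /rip; case: '[T x, x] => a b /=.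
by rewrite mul0r mulN1r sub0r opprK.
Qed.

End SpectralTheorem.

(** * Vectors dominated by arc length *)

Section ArcLength.
Context {R : realType}.
Implicit Types (s t a b : R) (B : set (borelC R)).

Let turn_measurable : measurable (`[0, 2 * pi[%classic : set (measurableTypeR R)).
Proof. exact: measurable_itv. Qed.

(** Lebesgue measure on one turn of the circle. *)
Definition turn : {measure set (measurableTypeR R) -> \bar R} :=
  mrestr (@lebesgue_measure R) turn_measurable.

Lemma circle_lebesgue_measure : exists lam : {measure set (borelC R) -> \bar R},
  (forall B, lam B = circle_lebesgue B) /\
  forall g : borelC R -> \bar R, measurable_fun setT g -> (forall z, 0 <= g z)%E ->
    (\int[lam]_z g z = \int[turn]_t g (expi t))%E.
Proof.
have me : measurable_fun setT (@expi R : measurableTypeR R -> borelC R).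
  exact: measurable_expi.
pose lam : {measure set (borelC R) -> \bar R} :=
  measure_function_pushforward__canonical__measure_function_Measure turn me.
exists lam; split=> [B|g mg g0]; first by rewrite /circle_lebesgue setIC.
by have := @ge0_integral_pushforward _ _ _ _ R _ me turn setT g measurableT mg;
  rewrite preimage_setT; apply => z _.
Qed.

Lemma turn_itv a b : a <= b -> (turn `[a, b[%classic <= (b - a)%:E)%E.
Proof.
move=> ab; apply: (@le_trans _ _ (lebesgue_measure `[a, b[%classic)).
  rewrite /turn /= /mrestr; apply: le_measure; rewrite ?inE //.
    by apply: measurableI.
rewrite lebesgue_measure_itv /= lte_fin; case: ltP => // _.
by rewrite lee_fin subr_ge0.
Qed.

(** A Lipschitz function differs by at most K h from its value at the left end point
   of a cell of length h. *)
Lemma turn_riemann (F : measurableTypeR R -> R) (K : R) N : measurable_fun setT F ->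
  (forall t, 0 <= F t) -> (forall s t, `|F s - F t| <= K * `|s - t|) -> 0 <= K ->
  (\int[turn]_t (F t)%:E <=
    (2 * pi / N.+1%:R * \sum_(j < N.+1) F (2 * pi / N.+1%:R * j%:R) +
     2 * pi * (K * (2 * pi / N.+1%:R)))%:E)%E.
Proof.
move=> mF F0 lF K0; set h := 2 * pi / N.+1%:R.
have pi0 := pi_gt0 R.
have h0 : 0 < h by rewrite divr_gt0 // mulr_gt0.
have hN : N.+1%:R * h = 2 * pi by rewrite mulrC divfK.
have mFD (D : set (measurableTypeR R)) : measurable_fun D (fun t => (F t)%:E).
  by apply: measurable_funTS; apply/measurable_EFinP.
have cells n : (\int[turn]_(t in `[0%R, (n%:R * h)%R[) (F t)%:E <=
    (\sum_(j < n) h * (F (h * j%:R) + K * h))%:E)%E.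
  elim: n => [|n IH]; first by rewrite mul0r set_itvco0 integral_set0 big_ord0.
  have n0 : 0 <= n%:R * h by rewrite mulr_ge0 // ltW.
  have nS : n%:R * h <= n.+1%:R * h by rewrite ler_wpM2r ?ler_nat // ltW.
  have -> : `[0, (n.+1%:R * h)[%classic = `[0, (n%:R * h)[%classic `|` `[n%:R * h, n.+1%:R * h[%classic.
    by rewrite -itv_bndbnd_setU // bnd_simp.
  rewrite ge0_integral_setU //; last 2 first.
  - by move=> t _; rewrite lee_fin.
  - apply/disj_setPS => t []; rewrite /= !in_itv /= => /andP[_ h1] /andP[h2 _].
    by move: h1; rewrite ltNge h2.
  rewrite big_ord_recr EFinD; apply: leeD => //.
  set v := F (h * n%:R) + K * h.
  have v0 : 0 <= v by rewrite addr_ge0 // mulr_ge0 // ltW.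
  apply: (@le_trans _ _ (\int[turn]_(t in `[(n%:R * h)%R, (n.+1%:R * h)%R[) (cst v%:E t))%E).
    apply: ge0_le_integral => //.
    + by move=> t _; rewrite lee_fin.
    + move=> t; rewrite /= in_itv /= => /andP[h1 h2]; rewrite lee_fin /v.
      have := lF t (h * n%:R); have := ler_norm (F t - F (h * n%:R)).
      have : `|t - h * n%:R| <= h.
        rewrite ger0_norm ?subr_ge0 1?mulrC // lerBlDr mulrC.
        by move: h2; rewrite -natr1 mulrDl mul1r addrC [n%:R * h]mulrC => /ltW.
      move=> h3 h4 h5; have := ler_wpM2l K0 h3; lra.
  rewrite integral_cst // EFinM muleC lee_wpmul2r ?lee_fin //.
  apply: le_trans (turn_itv nS) _; rewrite lee_fin -natr1 mulrDl mul1r; lra.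
have := cells N.+1; rewrite hN => hc.
have -> : (\int[turn]_t (F t)%:E = \int[turn]_(t in `[0%R, (2 * pi)%R[) (F t)%:E)%E.
  rewrite (@ge0_negligible_integral _ _ _ turn setT (~` `[0%R, (2 * pi)%R[%classic)) //.
  - by rewrite setTD setCK.
  - by apply: measurableC.
  - by move=> t _; rewrite lee_fin.
  - by rewrite /turn /= /mrestr setICl measure0.
apply: le_trans hc _; rewrite lee_fin -mulr_sumr big_split /= mulrDr lerD2l.
rewrite sumr_const card_ord -hN -[K * h *+ _]mulr_natl.
by move: (N.+1%:R) => u; rewrite mulrA [h * u]mulrC.
Qed.

End ArcLength.

Section DominatedDensity.
Context {R : realType} {H : hilbertType R}.
Implicit Types (x y u : H) (B : set (borelC R)) (al : nat -> R[i]).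

(** The real and the imaginary part are used instead of a measurable structure on the
   target, which keeps sums and products elementary. *)
Definition measurable_cfun (f : borelC R -> R[i]) :=
  measurable_fun setT (fun z => Re (f z)) /\ measurable_fun setT (fun z => Im (f z)).

Lemma measurable_cfunD f g : measurable_cfun f -> measurable_cfun g ->
  measurable_cfun (fun z => f z + g z).
Proof.
move=> [f1 f2] [g1 g2]; split.
  rewrite (_ : (fun z => _) = (fun z => Re (f z) + Re (g z))); first exact: measurable_funD.
  by apply/funext => z; rewrite raddfD.
rewrite (_ : (fun z => _) = (fun z => Im (f z) + Im (g z))); first exact: measurable_funD.
by apply/funext => z; rewrite raddfD.
Qed.

Lemma measurable_cfunM f g : measurable_cfun f -> measurable_cfun g ->
  measurable_cfun (fun z => f z * g z).
Proof.
move=> [f1 f2] [g1 g2]; split.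
  rewrite (_ : (fun z => _) = (fun z => Re (f z) * Re (g z) - Im (f z) * Im (g z))).
    by apply: measurable_funB; exact: measurable_funM.
  by apply/funext => z; case: (f z) (g z) => a b [c d].
rewrite (_ : (fun z => _) = (fun z => Re (f z) * Im (g z) + Im (f z) * Re (g z))).
  by apply: measurable_funD; exact: measurable_funM.
by apply/funext => z; case: (f z) (g z) => a b [c d].
Qed.

Lemma measurable_cfun_cst (c : R[i]) : measurable_cfun (fun=> c).
Proof. by split; exact: measurable_cst. Qed.

Lemma measurable_cfun_conjc : measurable_cfun (fun z => conjc (z : R[i])).
Proof.
split.
  rewrite (_ : (fun z => _) = (fun z => Re (z : R[i]))); first exact: measurable_Re.
  by apply/funext => -[a b].
rewrite (_ : (fun z => _) = (fun z => - Im (z : R[i]))).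
  by apply: measurable_funN; exact: measurable_Im.
by apply/funext => -[a b].
Qed.

Lemma measurable_csq f : measurable_cfun f -> measurable_fun setT (fun z : borelC R => csq (f z)).
Proof. by move=> [f1 f2]; apply: measurable_funD; exact: measurable_funX. Qed.

(** The symbol of past. *)
Definition trig al n (z : R[i]) : R[i] := \sum_(j < n) al j * conjc z ^+ j.

Lemma measurable_trig al n : measurable_cfun (trig al n).
Proof.
elim: n => [|n IH].
  rewrite (_ : trig al 0 = fun=> 0); first exact: measurable_cfun_cst.
  by apply/funext => z; rewrite /trig big_ord0.
rewrite (_ : trig al n.+1 = fun z => trig al n z + al n * conjc z ^+ n); last first.
  by apply/funext => z; rewrite /trig big_ord_recr.
apply: measurable_cfunD => //; apply: measurable_cfunM; first exact: measurable_cfun_cst.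
elim: n {IH} => [|n IH].
  rewrite (_ : (fun z => _) = fun=> 1); first exact: measurable_cfun_cst.
  by apply/funext => z; rewrite expr0.
rewrite (_ : (fun z => _) = fun z => conjc z * conjc z ^+ n); last first.
  by apply/funext => z; rewrite exprS.
exact: measurable_cfunM measurable_cfun_conjc IH.
Qed.

(** vector_parseval for the multiples al_k *: e, padded with zeros. *)
Lemma trig_parseval al n N (e : H) : sq e != 0 -> (n <= N)%N -> 
  \sum_(j < N) csq (trig al n (unity_root N j)) = N%:R * \sum_(k < n) csq (al k).
Proof.
move=> e0 nN; pose v k := if (k < n)%N then al k *: e else 0.
have := vector_parseval N v.
have -> : \sum_(k < N) sq (v k) = (\sum_(k < n) csq (al k)) * sq e.
  rewrite mulr_suml (big_ord_widen _ (fun k => csq (al k) * sq e) nN) [RHS]big_mkcond /=.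
  by apply: eq_bigr => k _; rewrite /v; case: ifP => _; rewrite ?sqZ ?sq0.
have -> : \sum_(j < N) sq (\sum_(k < N) conjc (unity_root N j) ^+ k *: v k) =
    (\sum_(j < N) csq (trig al n (unity_root N j))) * sq e.
  rewrite mulr_suml; apply: eq_bigr => j _; rewrite -sqZ; congr sq.
  rewrite /trig scaler_suml (big_ord_widen _ (fun k => (al k * conjc (unity_root N j) ^+ k) *: e) nN).
  rewrite [RHS]big_mkcond; apply: eq_bigr => k _ /=.
  by rewrite /v; case: ifP => _; rewrite ?scaler0 // scalerA mulrC.
by rewrite mulrA => /(mulIf e0).
Qed.

Variables T S : {linear H -> H}.
Hypothesis TS : forall x, T (S x) = x.
Hypothesis ST : forall x, S (T x) = x.
Hypothesis iT : forall x, sq (T x) = sq x.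
Variable mu : H -> {measure set (borelC R) -> \bar R}.
Hypothesis hmu : circle_family T mu.

(** The state reached with inputs al_j u, transported back by powers of S. *)
Definition past al n x := \sum_(j < n) al j *: iter j S x.

(** Apply S, which is isometric, as often as the system has applied T. *)
Lemma sq_drive al n u : sq (drive T (fun j => al j *: u) n) = sq (past al n u).
Proof.
have iS := isometry_inv TS iT.
have iSn k x : sq (iter k S x) = sq x by elim: k => //= k IH; rewrite iS.
suff E : iter n S (drive T (fun j => al j *: u) n) = S (past al n u).
  by rewrite -(iSn n) E iS.
elim: n => [|n IH]; first by rewrite /past big_ord0 linear0.
have SZ c x : S (c *: x) = c *: S x by exact: linearZ.
have SD x y : S (x + y) = S x + S y by exact: raddfD.
rewrite [LHS](_ : _ = iter n.+1 S (T (drive T (fun j => al j *: u) n) + al n *: u)) //.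
rewrite iter_add iter_scale [X in X + _]iterSr ST IH.
by rewrite [in RHS]/past big_ord_recr /= SD SZ.
Qed.

Lemma symbol_past al n : symbol T (past al n) (trig al n).
Proof.
elim: n => [|n IH].
  rewrite (_ : past al 0 = fun x => 0 *: x); last first.
    by apply/funext => x; rewrite /past big_ord0 scale0r.
  rewrite (_ : trig al 0 = fun=> 0); first exact: symbol_scalar.
  by apply/funext => z; rewrite /trig big_ord0.
rewrite (_ : past al n.+1 = fun x => past al n x + al n *: iter n S x); last first.
  by apply/funext => x; rewrite /past big_ord_recr.
rewrite (_ : trig al n.+1 = fun z => trig al n z + al n * conjc z ^+ n); last first.
  by apply/funext => z; rewrite /trig big_ord_recr.
by apply: symbolD IH (symbolM (symbol_scalar T _) _); apply: symbolX; exact: symbol_S.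
Qed.

(** The energy of the inputs al_j u is the integral of |trig al|^2 against mu u, at
   most c times its integral over one turn. Riemann sums at roots of unity are
   evaluated by Parseval's identity, and their error tends to 0. *)
Lemma dominated_bounded_density u (c : nat) :
  (forall B, measurable B -> mu u B <= c%:R%:E * circle_lebesgue B)%E ->
  bounded_density T u.
Proof.
move=> dom; have [u0|u0] := eqVneq (sq u) 0.
  exists 0 => // al n; rewrite mul0r isometry_energy // sq_drive (sq_eq0 u0).
  by rewrite /past big1 ?sq0 // => j _; rewrite (_ : iter j S 0 = 0) ?scaler0 //; elim: (nat_of_ord j) => //= k ->; rewrite linear0.
have pi0 := pi_gt0 R; have c0 : 0 <= c%:R :> R by [].
exists (c%:R * (2 * pi)) => [|al n]; first by rewrite !mulr_ge0 // ltW.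
rewrite isometry_energy // sq_drive.
have sP := symbol_past al n; have [C [C0 _ hf lf _]] := sP.
have mtrig := measurable_csq (measurable_trig al n).
have [lam [lamE lam_int]] := @circle_lebesgue_measure R.
have mcis : measurable_fun setT (@expi R : measurableTypeR R -> borelC R).
  exact: measurable_expi.
have key N : (n <= N.+1)%N -> sq (past al n u) <=
    c%:R * (2 * pi * (\sum_(j < n) csq (al j)) + 2 * pi * (2 * C * (2 * pi / N.+1%:R))).
  move=> nN; rewrite -(massT hmu) -lee_fin (mass_symbol hmu _ sP) //.
  have mt : measurable_fun setT (fun z : borelC R => (csq (trig al n z))%:E).
    exact/measurable_EFinP.
  have k0 : 0 <= c%:R :> R by [].
  pose k := NngNum k0.
  apply: (@le_trans _ _ (\int[mscale k lam]_z (csq (trig al n z))%:E)%E).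
    apply: ge0_le_measure_integral => //.
      by move=> B mB; have := dom B mB; rewrite -lamE.
    by move=> z; rewrite lee_fin csq_ge0.
  rewrite ge0_integral_mscale //; last by move=> z _; rewrite lee_fin csq_ge0.
  rewrite lam_int // => [|z]; last by rewrite lee_fin csq_ge0.
  rewrite EFinM lee_wpmul2l // ?lee_fin //.
  apply: le_trans (turn_riemann N _ _ (symbol_lip C0 hf lf) _) _.
  - exact: measurableT_comp mtrig mcis.
  - by move=> t; exact: csq_ge0.
  - by rewrite mulr_ge0.
  rewrite lee_fin lerD2r (trig_parseval al u0 nN) mulrA divfK //.
have sum0 : 0 <= \sum_(j < n) csq (al j) by apply: sumr_ge0 => j _; exact: csq_ge0.
move: key sum0; move: (sq _) (\sum_(j < n) _) => a s key s0.
rewrite -subr_le0.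
pose D := c%:R * (2 * pi * (2 * C * (2 * pi))).
(* N + 1 = m + n + 1 nodes are enough for Parseval's identity, whatever m is. *)
apply: (@archi_le _ (n.+1%:R * (a - c%:R * (2 * pi) * s) - D)) => m.
have := key (m + n)%N; rewrite leqW ?leq_addl // => /(_ isT) h.
have N0 : 0 < (m + n).+1%:R :> R by rewrite ltr0n.
have -> : n.+1%:R * (a - c%:R * (2 * pi) * s) - D + m%:R * (a - c%:R * (2 * pi) * s) =
   (m + n).+1%:R * (a - c%:R * (2 * pi) * s) - D.
  by rewrite -addnS natrD; ring.
rewrite subr_le0 mulrC -ler_pdivlMr // lerBlDr; apply: le_trans h _.
rewrite /D; move: ((m + n).+1%:R) N0 => M M0.
rewrite le_eqVlt; apply/orP; left; apply/eqP; field; rewrite gt_eqF //.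
Qed.

End DominatedDensity.

(** * Singularity of the spectral measures *)

Section HahnComparison.
Local Open Scope ereal_scope.

(** N is the negative set of m1 - c m2. *)
Lemma hahn_comparison d (X : measurableType d) (R : realType)
    (m1 m2 : {measure set X -> \bar R}) (c : nat) : m1 setT < +oo -> m2 setT < +oo ->
  exists N, [/\ measurable N,
    forall B, measurable B -> B `<=` N -> m1 B <= c%:R%:E * m2 B &
    forall B, measurable B -> B `<=` ~` N -> c%:R%:E * m2 B <= m1 B].
Proof.
move=> f1 f2.
pose M1 : {finite_measure set X -> \bar R} := mfrestr measurableT f1.
pose M2 : {finite_measure set X -> \bar R} := mfrestr measurableT f2.
pose nu := cadd (charge_of_finite_measure M1)
  (cscale (- c%:R)%R (charge_of_finite_measure M2)).
have nuE B : nu B = m1 B - c%:R%:E * m2 B.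
  by rewrite /nu /cadd /= /cscale /= EFinN mulNe /charge_of_finite_measure /= /mfrestr /mrestr !setIT.
have g2 := lty_fin_num_fun f2.
have [P [N [[mP hP] [mN hN] PN PN0]]] := Hahn_decomposition nu.
exists N; split=> // B mB.
- move=> /(hN _ mB) h; have {h} : nu B <= 0 by exact: h.
  rewrite nuE leeBlDr ?add0e // fin_numM //; exact: g2.
- move=> BN; have /(hP _ mB) h : B `<=` P.
    move=> z Bz; have : (P `|` N) z by rewrite PN.
    by case=> // /(BN _ Bz).
  have {h} : 0 <= nu B by exact: h.
  rewrite nuE leeBrDr ?add0e // fin_numM //; exact: g2.
Qed.

End HahnComparison.

Section Singularity.
Context {R : realType} {H : hilbertType R}.
Implicit Types (x y u : H) (B : set (borelC R)).
Variables T S : {linear H -> H}.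
Hypothesis TS : forall x, T (S x) = x.
Hypothesis ST : forall x, S (T x) = x.
Hypothesis iT : forall x, sq (T x) = sq x.
Variable mu : H -> {measure set (borelC R) -> \bar R}.
Hypothesis hmu : circle_family T mu.
Hypothesis borel_split : forall B, measurable B -> splitting mu B.
Hypothesis maxT : harnack_maximal T.

(** The part u of x carried by N is dominated on all Borel sets, so it has bounded
   density and is 0. *)
Lemma dominated_null x (c : nat) N : measurable N ->
  (forall B, measurable B -> B `<=` N -> (mu x B <= c%:R%:E * circle_lebesgue B)%E) ->
  mass mu x N = 0.
Proof.
move=> mN dom; have [lam [lamE _]] := @circle_lebesgue_measure R.
have [_ /(_ x)[u [u1 u2]]] := borel_split mN.
have xu : x = u + (x - u) by rewrite subrKC.
suff u0 : u = 0 by move: u2; rewrite u0 subr0.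
apply: (isometry_bounded_density maxT iT).
apply: (dominated_bounded_density TS ST iT hmu (c := c)) => B mB.
have mBN : measurable (B `&` N) by exact: measurableI.
have mBC : measurable (B `&` ~` N) by apply: measurableI => //; exact: measurableC.
rewrite -(massE hmu _ mB) (massIC hmu _ mB mN).
rewrite (null_le hmu mBC (measurableC mN) (@subIsetr _ _ _) u1) addr0.
rewrite -(massD_null hmu u mBN (null_le hmu mBN mN (@subIsetr _ _ _) u2)) -xu (massE hmu) //.
apply: (le_trans (dom _ mBN (@subIsetr _ _ _))).
by rewrite -!lamE lee_wpmul2l ?lee_fin // le_measure ?inE.
Qed.

(** Let N c be the set where mu x is at most c times arc length. It has mass 0. Off
   all of them arc length is at most mu x / c for every c, hence 0. *)
Lemma maximal_mutually_singular x : mutually_singular (mu x) (@circle_lebesgue R).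
Proof.
have [lam [lamE _]] := @circle_lebesgue_measure R.
have fin1 : (mu x setT < +oo)%E by rewrite -(massE hmu) ?ltry.
have fin2 : (lam setT < +oo)%E.
  rewrite lamE /circle_lebesgue preimage_setT setIT lebesgue_measure_itv /=.
  by case: ifP => _; rewrite ltry.
have /choice[N hN] : forall c : nat, exists N, [/\ measurable N,
    forall B, measurable B -> B `<=` N -> (mu x B <= c%:R%:E * lam B)%E &
    forall B, measurable B -> B `<=` ~` N -> (c%:R%:E * lam B <= mu x B)%E].
  by move=> c; exact: hahn_comparison.
have mN c : measurable (N c) by case: (hN c).
have mU : measurable (\bigcup_c N c) by exact: bigcupT_measurable.
have mCU := measurableC mU.
exists (~` \bigcup_c N c); split=> //.
- rewrite setCK; apply: measure_negligible => //; apply: negligible_bigcup => c.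
  have null : mass mu x (N c) = 0.
    apply: (@dominated_null _ c) => // B mB BN.
    by rewrite -lamE; have [_ + _] := hN c; apply.
  by exists (N c); split=> //; rewrite -(massE hmu) // null.
- rewrite -lamE; have lfin : lam (~` \bigcup_c N c) \is a fin_num.
    rewrite ge0_fin_numE //; apply: le_lt_trans fin2.
    by apply: le_measure; rewrite ?inE.
  rewrite -(fineK lfin); congr (_%:E); apply/eqP; rewrite eq_le fine_ge0 // andbT.
  apply: (@archi_le _ (- sq x)) => c; rewrite addrC subr_le0.
  have [_ _ /(_ _ mCU)] := hN c; rewrite -(fineK lfin) -EFinM -(massE hmu) // lee_fin => h.
  apply: le_trans (mass_leT hmu x mCU); apply: h => z nz Nz; apply: nz; by exists c.
Qed.

End Singularity.

Section MaximalIsSingular.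
Context {R : realType} {H : hilbertType R}.

(** The measures mu x are the scalar measures of the spectral measure of T. *)
Lemma maximal_singular_unitary (T : {linear H -> H}) : harnack_maximal T -> singular_unitary T.
Proof.
move=> maxT; have uT := maximal_unitary maxT; split=> //.
have iT := unitary_isometry maxT.1 uT.
have hA : is_adjoint T (adjoint T).
  by apply: (@adjoint_exists _ _ _ 1) => [x y|c x|x]; rewrite ?raddfD ?linearZ ?mul1r ?iT.
have [S SE] := exists_linear (is_adjointD hA) (is_adjointZ hA).
have ST x : S (T x) = x by rewrite SE; exact: (congr1 (@^~ x) uT.1).
have TS x : T (S x) = x by rewrite SE; exact: (congr1 (@^~ x) uT.2).
have [mu hmu] := circle_family_exists iT.
have hB := splitting_borel TS iT hmu.
have [E hE] := spectral_family_exists hmu hB.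
have sE := family_spectral hmu hE iT.
exists E => // x; have [N [mN N1 N2]] := maximal_mutually_singular TS ST iT hmu hB maxT x.
exists N; split=> //.
rewrite (scalar_measureE (family_pvm hmu hE)); last exact: measurableC.
by rewrite (family_mass hmu hE) ?(massE hmu) //; exact: measurableC.
Qed.

End MaximalIsSingular.

Theorem theorem3p5 (R : realType) (H : hilbertType R) (T : {linear H -> H})
    (hT : contraction_op T) :
  harnack_maximal T <-> singular_unitary T.
Proof.
split; first exact: maximal_singular_unitary.
exact: singular_unitary_maximal.
Qed.
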